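(* Let $k$ be one of $\mathbb C$, $\mathbb R$ or $\mathbb R_+=[0,\infty)$, let $\Sigma$ be a rational fan (not necessarily complete) in $N_{\mathbb R}$, and let $X_\Sigma(k)$ and $Y_\Sigma(k)$ be the $T(k)$-spaces defined in the context. If $\Sigma$ is complete, then $Y_\Sigma(k)$ is $T(k)$-equivariantly homeomorphic to $X_\Sigma(k)$. In general, $Y_\Sigma(k)$ is a $T(k)$-equivariant strong deformation retract of $X_\Sigma(k)$.
   Context: $N$ is a free $\mathbb Z$-module of rank $n$ with dual $M=N^\vee$; $N_{\mathbb R}=N\otimes\mathbb R$, $M_{\mathbb R}=M\otimes\mathbb R$. A rational fan $\Sigma$ in $N_{\mathbb R}$ is a finite non-empty collection of strongly convex rational polyhedral cones, closed under taking faces and such that any two cones meet in a common face; it is complete if its cones cover $N_{\mathbb R}$. Regard $k$ as a multiplicative submonoid of $\mathbb C$. Set $\mathbb T(k)=\mathrm{Hom}(M,k)$ (monoid homomorphisms) and $T(k)=\mathrm{Hom}(M,k\cap S^1)$; thus $T(\mathbb C)\cong(S^1)^n$, $T(\mathbb R)\cong(\mathbb Z_2)^n$, $T(\mathbb R_+)=1$. For a cone $\sigma\in\Sigma$ with dual cone $\sigma^\vee\subset M_{\mathbb R}$ let $X_\sigma(k)=\mathrm{Hom}(\sigma^\vee\cap M,k)$ be the set of monoid homomorphisms, topologized (metric topology) by embedding it into some $k^L$ via finitely many generators of $\sigma^\vee\cap M$. $\mathbb T(k)$ and $T(k)$ act by pointwise multiplication. The toric variety $X_\Sigma(k)$ is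 obtained by gluing the $X_\sigma(k)$, $\sigma\in\Sigma$, as prescribed by the fan ($X_\tau(k)$ is open in $X_\sigma(k)$ for $\tau$ a face of $\sigma$). So $X_\Sigma(\mathbb C)$ is the usual complex toric variety, $X_\Sigma(\mathbb R)$ its real part and $X_\Sigma(\mathbb R_+)$ its non-negative part. The order complex $\mathcal F(\Sigma)$ is the simplicial complex whose $p$-simplices are the strictly ascending sequences $(\sigma_0<\dots<\sigma_p)$ in $\Sigma$, where $\tau\le\sigma$ means that $\tau$ is a face of $\sigma$; $|\mathcal F(\Sigma)|$ is its topological realization. For $\sigma\in\Sigma$ let $T_\sigma(k)=\{g\in T(k):\sigma^\perp\cap M\subset\ker g\}$. Define $$Y_\Sigma(k)=\bigl(T(k)\times|\mathcal F(\Sigma)|\bigr)/\!\sim,$$ where for $x\in|\mathcal F(\Sigma)|$ with supporting simplex $(\sigma_0,\dots,\sigma_p)$ (the unique simplex containing $x$ in its relative interior) one has $(t_1,x)\sim(t_2,x)$ if and only if $t_1t_2^{-1}\in T_{\sigma_0}(k)$. $T(k)$ acts through the first factor. That $Y_\Sigma(k)$ is a $T(k)$-equivariant strong deformation retract of $X_\Sigma(k)$ means that $Y_\Sigma(k)$ is $T(k)$-homeomorphic to a $T(k)$-stable subspace of $X_\Sigma(k)$ which is a strong deformation retract of $X_\Sigma(k)$ via a $T(k)$-equivariant homotopy. *)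

(* Defs.v *)
From HB Require Import structures.
From Stdlib Require Import Relation_Operators.
From mathcomp Require Import all_boot all_order all_algebra.
From mathcomp Require Import finmap generic_quotient.
From mathcomp Require Import all_classical all_reals.
From mathcomp Require Import topology function_spaces normedtype.
From mathcomp Require Import complex.
From mathcomp Require Import zify.

Set Implicit Arguments.
Unset Strict Implicit.
Unset Printing Implicit Defensive.

Import Order.TTheory GRing.Theory Num.Theory numFieldNormedType.Exports.
Local Open Scope classical_set_scope.
Local Open Scope quotient_scope.
Local Open Scope complex_scope.
Local Open Scope ring_scope.

(* A basis of N is fixed: N = 'cV[int]_n and N_R = 'cV[R]_n, with dual        *)
(* M = 'rV[int]_n and M_R = 'rV[R]_n.                                         *)
Section Cones.
Context {R : realType} {n : nat}.
Implicit Types (sigma tau : set 'cV[R]_n) (m : 'rV[int]_n).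

Definition pairing (u : 'rV[R]_n) (v : 'cV[R]_n) : R := (u *m v) 0 0.

Definition dual_cone sigma : set 'rV[R]_n :=
  [set u | forall v, sigma v -> 0 <= pairing u v].

Definition dual_monoid sigma : set 'rV[int]_n :=
  [set m | dual_cone sigma (map_mx intr m)].

Definition orth_lattice sigma : set 'rV[int]_n :=
  [set m | forall v, sigma v -> pairing (map_mx intr m) v = 0].

Definition rational_polyhedral_cone sigma :=
  exists r (v : 'I_r -> 'cV[int]_n),
    sigma = [set w | exists c : 'I_r -> R,
      (forall i, 0 <= c i) /\ w = \sum_i c i *: map_mx intr (v i)].

Definition strongly_convex sigma :=
  forall v, sigma v -> sigma (- v) -> v = 0.

Definition face tau sigma :=
  exists2 u, dual_cone sigma u & tau = [set v | sigma v /\ pairing u v = 0].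

Definition strict_face tau sigma := face tau sigma /\ tau <> sigma.

Definition is_fan (Sigma : {fset set 'cV[R]_n}) :=
  [/\ Sigma != fset0,
      forall sigma, sigma \in Sigma ->
        rational_polyhedral_cone sigma /\ strongly_convex sigma,
      forall sigma tau, sigma \in Sigma -> face tau sigma -> tau \in Sigma &
      forall sigma tau, sigma \in Sigma -> tau \in Sigma ->
        face (sigma `&` tau) sigma /\ face (sigma `&` tau) tau].

Definition complete (Sigma : {fset set 'cV[R]_n}) :=
  forall v, exists2 sigma, sigma \in Sigma & sigma v.

Definition generates (s : seq 'rV[int]_n) (S : set 'rV[int]_n) :=
  (forall m, m \in s -> S m) /\
  (forall m, S m -> exists c : 'I_(size s) -> nat, m = \sum_(i < size s) s`_i *+ c i).

(* The default value is never used for a rational cone, see generatorsP.      *)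
Definition generators sigma : seq 'rV[int]_n :=
  xget [::] [set s | generates s (dual_monoid sigma)].

End Cones.

Lemma dickson (T : Type) (I : eqType) (f : I -> T -> nat) (s : seq I)
    (P : set T) :
  exists t : seq T, (forall i, (i < size t)%N -> forall d, P (nth d t i)) /\
    forall x, P x -> exists2 i, (i < size t)%N &
      forall d j, j \in s -> (f j (nth d t i) <= f j x)%N.
Proof.
elim: s P => [|j s IHs] P.
  have [[x Px]|P0] := pselect (exists x, P x).
    exists [:: x]; split=> [[]//|y Py]; by exists 0%N.
  by exists [::]; split=> // x Px; case: P0; exists x.
have [t0 [t0P t0le]] := IHs P.
have slice c : exists t : seq T,
    (forall i, (i < size t)%N -> forall d, P (nth d t i)) /\
    forall x, P x -> (f j x < c)%N -> exists2 i, (i < size t)%N &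
      forall d l, l \in j :: s -> (f l (nth d t i) <= f l x)%N.
  elim: c => [|c [t [tP tle]]]; first by exists [::].
  have [t' [t'P t'le]] := IHs [set x | P x /\ f j x = c].
  exists (t ++ t'); split=> [i|x Px].
    rewrite size_cat => ilt d; rewrite nth_cat; case: ltnP => it; first exact: tP.
    by have [] := t'P (i - size t)%N _ d; rewrite // ltn_subLR.
  rewrite ltnS leq_eqVlt => /predU1P[fx|/(tle _ Px)[i it ile]]; last first.
    exists i => [|d l ls]; first by rewrite size_cat ltn_addr.
    by rewrite nth_cat it ile.
  have [i it ile] := t'le x (conj Px fx).
  exists (size t + i)%N => [|d l]; first by rewrite size_cat ltn_add2l.
  rewrite nth_cat ltnNge leq_addr /= addKn inE => /predU1P[->|]; last exact: ile.
  by have [_ ->] := t'P i it d; rewrite fx.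
have [t [tP tle]] := slice (\max_(y <- t0) f j y).
exists (t ++ t0); split=> [i|x Px].
  rewrite size_cat => ilt d; rewrite nth_cat; case: ltnP => it; first exact: tP.
  by apply: t0P; rewrite ltn_subLR.
have [/(tle _ Px)[i it ile]|maxle] := ltnP (f j x) (\max_(y <- t0) f j y).
  exists i => [|d l ls]; first by rewrite size_cat ltn_addr.
  by rewrite nth_cat it ile.
have [i it ile] := t0le x Px.
exists (size t + i)%N => [|d l]; first by rewrite size_cat ltn_add2l.
rewrite nth_cat ltnNge leq_addr /= addKn inE => /predU1P[->|]; last exact: ile.
apply: leq_trans maxle; rewrite (big_nth d) big_mkord.
exact: (@leq_bigmax _ (fun l : 'I__ => f j (nth d t0 l)) (Ordinal it)).
Qed.

Section Gordan.
Context {R : realType} {n : nat}.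

Lemma gordan (sigma : set 'cV[R]_n) : rational_polyhedral_cone sigma ->
  exists s, generates s (dual_monoid sigma).
Proof.
case=> r [v sigmaE].
pose S := [set m : 'rV[int]_n | forall i, 0 <= (m *m v i) 0 0].
have pairZ (m : 'rV[int]_n) i :
    pairing (map_mx intr m) (map_mx intr (v i)) = ((m *m v i) 0 0)%:~R :> R.
  by rewrite /pairing -map_mxM mxE.
have -> : dual_monoid sigma = S.
  rewrite sigmaE; apply/seteqP; split=> m /= mP.
    move=> i; rewrite -(ler0z R) -pairZ; apply: mP.
    exists (fun j => (j == i)%:R); split=> [j|]; first exact: ler0n.
    rewrite (bigD1 i)//= eqxx scale1r big1 ?addr0// => j /negPf->.
    by rewrite scale0r.
  move=> _ [c [c0 ->]]; rewrite /pairing mulmx_sumr summxE.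
  apply: sumr_ge0 => i _; rewrite -scalemxAr mxE mulr_ge0//.
  by have := pairZ m i; rewrite /pairing => ->; rewrite ler0z; apply: mP.
pose f (i : 'I_n * bool + 'I_r) (m : 'rV[int]_n) : nat :=
  match i with
  | inl (j, b) => absz (Num.max 0 (if b then m 0 j else - m 0 j))
  | inr j => absz ((m *m v j) 0 0)
  end.
have [s [sP sle]] := dickson f (enum {: 'I_n * bool + 'I_r})
  [set m | S m /\ m != 0].
have S0 : S 0 by move=> i; rewrite mul0mx mxE.
have sS m : m \in s -> S m /\ m != 0.
  by move=> ms; rewrite -(nth_index 0 ms); apply: sP; rewrite index_mem.
exists s; split=> [m /sS[]//|m Sm].
pose h (m : 'rV[int]_n) := (\sum_j `|m ord0 j|)%N.
have [N hN] := ubnP (h m); elim: N => // N IHN in m hN Sm *.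
have [->|m0] := eqVneq m 0.
  by exists (fun=> 0%N); rewrite big1// => i _; rewrite mulr0n.
have [i il ile] := sle m (conj Sm m0).
set y := nth 0 s i in ile.
have {}ile j : (f j y <= f j m)%N by apply: ile; rewrite mem_enum.
have [Sy y0] : S y /\ y != 0 by apply: sS; rewrite mem_nth.
have hy j : `|m ord0 j|%N = (`|m ord0 j - y ord0 j| + `|y ord0 j|)%N.
  have key (a b : int) : (absz (Num.max 0%R b) <= absz (Num.max 0%R a))%N ->
      (absz (Num.max 0%R (- b)%R) <= absz (Num.max 0%R (- a)%R))%N ->
      `|a|%N = (`|a - b| + `|b|)%N.
    rewrite /Num.max; case: (ltP 0 a) => ?; case: (ltP 0 b) => ?;
    case: (ltP 0 (- a)) => ?; case: (ltP 0 (- b)) => ?; lia.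
  exact: key (ile (inl (j, true))) (ile (inl (j, false))).
have [|k|c mE] := IHN (m - y).
- have hmy : h m = (h (m - y)%R + h y)%N.
    by rewrite /h -big_split; apply: eq_bigr => j _; rewrite hy !mxE.
  have : (0 < h y)%N.
    rewrite lt0n; apply: contra_neq y0 => /eqP; rewrite sum_nat_eq0 => /forallP hy0.
    by apply/rowP => j; apply/eqP; rewrite mxE -absz_eq0; have := hy0 j.
  by move: hN; rewrite hmy; lia.
- have -> : ((m - y) *m v k) 0 0 = (m *m v k) 0 0 - (y *m v k) 0 0.
    by rewrite mulmxBl [LHS]mxE [X in _ + X]mxE.
  move: (ile (inr k)) (Sm k) (Sy k) => /=.
  by move: ((m *m _) _ _) ((y *m _) _ _) => a b; lia.
exists (fun j => c j + (j == Ordinal il))%N.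
rewrite -[LHS](subrK y) mE; under [RHS]eq_bigr do rewrite mulrnDr.
rewrite big_split/=; congr (_ + _).
by rewrite (bigD1 (Ordinal il))//= eqxx mulr1n big1 ?addr0// => j /negPf->.
Qed.

Lemma generatorsP (sigma : set 'cV[R]_n) : rational_polyhedral_cone sigma ->
  generates (generators sigma) (dual_monoid sigma).
Proof. by move=> /gordan; exact: xgetPex. Qed.

End Gordan.

Variant scalars := Complexes | Reals | NonnegReals.

Definition scalar_set (R : realType) (k : scalars) : set R[i] :=
  match k with
  | Complexes => setT
  | Reals => [set z | z \is Num.real]
  | NonnegReals => [set z | 0 <= z]
  end.

Section Scalars.
Context {R : realType}.
Variable k : scalars.
Notation K := (@scalar_set R k).

Lemma scalar_setM x y : K x -> K y -> K (x * y).
Proof. by case: k => //=; [exact: realM|exact: mulr_ge0]. Qed.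

Lemma scalar_setV x : K x -> K x^-1.
Proof. by case: k => //=; [rewrite realV|rewrite invr_ge0]. Qed.

End Scalars.

(* Monoid homomorphisms from an additive submonoid S of M to a multiplicative *)
(* submonoid K of the complex numbers, extended by 0 outside S.               *)
Definition monoid_hom (R : realType) n (S : set 'rV[int]_n) (K : set R[i]) :
    set ('rV[int]_n -> R[i]) :=
  [set x | [/\ x 0 = 1,
     forall m m', S m -> S m' -> x (m + m') = x m * x m',
     forall m, S m -> K (x m) &
     forall m, ~ S m -> x m = 0]].

Section Torus.
Context (R : realType) (n : nat) (k : scalars).

Definition torus_set : set ('rV[int]_n -> R[i]) :=
  monoid_hom setT (scalar_set k `&` [set z | `|z| = 1]).

Definition torus_coord (g : torus_set) : 'rV[R[i]^o]_n :=
  \row_i set_val g (delta_mx 0 i).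

Definition torus : topologicalType := initial_topology torus_coord.

Definition tval (g : torus) : 'rV[int]_n -> R[i] := set_val (g : torus_set).

Lemma tvalP (g : torus) : torus_set (tval g).
Proof. exact: set_valP. Qed.

Lemma torus_mul_subproof (g h : torus) :
  torus_set (fun m => tval g m * tval h m).
Proof.
have [g1 gM gK _] := tvalP g; have [h1 hM hK _] := tvalP h.
split=> [|m m' _ _|m _|m []//]; first by rewrite g1 h1 mulr1.
- by rewrite gM// hM// mulrACA.
have [[gk /= gS] [hk /= hS]] := (gK m I, hK m I).
by split; [exact: scalar_setM|rewrite /= normrM gS hS mulr1].
Qed.

Definition torus_mul (g h : torus) : torus :=
  SigSub (mem_set (torus_mul_subproof g h)) : torus_set.

Lemma tval_mul g h m : tval (torus_mul g h) m = tval g m * tval h m.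
Proof. by rewrite /tval set_valE. Qed.

Lemma torus_inv_subproof (g : torus) : torus_set (fun m => (tval g m)^-1).
Proof.
have [g1 gM gK _] := tvalP g.
split=> [|m m' _ _|m _|m []//]; first by rewrite g1 invr1.
- by rewrite gM// invfM.
have [gk /= gS] := gK m I.
by split; [exact: scalar_setV|rewrite /= normfV gS invr1].
Qed.

Definition torus_inv (g : torus) : torus :=
  SigSub (mem_set (torus_inv_subproof g)) : torus_set.

Lemma tval_inv g m : tval (torus_inv g) m = (tval g m)^-1.
Proof. by rewrite /tval set_valE. Qed.

Definition cone_subtorus (sigma : set 'cV[R]_n) : set torus :=
  [set g | forall m, orth_lattice sigma m -> tval g m = 1].

Lemma cone_subtorus1 sigma g : cone_subtorus sigma (torus_mul g (torus_inv g)).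
Proof.
move=> m _; rewrite tval_mul tval_inv mulfV// -normr_eq0.
by have [_ _ /(_ m I)[_ /= ->] _] := tvalP g; exact: oner_neq0.
Qed.

End Torus.

Section ToricVariety.
Context (R : realType) (n : nat) (k : scalars).
Implicit Types sigma tau : set 'cV[R]_n.

Definition chart_set sigma : set ('rV[int]_n -> R[i]) :=
  monoid_hom (dual_monoid sigma) (scalar_set k).

Definition chart_coord sigma (x : chart_set sigma) :
    'rV[R[i]^o]_(size (generators sigma)) :=
  \row_i set_val x (generators sigma)`_i.

Definition chart sigma : topologicalType := initial_topology (@chart_coord sigma).

Definition cval sigma (x : chart sigma) : 'rV[int]_n -> R[i] :=
  set_val (x : chart_set sigma).

Lemma cvalP sigma (x : chart sigma) : chart_set sigma (cval x).
Proof. exact: set_valP. Qed.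

Lemma chart_act_subproof sigma (g : torus R n k) (x : chart sigma) :
  chart_set sigma (fun m => tval g m * cval x m).
Proof.
have [g1 gM gK _] := tvalP g; have [x1 xM xK x0] := cvalP x.
split=> [|m m' Sm Sm'|m Sm|m Sm]; first by rewrite g1 x1 mulr1.
- by rewrite gM// xM// mulrACA.
- by apply: scalar_setM; [have [] := gK m I|exact: xK].
- by rewrite x0// mulr0.
Qed.

Definition chart_act sigma (g : torus R n k) (x : chart sigma) : chart sigma :=
  SigSub (mem_set (chart_act_subproof g x)) : chart_set sigma.

Lemma cval_act sigma g (x : chart sigma) m :
  cval (chart_act g x) m = tval g m * cval x m.
Proof. by rewrite /cval set_valE. Qed.

Variable Sigma : {fset set 'cV[R]_n}.

Definition charts : topologicalType := {sigma : Sigma & chart (val sigma)}.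

Definition charts_act (g : torus R n k) (p : charts) : charts :=
  existT (fun sigma : Sigma => chart (val sigma)) (projT1 p)
    (chart_act g (projT2 p)).

(* q is the image of p under the map restricting homomorphisms from           *)
(* dual_monoid tau to dual_monoid sigma, for tau a face of sigma.             *)
Definition glue_step (p q : charts) :=
  face (val (projT1 p)) (val (projT1 q)) /\
  forall m, dual_monoid (val (projT1 q)) m ->
    cval (projT2 q) m = cval (projT2 p) m.

Definition glue (p q : charts) : bool :=
  `[< clos_refl_sym_trans charts glue_step p q >].

Lemma glue_refl : reflexive glue.
Proof. by move=> p; apply/asboolP; exact: rst_refl. Qed.

Lemma glue_sym : symmetric glue.
Proof. by move=> p q; apply/asboolP/asboolP; exact: rst_sym. Qed.

Lemma glue_trans : transitive glue.
Proof.
by move=> q p r /asboolP pq /asboolP qr; apply/asboolP; exact: rst_trans pq qr.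
Qed.

Canonical glue_equiv := EquivRel glue glue_refl glue_sym glue_trans.

Definition toric : topologicalType := quotient_topology {eq_quot glue_equiv}.

Lemma glue_act g (p q : charts) :
  clos_refl_sym_trans charts glue_step p q ->
  clos_refl_sym_trans charts glue_step (charts_act g p) (charts_act g q).
Proof.
elim=> [a b [fab gab]|a|a b _|a b c _ ab _ bc].
- by apply: rst_step; split=> // m Sm; rewrite !cval_act gab.
- exact: rst_refl.
- exact: rst_sym.
- exact: rst_trans ab bc.
Qed.

Definition toric_act (g : torus R n k) (x : toric) : toric :=
  \pi_toric (charts_act g (repr x)).

Lemma toric_act_pi g (p : charts) :
  toric_act g (\pi_toric p) = \pi_toric (charts_act g p).
Proof.
apply/eqmodP/asboolP; rewrite /toric_act.
have /eqmodP/asboolP : repr (\pi_toric p) = p %[mod {eq_quot glue_equiv}].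
  exact: reprK.
exact: glue_act.
Qed.

End ToricVariety.

Section OrderComplex.
Context (R : realType) (n : nat) (Sigma : {fset set 'cV[R]_n}).

(* s lists an ascending sequence sigma_0 < ... < sigma_p whose simplex        *)
(* contains the point with barycentric coordinates x in its relative          *)
(* interior.                                                                  *)
Definition supporting_simplex (x : Sigma -> R) (s : seq Sigma) :=
  sorted (fun tau sigma => `[< strict_face (val tau) (val sigma) >]) s /\
  forall sigma, (x sigma != 0) = (sigma \in s).

Definition realization_set : set {ptws Sigma -> R} :=
  [set x | [/\ forall sigma, 0 <= x sigma, \sum_sigma x sigma = 1 &
               exists s, supporting_simplex x s]].

Definition realization : topologicalType := realization_set.

Variable k : scalars.

Definition Yprod : topologicalType := (torus R n k * realization)%type.

Definition Yrel (p q : Yprod) : bool :=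
  `[< p.2 = q.2 /\
      forall sigma0 s, supporting_simplex (set_val p.2) (sigma0 :: s) ->
        cone_subtorus (val sigma0) (torus_mul p.1 (torus_inv q.1)) >].

Lemma Yrel_refl : reflexive Yrel.
Proof.
by move=> p; apply/asboolP; split=> // sigma0 s _; exact: cone_subtorus1.
Qed.

Lemma Yrel_sym : symmetric Yrel.
Proof.
suff imp p q : Yrel p q -> Yrel q p by move=> p q; apply/idP/idP; exact: imp.
move=> /asboolP[pq H]; apply/asboolP; split=> // sigma0 s; rewrite -pq => /H {}H.
move=> m /H; rewrite !(tval_mul, tval_inv) => /(congr1 GRing.inv).
by rewrite invfM invrK invr1 mulrC.
Qed.

Lemma Yrel_trans : transitive Yrel.
Proof.
move=> q p r /asboolP[pq H1] /asboolP[qr H2]; apply/asboolP.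
split=> [|sigma0 s hs m mo]; first by rewrite pq.
have := H1 _ _ hs m mo; rewrite pq in hs; have := H2 _ _ hs m mo.
have := cone_subtorus1 q.1 mo; rewrite !(tval_mul, tval_inv) => qq qr' pq'.
rewrite -[tval p.1 m]mulr1 -[X in _ * X / _]qq [tval q.1 m * _]mulrC mulrA.
by rewrite -[LHS]mulrA qr' pq' mulr1.
Qed.

Canonical Yequiv := EquivRel Yrel Yrel_refl Yrel_sym Yrel_trans.

Definition Yspace : topologicalType := quotient_topology {eq_quot Yequiv}.

Definition Yact (g : torus R n k) (y : Yspace) : Yspace :=
  \pi_Yspace (torus_mul g (repr y).1, (repr y).2).

Lemma Yact_pi g (p : Yprod) :
  Yact g (\pi_Yspace p) = \pi_Yspace (torus_mul g p.1, p.2).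
Proof.
apply/eqmodP/asboolP => /=.
have /eqmodP/asboolP[e H] : repr (\pi_Yspace p) = p %[mod {eq_quot Yequiv}].
  exact: reprK.
split=> // sigma0 s /H {}H m mo.
have := H m mo; have := cone_subtorus1 g mo; rewrite !(tval_mul, tval_inv).
by move=> gg rr; rewrite invfM mulrACA gg rr mulr1.
Qed.

End OrderComplex.

Section EquivariantTopology.
Context {G : Type}.

Definition equivariant {X Y : Type} (aX : G -> X -> X) (aY : G -> Y -> Y)
    (f : X -> Y) :=
  forall g x, f (aX g x) = aY g (f x).

Definition equivariantly_homeomorphic {X Y : topologicalType}
    (aX : G -> X -> X) (aY : G -> Y -> Y) :=
  exists (f : X -> Y) (f' : Y -> X),
    [/\ cancel f f', cancel f' f, continuous f, continuous f' &
        equivariant aX aY f].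

Definition stable {X : Type} (aX : G -> X -> X) (A : set X) :=
  forall g x, A x -> A (aX g x).

Definition sub_act {X : Type} (aX : G -> X -> X) (A : set X)
    (sA : stable aX A) (g : G) (a : A) : A :=
  SigSub (mem_set (sA g (set_val a) (set_valP a))).

Definition equivariant_strong_deformation {R : realType} {X : topologicalType}
    (aX : G -> X -> X) (A : set X) (H : R * X -> X) :=
  [/\ {within `[0, 1] `*` setT, continuous H},
      forall x, H (0, x) = x,
      forall x, A (H (1, x)),
      forall t a, 0 <= t <= 1 -> A a -> H (t, a) = a &
      forall t, 0 <= t <= 1 -> equivariant aX aX (fun x => H (t, x))].

Definition equivariant_strong_deformation_retract (R : realType)
    {X Y : topologicalType} (aY : G -> Y -> Y) (aX : G -> X -> X) :=
  exists (A : set X) (sA : stable aX A),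
    equivariantly_homeomorphic aY (sub_act sA) /\
    exists H : R * X -> X, equivariant_strong_deformation aX A H.

End EquivariantTopology.

(* Main.v *)
(* A point of X_Sigma(k) is a pair (tau, chi): the cone tau of its orbit and  *)
(* a character chi of tau^\perp, which is extended by 0 to M; z tends to z0   *)
(* iff eventually the cone of z lies in that of z0 and the values tend on the *)
(* dual monoid of the latter. With v_sigma the sum of generators of sigma,    *)
(* the order complex embeds in the non-negative part: a point with weights y  *)
(* on the chain sigma_0 < ... < sigma_p goes to (sigma_0, chi) with           *)
(*   chi(m) = exp (- \sum_i (y_i / (y_0 + ... + y_(i-1))) <m, v_(sigma_i)>).  *)
(* The barycentric coordinates extend from the image to X_Sigma(R_+) by       *)
(* Tietze's theorem, applied to compactified charts. The extension can be     *)
(* made positive on the orbit of sigma and zero off the chart of sigma, and   *)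
(* since the order complex is a flag complex its support can be truncated to  *)
(* a chain: this gives a retraction r onto the order complex that preserves   *)
(* orbits. Moving |chi| geometrically to r is the deformation; arguments are  *)
(* carried along. For complete Sigma the embedding is onto, as barycentric    *)
(* subdivisions of the stars of the cones cover their quotients of N_R. The   *)
(* map z |-> [arg z, r z] into Y_Sigma(k) is continuous, although arg z is    *)
(* not, because the torus is compact.                                         *)

From Stdlib Require Import Relation_Operators.
From mathcomp Require Import all_boot all_order all_algebra finmap.
From mathcomp Require Import generic_quotient.
From mathcomp Require Import all_classical all_reals.
From mathcomp Require Import topology function_spaces normedtype.
From mathcomp Require Import sequences exp numfun urysohn complex zify lra.
Require Import Defs.

Set Implicit Arguments.
Unset Strict Implicit.
Unset Printing Implicit Defensive.

Import Order.TTheory GRing.Theory Num.Theory numFieldNormedType.Exports.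
Local Open Scope classical_set_scope.
Local Open Scope quotient_scope.
Local Open Scope complex_scope.
Local Open Scope ring_scope.

(** * Rational cones and fans *)

(** The angular and the radial directions separate. A point z amounts to its orbit cone [ot z] and a
    character [ch z] of ([ot z])^perp; convergence in these terms is [near_sle], [ch_cvg] and,
    conversely, [toric_cvg]. The character is its modulus times a phase, and the phase is an element
    of T(k) well defined up to the subtorus of [ot z] ([phase_ex], [Psi_phase]). This is exactly the
    identification made in Y over chains with least cone [ot z], so the task is to embed the order
    complex in the non-negative part and to retract onto it, preserving orbits.

    Embedding [phi]. On the non-negative part of the orbit of rho, minus the logarithm of a
    character is a point of N_R / span(rho). A chain starting at rho contributes a non-negative
    combination of the barycenters of its larger cones. Such combinations are unique, because the
    star of rho, barycentrically subdivided, is a fan in the quotient ([flag_weights_inj],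
    [ev_inj]). The coefficients y_i / (y_0 + ... + y_(i-1)) are chosen so that the one at sigma_i
    blows up when the weights below sigma_i vanish, which is convergence to the orbit of sigma_i
    ([ev_cvg]). For a complete fan the star covers the quotient ([complete_star],
    [star_decomposition]), so [phi] reaches the whole non-negative part ([ev_surj]).

    Retraction. The order complex is compact ([realization_compact]). The map [theta] sends a chart
    to a vector space, injectively up to phases, and the rest of the variety to 0, so Tietze's
    theorem extends each barycentric coordinate to a [bump]. Truncation to a chain gives [retract],
    and [mn_retract] says that orbits are preserved. Hence z and its image have non-zero values on
    the same lattice, and their moduli can be interpolated geometrically; [slide_le] gives
    continuity across orbits. The homotopy ends at the composite of [Psi] and [Phi], while [PhiK]
    makes [Phi] an embedding. *)

Section Pairing.
Context {R : realType} {n : nat}.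
Implicit Types (u : 'rV[R]_n) (v w : 'cV[R]_n) (m : 'rV[int]_n).

Lemma pairingDr u v w : pairing u (v + w) = pairing u v + pairing u w.
Proof. by rewrite /pairing mulmxDr mxE. Qed.

Lemma pairingZr u c v : pairing u (c *: v) = c * pairing u v.
Proof. by rewrite /pairing -scalemxAr mxE. Qed.

Lemma pairingNr u v : pairing u (- v) = - pairing u v.
Proof. by rewrite /pairing mulmxN mxE. Qed.

Lemma pairing0r u : pairing u 0 = 0.
Proof. by rewrite /pairing mulmx0 mxE. Qed.

Lemma pairingBr u v w : pairing u (v - w) = pairing u v - pairing u w.
Proof. by rewrite pairingDr pairingNr. Qed.

Lemma pairing_sumr u (I : Type) (r : seq I) P (F : I -> 'cV[R]_n) :
  pairing u (\sum_(i <- r | P i) F i) = \sum_(i <- r | P i) pairing u (F i).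
Proof. by rewrite /pairing mulmx_sumr summxE. Qed.

Definition pr m v : R := pairing (map_mx intr m) v.

Lemma prDl m m' v : pr (m + m') v = pr m v + pr m' v.
Proof. by rewrite /pr /pairing map_mxD mulmxDl mxE. Qed.

Lemma pr0l v : pr 0 v = 0.
Proof. by rewrite /pr /pairing map_mx0 mul0mx mxE. Qed.

Lemma prNl m v : pr (- m) v = - pr m v.
Proof. by rewrite /pr /pairing map_mxN mulNmx mxE. Qed.

Lemma prMnl m c v : pr (m *+ c) v = pr m v *+ c.
Proof. by elim: c => [|c IH]; rewrite ?mulr0n ?pr0l// !mulrS prDl IH. Qed.

Lemma prZl (c : int) m v : pr (c *: m) v = c%:~R * pr m v.
Proof.
rewrite /pr /pairing (_ : map_mx _ _ = c%:~R *: map_mx intr m).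
  by rewrite -scalemxAl mxE.
by apply/rowP => i; rewrite !mxE intrM.
Qed.

Lemma pr_suml (I : Type) (r : seq I) P (F : I -> 'rV[int]_n) v :
  pr (\sum_(i <- r | P i) F i) v = \sum_(i <- r | P i) pr (F i) v.
Proof.
elim/big_rec2 : _ => [|i x y _ <-]; first exact: pr0l.
by rewrite prDl.
Qed.

Lemma prI m (v : 'cV[int]_n) : pr m (map_mx intr v) = ((m *m v) 0 0)%:~R.
Proof. by rewrite /pr /pairing -map_mxM mxE. Qed.

Lemma orth_latticeD (S : set 'cV[R]_n) m m' :
  orth_lattice S m -> orth_lattice S m' -> orth_lattice S (m + m').
Proof. by move=> h h' v Sv; rewrite [LHS]prDl [pr _ _]h// [pr _ _]h'// addr0. Qed.

Lemma orth_latticeN (S : set 'cV[R]_n) m :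
  orth_lattice S m -> orth_lattice S (- m).
Proof. by move=> h v Sv; rewrite [LHS]prNl [pr _ _]h// oppr0. Qed.

Lemma orth_lattice0 (S : set 'cV[R]_n) : orth_lattice S 0.
Proof. by move=> v Sv; exact: pr0l. Qed.

Lemma dual_monoidD (S : set 'cV[R]_n) m m' :
  dual_monoid S m -> dual_monoid S m' -> dual_monoid S (m + m').
Proof.
by move=> h h' v Sv; rewrite [leRHS]prDl addr_ge0//; [exact: h|exact: h'].
Qed.

Lemma dual_monoid0 (S : set 'cV[R]_n) : dual_monoid S 0.
Proof. by move=> v Sv; rewrite [leRHS]pr0l. Qed.

Lemma dual_monoidMn (S : set 'cV[R]_n) m c :
  dual_monoid S m -> dual_monoid S (m *+ c).
Proof. by move=> h v Sv; rewrite [leRHS]prMnl mulrn_wge0//; exact: h. Qed.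

Lemma orth_dual (S : set 'cV[R]_n) m : orth_lattice S m -> dual_monoid S m.
Proof. by move=> h v Sv; rewrite h. Qed.

Lemma dual_monoidS (S S' : set 'cV[R]_n) m :
  S `<=` S' -> dual_monoid S' m -> dual_monoid S m.
Proof. by move=> SS' h v /SS'; exact: h. Qed.

Lemma orth_latticeS (S S' : set 'cV[R]_n) m :
  S `<=` S' -> orth_lattice S' m -> orth_lattice S m.
Proof. by move=> SS' h v /SS'; exact: h. Qed.

End Pairing.

(** * Cones as solution sets of integral inequalities *)

Section FinitelyGeneratedCones.
Context {R : realType} {n : nat}.
Implicit Types (s : seq 'cV[int]_n) (w : 'cV[R]_n).
Local Notation toR := (map_mx (intr : int -> R)).

Fixpoint cspan s : set 'cV[R]_n :=
  if s is v :: s' then [set w | exists2 c, 0 <= c & cspan s' (w - c *: toR v)]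
  else [set 0].

(* Fourier-Motzkin: one generator is eliminated at a time, which keeps the    *)
(* inequalities integral although the cone is real.                           *)
Lemma weyl s : exists ms : seq 'rV[int]_n,
  forall w, cspan s w <-> forall m, m \in ms -> 0 <= pr m w.
Proof.
elim: s => [|v s [ms msP]].
  pose d (i : 'I_n) : 'rV[int]_n := delta_mx 0 i.
  exists ([seq d i | i <- enum 'I_n] ++ [seq - d i | i <- enum 'I_n]) => w.
  split=> [->|h]; first by move=> m _; rewrite /pr pairing0r.
  have dE i : pr (d i) w = w i 0.
    rewrite /pr /pairing mxE (bigD1 i)//= !mxE !eqxx mul1r big1 ?addr0// => j ji.
    by rewrite !mxE (negPf ji) mul0r.
  apply/matrixP => i j; rewrite ord1 mxE; apply/eqP; rewrite eq_le -dE.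
  rewrite -oppr_ge0 -prNl !h// mem_cat; apply/orP; first by left; exact: map_f (mem_enum _ _).
  by right; apply: (map_f (fun i => - d i)); rewrite mem_enum.
pose a (m : 'rV[int]_n) : int := (m *m v) 0 0.
pose pos := [seq m <- ms | 0 < a m]; pose neg := [seq m <- ms | a m < 0].
(* The combined forms vanish on [v] and, since a m > 0 > a m', are non-negative combinations of old
   ones. *)
exists ([seq m <- ms | 0 <= a m] ++
        [seq a m *: m' - a m' *: m | m <- pos, m' <- neg]) => w.
have stepE m c : pr m (w - c *: toR v) = pr m w - c * (a m)%:~R.
  by rewrite /pr pairingBr pairingZr [pairing _ (toR v)]prI.
split=> [[c c0 /msP wP] m|h].
  have wP' m' : m' \in ms -> c * (a m')%:~R <= pr m' w.
    by move=> /wP; rewrite stepE subr_ge0.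
  rewrite mem_cat => /orP[|/allpairsP[[m1 m2] /= [+ + ->]]].
    rewrite mem_filter => /andP[am /wP']; apply: le_trans.
    by rewrite mulr_ge0// ler0z.
  rewrite !mem_filter => /andP[a1 /wP' h1] /andP[a2 /wP' h2].
  rewrite prDl prNl !prZl.
  have {}a1 : 0 < (a m1)%:~R :> R by rewrite ltr0z.
  have {}a2 : (a m2)%:~R < 0 :> R by rewrite ltrz0.
  by nra.
(* The least multiple of [v] whose removal satisfies the forms that are negative on [v]; the
   combined forms say that it is not too large for the positive ones. *)
pose c : R := \big[Num.max/0]_(m <- neg) (pr m w / (a m)%:~R).
exists c; first exact: bigmax_ge_id.
apply/msP => m mms; rewrite stepE subr_ge0.
have [am|am|am] := ltgtP 0 (a m).
- have am' : 0 < (a m)%:~R :> R by rewrite ltr0z.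
  rewrite -ler_pdivlMr// /c big_seq; apply: bigmax_le => [|m' m'neg].
    by rewrite divr_ge0 ?(ltW am')//; apply: h; rewrite mem_cat mem_filter mms ltW.
  have : 0 <= pr (a m *: m' - a m' *: m) w.
    apply: h; rewrite mem_cat; apply/orP; right; apply/allpairsP.
    by exists (m, m'); split=> //; rewrite mem_filter am.
  move: m'neg; rewrite mem_filter => /andP[am0 _].
  have {}am0 : (a m')%:~R < 0 :> R by rewrite ltrz0.
  rewrite prDl prNl !prZl ler_ndivrMr// mulrAC ler_pdivrMr// [_ * pr m' w]mulrC.
  by rewrite subr_ge0 [pr m w * _]mulrC.
- have am' : (a m)%:~R < 0 :> R by rewrite ltrz0.
  rewrite -ler_ndivrMr//; apply: (le_bigmax_seq _ m) => //.
  by rewrite mem_filter am.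
- by rewrite -am mulr0 h// mem_cat mem_filter mms -am lexx.
Qed.

Lemma cspan0 s : cspan s 0.
Proof. by have [ms msP] := weyl s; apply/msP => m _; rewrite /pr pairing0r. Qed.

Lemma cspanD s w w' : cspan s w -> cspan s w' -> cspan s (w + w').
Proof.
have [ms msP] := weyl s; move=> /msP h /msP h'; apply/msP => m mms.
by rewrite /pr pairingDr addr_ge0 ?h ?h'.
Qed.

Lemma cspan_gen s v : v \in s -> cspan s (toR v).
Proof.
elim: s => //= x s IH; rewrite inE => /predU1P[->|/IH vs].
  by exists 1 => //; rewrite scale1r subrr; exact: cspan0.
by exists 0 => //; rewrite scale0r subr0.
Qed.

Lemma cspan_sum s : cspan s (\sum_(v <- s) toR v).
Proof.
rewrite big_seq; elim/big_ind : _ => [|x y|v vs]; first exact: cspan0.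
- exact: cspanD.
- exact: cspan_gen.
Qed.

Lemma cspan_cat s s' w : cspan (s ++ s') w <->
  exists w1 w2, [/\ cspan s w1, cspan s' w2 & w = w1 + w2].
Proof.
elim: s w => [|v s IH] w /=.
  split=> [h|[_ [w2 [-> h ->]]]]; last by rewrite add0r.
  by exists 0, w; rewrite add0r.
split=> [[c c0 /IH[w1 [w2 [h1 h2 e]]]]|[w1 [w2 [[c c0 h1] h2 ->]]]].
  exists (w1 + c *: toR v), w2; split=> //; first by exists c => //; rewrite addrK.
  by rewrite addrAC -e subrK.
exists c => //; apply/IH; exists (w1 - c *: toR v), w2; split=> //.
by rewrite addrAC.
Qed.

Lemma cspanN s w : cspan [seq - v | v <- s] w <-> cspan s (- w).
Proof.
elim: s w => [|v s IH] w /=.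
  by split=> [->|/eqP]; rewrite ?oppr0// oppr_eq0 => /eqP.
have e c : - (w - c *: toR (- v)) = - w - c *: toR v.
  by rewrite map_mxN scalerN opprK opprD.
by split=> -[c c0 h]; exists c => //; [rewrite -e; exact/IH|apply/IH; rewrite e].
Qed.

Lemma cspan_ge0 (u : 'rV[R]_n) s :
  (forall v, v \in s -> 0 <= pairing u (toR v)) ->
  forall w, cspan s w -> 0 <= pairing u w.
Proof.
elim: s => [|v s IH] us w /= => [->|[c c0 /IH]]; first by rewrite pairing0r.
rewrite pairingBr subr_ge0 pairingZr => h; apply: le_trans (h _) => [|x xs].
  by rewrite mulr_ge0// us// mem_head.
by rewrite us// in_cons xs orbT.
Qed.

Lemma cspan_eq0 (u : 'rV[R]_n) s :
  (forall v, v \in s -> pairing u (toR v) = 0) ->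
  forall w, cspan s w -> pairing u w = 0.
Proof.
elim: s => [|v s IH] us w /= => [->|[c c0 /IH]]; first by rewrite pairing0r.
rewrite pairingBr pairingZr us ?mem_head// mulr0 subr0; apply=> x xs.
by rewrite us// in_cons xs orbT.
Qed.

Lemma rational_cspan (sigma : set 'cV[R]_n) : rational_polyhedral_cone sigma ->
  exists s, sigma = cspan s.
Proof.
case=> r [v ->]; exists [seq v i | i <- enum 'I_r].
suff H (l : seq 'I_r) w : uniq l -> cspan [seq v i | i <- l] w <->
    exists c : 'I_r -> R, (forall i, 0 <= c i) /\
      w = \sum_(i <- l) c i *: toR (v i).
  apply/seteqP; split=> w /=.
    move=> [c [c0 ->]]; apply/H; first exact: enum_uniq.
    by exists c; split=> //; rewrite big_enum.
  move=> /H[|c [c0 ->]]; first exact: enum_uniq.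
  by exists c; split=> //; rewrite big_enum.
elim: l w => [|i l IH] w /=.
  move=> _; split=> [->|[c [c0 ->]]]; last by rewrite big_nil.
  by exists (fun=> 0); rewrite big_nil.
move=> /andP[il ul]; split=> [[b b0 /IH[//|c [c0 e]]]|[c [c0 ->]]].
  exists (fun j => if j == i then b else c j); split=> [j|]; first by case: ifP.
  rewrite big_cons eqxx -[LHS](subrK (b *: toR (v i))) addrC e; congr (_ + _).
  rewrite big_seq [RHS]big_seq; apply: eq_bigr => j jl.
  by case: eqP => // ji; rewrite -ji jl in il.
exists (c i) => //; apply/IH => //; exists c; split=> //.
by rewrite big_cons addrC addKr.
Qed.

End FinitelyGeneratedCones.

(** * Integral forms cutting out and separating the cones of a fan *)

Section Fan.
Context {R : realType} {n : nat} {Sigma : {fset set 'cV[R]_n}}.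
Hypothesis hS : is_fan Sigma.
Implicit Types sigma tau rho : Sigma.
Local Notation toR := (map_mx (intr : int -> R)).

Definition gens sigma : seq 'cV[int]_n := xget [::] [set s | val sigma = cspan s].

Lemma gensP sigma : val sigma = cspan (gens sigma).
Proof.
have [_ /(_ _ (valP sigma))[rs _] _ _] := hS.
have [s sE] := rational_cspan rs.
by rewrite /gens; case: xgetP => [_ _ -> //|/(_ s)].
Qed.

(** A point of the relative interior: a form that is non-negative on sigma vanishes on sigma as soon
    as it vanishes here ([bary_orth]). *)
Definition bary sigma : 'cV[int]_n := \sum_(v <- gens sigma) v.

Lemma toR_bary sigma : toR (bary sigma) = \sum_(v <- gens sigma) toR v.
Proof. by rewrite /bary raddf_sum. Qed.

Lemma bary_in sigma : val sigma (toR (bary sigma)).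
Proof. by rewrite gensP toR_bary; exact: cspan_sum. Qed.

Lemma gens_in sigma v : v \in gens sigma -> val sigma (toR v).
Proof. by move=> vs; rewrite gensP; exact: cspan_gen. Qed.

Lemma bary_orth sigma u : dual_cone (val sigma) u ->
  pairing u (toR (bary sigma)) = 0 -> forall v, val sigma v -> pairing u v = 0.
Proof.
move=> du; rewrite toR_bary pairing_sumr big_seq => /eqP.
rewrite psumr_eq0 => [/allP u0 v|v /gens_in]; last exact: du.
by rewrite gensP; apply: cspan_eq0 => w ws; apply/eqP; have := u0 w ws; rewrite ws.
Qed.

Lemma bary_orth_lattice sigma m : dual_monoid (val sigma) m ->
  pr m (toR (bary sigma)) = 0 :> R -> orth_lattice (val sigma) m.
Proof. by move=> dm m0 v; exact: bary_orth. Qed.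

Lemma fan_face sigma tau : val tau `<=` val sigma -> face (val tau) (val sigma).
Proof.
have [_ _ _ /(_ _ _ (valP tau) (valP sigma))[_]] := hS.
by move=> + /setIidl e; rewrite e.
Qed.

Lemma face_sub (A B : set 'cV[R]_n) : face A B -> A `<=` B.
Proof. by case=> u _ ->; exact: subIsetl. Qed.

(** In a fan the intersection is a face of sigma, and a face through a relative interior point is
    everything. *)
Lemma bary_sub sigma tau :
  val tau (toR (bary sigma)) -> val sigma `<=` val tau.
Proof.
move=> bt; have [_ _ _ /(_ _ _ (valP sigma) (valP tau))[[u du e] _]] := hS.
have := conj (bary_in sigma) bt; rewrite -[_ /\ _]/((val sigma `&` val tau) _).
rewrite e => -[_ /(bary_orth du) u0]; apply/setIidPl; rewrite e.
by apply/seteqP; split=> [v []//|v sv]; split=> //; exact: u0.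
Qed.

Lemma sub_val_inj sigma tau :
  val sigma `<=` val tau -> val tau `<=` val sigma -> sigma = tau.
Proof. by move=> st ts; apply/val_inj/seteqP. Qed.

(** A face comes with a real form, but characters can only be evaluated at integral ones. The
    integral inequalities of sigma - R_+ bary(rho) generate the face of the dual cone orthogonal to
    rho, and their sum is an interior point of that face. *)
Lemma face_form sigma rho : val rho `<=` val sigma ->
  exists m, dual_monoid (val sigma) m /\
    forall v, val sigma v -> pr m v = 0 <-> val rho v.
Proof.
move=> rs; have [u du rhoE] := fan_face rs.
have [ms msP] := @weyl R n (- bary rho :: gens sigma).
have sub v : val sigma v -> cspan (- bary rho :: gens sigma) v.
  by move=> sv; exists 0 => //; rewrite scale0r subr0 -gensP.
have msge0 v m : m \in ms -> val sigma v -> 0 <= pr m v.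
  by move=> mms sv; have /msP := sub _ sv; exact.
have mD : dual_monoid (val sigma) (\sum_(m <- ms) m).
  move=> v sv; rewrite [leRHS]pr_suml big_seq sumr_ge0// => m mms.
  exact: msge0.
exists (\sum_(m <- ms) m); split=> // v sv; split.
  rewrite pr_suml big_seq => /eqP; rewrite psumr_eq0 => [/allP m0|m mms]; last exact: msge0.
  (* All inequalities vanish at [v], so [- v] satisfies them as well: some c bary(rho) - v lies in
     sigma, which bounds [u] at [v] from above by 0. *)
  have : cspan (- bary rho :: gens sigma) (- v).
    apply/msP => m mms; have := m0 m mms; rewrite mms /= /pr pairingNr => /eqP e.
    by rewrite [pairing _ _]e oppr0.
  move=> /= -[c c0]; rewrite -gensP map_mxN scalerN opprK => sw.
  have : val rho (toR (bary rho)) by exact: bary_in.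
  have rhoP w : val rho w <-> val sigma w /\ pairing u w = 0 by rewrite rhoE.
  move=> /rhoP[_ ub]; apply/rhoP; split=> //; apply/eqP; rewrite eq_le du// andbT.
  rewrite -oppr_ge0 -pairingNr.
  by have := du _ sw; rewrite pairingDr pairingZr ub mulr0 addr0.
move: sv => _; apply: bary_orth_lattice v; first exact: dual_monoidS mD.
apply/eqP; rewrite eq_le mD ?andbT; last exact/rs/bary_in.
rewrite -oppr_ge0 -pairingNr -[pairing _ _]/(pr _ _) pr_suml big_seq sumr_ge0//.
move=> m mms; have /msP : cspan (- bary rho :: gens sigma) (- toR (bary rho)); last exact.
by rewrite -map_mxN; apply: cspan_gen; rewrite mem_head.
Qed.

Lemma face_form_orth sigma rho m : val rho `<=` val sigma ->
  (forall v, val sigma v -> pr m v = 0 <-> val rho v) ->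
  orth_lattice (val rho) m.
Proof. by move=> rs mP v rv; apply/mP => //; exact: rs. Qed.

Lemma dual_monoid_gens sigma m :
  (forall v, v \in gens sigma -> 0 <= pr m (toR v) :> R) -> dual_monoid (val sigma) m.
Proof. by move=> h v; rewrite gensP; exact: cspan_ge0. Qed.

(** The dual monoid of a face is the localization of that of sigma at [m0]: on generators outside
    rho, [m0] is at least 1 by integrality, so enough copies of it outweigh [m]. *)
Lemma face_form_lift sigma rho m m0 : val rho `<=` val sigma ->
  dual_monoid (val sigma) m0 ->
  (forall v, val sigma v -> pr m0 v = 0 <-> val rho v) ->
  dual_monoid (val rho) m ->
  exists N, forall N', (N <= N')%N -> dual_monoid (val sigma) (m + m0 *+ N').
Proof.
move=> rs m0D m0P mD.
exists (\max_(v <- gens sigma) `|(m *m v) ord0 ord0|)%N => N' NN'.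
apply: dual_monoid_gens => v vs; have sv := gens_in vs.
have := m0D _ sv; rewrite -[pairing _ _]/(pr _ _) le_eqVlt => /predU1P[/esym|].
  by rewrite prDl prMnl => /[dup] /m0P rv ->; rewrite // mul0rn addr0 mD//; exact: rv.
rewrite prDl prMnl !prI ltr0z.
have : (`|(m *m v) ord0 ord0| <= N')%N.
  by apply: leq_trans NN'; rewrite (@leq_bigmax_seq _ (gens sigma) xpredT).
rewrite pmulrn -[X in _ + X]mulrzl -intrM -intrD ler0z.
by move: ((m *m v) _ _) ((m0 *m v) _ _) => a b; nia.
Qed.

(** The candidates are the integral inequalities of sigma - tau. If all of them vanished on tau,
    then bary(tau) would lie in sigma - tau, and the common face would contain it, so that tau would
    be part of sigma. *)
Lemma separating_form sigma tau : exists m, [/\ dual_monoid (val sigma) m,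
  dual_monoid (val tau) (- m) &
  ~ val tau `<=` val sigma -> ~ orth_lattice (val tau) m].
Proof.
have [ms msP] := @weyl R n (gens sigma ++ [seq - v | v <- gens tau]).
have msd v w m : m \in ms -> val sigma v -> val tau w -> 0 <= pr m (v - w).
  move=> mms; rewrite !gensP => sv tw.
  have /msP : cspan (gens sigma ++ [seq - v | v <- gens tau]) (v - w); last exact.
  by apply/cspan_cat; exists v, (- w); split=> //; apply/cspanN; rewrite opprK.
have ms1 m v : m \in ms -> val sigma v -> 0 <= pr m v.
  move=> mms sv; rewrite -[v]subr0; apply: msd => //.
  by rewrite gensP; exact: cspan0.
have ms2 m v : m \in ms -> val tau v -> 0 <= pr (- m) v.
  move=> mms sv; rewrite prNl /pr -pairingNr -[- v]add0r; apply: msd => //.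
  by rewrite gensP; exact: cspan0.
have [[m mms mN]|all0] := pselect (exists2 m, m \in ms & ~ orth_lattice (val tau) m).
  by exists m; split=> // v; [exact: ms1|exact: ms2].
exists 0; rewrite oppr0; split; [exact: dual_monoid0|exact: dual_monoid0|move=> nts].
case: nts; apply: bary_sub.
have [_ _ _ /(_ _ _ (valP sigma) (valP tau))[_ [u du e]]] := hS.
have : cspan (gens sigma ++ [seq - v | v <- gens tau]) (toR (bary tau)).
  apply/msP => m mms.
  have /contrapT h : ~ ~ orth_lattice (val tau) m.
    by move=> nm; apply: all0; exists m.
  by rewrite [pr _ _]h//; exact: bary_in.
move=> /cspan_cat[a [b [sa /cspanN tb]]] E; rewrite -!gensP in sa tb.
have ta : val tau a.
  rewrite (_ : a = toR (bary tau) + - b); last by rewrite E addrK.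
  have := bary_in tau; rewrite gensP => h; apply: cspanD => //.
  by rewrite -gensP.
have u0 : forall v, val tau v -> pairing u v = 0.
  apply: (bary_orth du); apply/eqP; rewrite eq_le du ?andbT; last exact: bary_in.
  have [_ ua] : [set v | val tau v /\ pairing u v = 0] a by rewrite -e.
  by rewrite E pairingDr ua add0r -oppr_ge0 -pairingNr du.
have : (val sigma `&` val tau) (toR (bary tau)).
  by rewrite e; split; [|exact: u0 (bary_in _)]; exact: bary_in.
by case.
Qed.

End Fan.

(** * Stars of cones: uniqueness of barycentric coordinates *)

Section StarDecomposition.
Context {R : realType} {n : nat} {Sigma : {fset set 'cV[R]_n}}.
Hypothesis hS : is_fan Sigma.
Implicit Types sigma tau rho : Sigma.
Local Notation toR := (map_mx (intr : int -> R)).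

Definition sle sigma tau : bool := `[< val sigma `<=` val tau >].
Definition slt sigma tau : bool := (sigma != tau) && sle sigma tau.

Lemma sleP sigma tau : reflect (val sigma `<=` val tau) (sle sigma tau).
Proof. exact: asboolP. Qed.

Lemma sle_refl sigma : sle sigma sigma.
Proof. exact/sleP. Qed.

Lemma sle_trans : transitive sle.
Proof. by move=> b a c /sleP ab /sleP bc; apply/sleP; exact: subset_trans bc. Qed.

Lemma sle_anti sigma tau : sle sigma tau -> sle tau sigma -> sigma = tau.
Proof. by move=> /sleP h /sleP h'; exact: sub_val_inj. Qed.

Lemma slt_le sigma tau : slt sigma tau -> sle sigma tau.
Proof. by case/andP. Qed.

Lemma slt_le_trans sigma tau rho : slt sigma tau -> sle tau rho -> slt sigma rho.
Proof.
move=> /andP[st le1] le2; rewrite /slt (sle_trans le1 le2) andbT.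
by apply: contra_neq st => e; apply: sle_anti => //; rewrite e.
Qed.

Lemma sle_lt_trans sigma tau rho : sle sigma tau -> slt tau rho -> slt sigma rho.
Proof.
move=> le1 /andP[st le2]; rewrite /slt (sle_trans le1 le2) andbT.
by apply: contra_neq st => e; apply: sle_anti => //; rewrite -e.
Qed.

Lemma sltxx sigma : slt sigma sigma = false.
Proof. by rewrite /slt eqxx. Qed.

Lemma slt_nge sigma tau : slt sigma tau -> sle tau sigma = false.
Proof. by move=> st; apply/negP => /(slt_le_trans st); rewrite sltxx. Qed.

Definition rank sigma := #|[pred tau | sle tau sigma]|.

Lemma slt_rank sigma tau : slt sigma tau -> (rank sigma < rank tau)%N.
Proof.
move=> st; apply: proper_card; apply/properP; split.
  apply/fintype.subsetP => rho; rewrite !unfold_in /= => rs.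
  exact: sle_trans rs (slt_le st).
by exists tau; rewrite !unfold_in /= ?sle_refl// slt_nge.
Qed.

Definition chain (P : pred Sigma) :=
  forall sigma tau, P sigma -> P tau -> sle sigma tau || sle tau sigma.

Lemma chain_max (P : pred Sigma) sigma : chain P -> P sigma ->
  exists2 tau, P tau & forall rho, P rho -> sle rho tau.
Proof.
move=> cP Ps; case: (arg_maxnP rank Ps) => tau Pt tmax; exists tau => // rho Pr.
have /orP[//|tr] := cP _ _ Pr Pt.
have [<-|nrt] := eqVneq tau rho; first exact: sle_refl.
have /slt_rank : slt tau rho by rewrite /slt nrt.
by rewrite ltnNge [(_ <= _)%N]tmax.
Qed.

Lemma chain_min (P : pred Sigma) sigma : chain P -> P sigma ->
  exists2 tau, P tau & forall rho, P rho -> sle tau rho.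
Proof.
move=> cP Ps; case: (arg_minnP rank Ps) => tau Pt tmin; exists tau => // rho Pr.
have /orP[rt|//] := cP _ _ Pr Pt.
have [->|nrt] := eqVneq rho tau; first exact: sle_refl.
have /slt_rank : slt rho tau by rewrite /slt nrt.
by rewrite ltnNge [(_ <= _)%N]tmin.
Qed.

(** Coordinates in the barycentric subdivision of the star of rho, modulo the span of rho. *)
Definition flag_weights rho (d : Sigma -> R) :=
  [/\ forall sigma, 0 <= d sigma, chain [pred sigma | d sigma != 0] &
      forall sigma, d sigma != 0 -> slt rho sigma].

Lemma flag_weights_top rho d : flag_weights rho d ->
  exists top, [/\ sle rho top, d top = 0 -> top = rho &
    forall sigma, d sigma != 0 -> sle sigma top].
Proof.
move=> [_ cd dr]; have [[sigma ds]|d0] := pselect (exists sigma, d sigma != 0).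
  have [top /= dt tmax] := chain_max cd ds; exists top; split=> //.
    exact/slt_le/dr.
  by move=> dt0; rewrite dt0 eqxx in dt.
exists rho; split=> // [|sigma ds]; first exact: sle_refl.
by case: d0; exists sigma.
Qed.

(** Otherwise a form separating [top'] from [top] vanishes on rho, and it is non-negative on the
    combination given by [d'] but negative on that given by [d], where [top] has positive weight. *)
Lemma flag_weights_top_le rho d d' top top' :
  flag_weights rho d -> flag_weights rho d' ->
  (forall m, orth_lattice (val rho) m ->
    \sum_sigma d sigma * pr m (toR (bary sigma)) =
    \sum_sigma d' sigma * pr m (toR (bary sigma))) ->
  sle rho top -> (d top = 0 -> top = rho) ->
  (forall sigma, d sigma != 0 -> sle sigma top) ->
  sle rho top' -> (forall sigma, d' sigma != 0 -> sle sigma top') ->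
  sle top top'.
Proof.
move=> [d0 _ _] [d0' _ _] eqd rt dt td rt' td'; apply/sleP; apply: contrapT => nle.
have [m [m1 m2 /(_ nle) m3]] := separating_form hS top' top.
have mo : orth_lattice (val rho) m.
  move=> v rv; apply/eqP; rewrite eq_le (m1 v) ?andbT; last by move/sleP: rt'; apply.
  by rewrite -oppr_ge0 -[pairing _ _]/(pr m v) -prNl; apply: m2; move/sleP: rt; apply.
have : 0 <= \sum_sigma d' sigma * pr m (toR (bary sigma)).
  apply: sumr_ge0 => sigma _; have [->|/td' /sleP st] := eqVneq (d' sigma) 0.
    by rewrite mul0r.
  by rewrite mulr_ge0// m1//; apply/st/bary_in.
apply/negP; rewrite -eqd// -ltNge -oppr_gt0 -sumrN (bigD1 top)//=.
have dtop : 0 < d top.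
  rewrite lt_neqAle d0 andbT eq_sym; apply/eqP => /dt e.
  by case: nle; rewrite e; apply/sleP.
apply: ltr_pwDl; last first.
  apply: sumr_ge0 => sigma _; have [->|/td /sleP st] := eqVneq (d sigma) 0.
    by rewrite mul0r oppr0.
  by rewrite -mulrN -prNl mulr_ge0// m2//; apply/st/bary_in.
rewrite -mulrN -prNl mulr_gt0// lt_neqAle m2 ?andbT; last exact: bary_in.
rewrite eq_sym; apply/eqP => m0; apply: m3.
by rewrite -[m]opprK; apply/orth_latticeN; exact: bary_orth_lattice.
Qed.

(** Both supports have the same top. Subtracting the smaller of the two top coefficients from both
    sides preserves the equality and removes the top from at least one support. *)
Lemma flag_weights_inj rho d d' :
  flag_weights rho d -> flag_weights rho d' ->
  (forall m, orth_lattice (val rho) m ->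
    \sum_sigma d sigma * pr m (toR (bary sigma)) =
    \sum_sigma d' sigma * pr m (toR (bary sigma))) ->
  d =1 d'.
Proof.
have [N] := ubnP (#|[pred sigma | d sigma != 0%R]| + #|[pred sigma | d' sigma != 0%R]|).
elim: N => // N IH in d d' * => hN fd fd' eqd.
have [top [t1 t2 t3]] := flag_weights_top fd.
have [top' [t1' t2' t3']] := flag_weights_top fd'.
have ett' : top = top'.
  by apply: sle_anti; [exact: (flag_weights_top_le fd fd')|
    apply: (flag_weights_top_le fd' fd) => // m mo; rewrite eqd].
rewrite -{top'}ett' in t1' t2' t3'.
have [d00 cd dr] := fd; have [d00' cd' dr'] := fd'.
have zero (e : Sigma -> R) : (forall sigma, e sigma != 0 -> slt rho sigma) ->
    (forall sigma, e sigma != 0 -> sle sigma top) -> top = rho -> e =1 fun=> 0.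
  move=> er et tr sigma; apply/eqP; apply: contraT => /[dup] /er + /et.
  by rewrite tr => /slt_nge ->.
have [tr|/eqP tr] := pselect (top = rho).
  by move=> sigma; rewrite (zero d dr t3 tr) (zero d' dr' t3' tr).
have dt : d top != 0 by apply: contra_neq tr => /t2.
have dt' : d' top != 0 by apply: contra_neq tr => /t2'.
pose c := Num.min (d top) (d' top).
pose sub (e : Sigma -> R) sigma := if sigma == top then e sigma - c else e sigma.
have subP (e : Sigma -> R) : c <= e top -> e top != 0 -> flag_weights rho e ->
    flag_weights rho (sub e).
  move=> ce et [e0 ce' er].
  have imp sigma : sub e sigma != 0 -> e sigma != 0.
    by rewrite /sub; have [->|] := eqVneq sigma top.
  split=> [sigma|sigma tau /imp es /imp ett|sigma /imp]; last exact: er.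
    by rewrite /sub; case: eqP => [->|_]; rewrite ?subr_ge0.
  exact: ce'.
have subN (e : Sigma -> R) : e top != 0 ->
    [pred sigma | sub e sigma != 0] \subset [pred sigma | e sigma != 0].
  move=> et; apply/fintype.subsetP => sigma; rewrite !unfold_in /= /sub.
  by have [->|] := eqVneq sigma top.
have subN' (e : Sigma -> R) : e top != 0 -> e top = c ->
    (#|[pred sigma | sub e sigma != 0%R]| < #|[pred sigma | e sigma != 0%R]|)%N.
  move=> et ec; apply: proper_card; apply/properP; split; first exact: subN.
  by exists top; rewrite !unfold_in //= /sub eqxx ec subrr eqxx.
have subS (e : Sigma -> R) m : \sum_sigma sub e sigma * pr m (toR (bary sigma)) =
    \sum_sigma e sigma * pr m (toR (bary sigma)) - c * pr m (toR (bary top)).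
  rewrite (bigD1 top)//= [in RHS](bigD1 top)//= {1}/sub eqxx mulrBl addrAC.
  by congr (_ + _ - _); apply: eq_bigr => sigma /negPf st; rewrite /sub st.
have ct : c <= d top by rewrite ge_min lexx.
have ct' : c <= d' top by rewrite ge_min lexx orbT.
have E : sub d =1 sub d'.
  apply: IH; [|exact: subP|exact: subP|by move=> m mo; rewrite !subS eqd].
  have := subset_leq_card (subN d dt); have := subset_leq_card (subN d' dt').
  have [/subN'|/subN'] : d top = c \/ d' top = c.
    by rewrite /c minEle; case: ifP; [left|right].
  - by move=> /(_ dt) h1 h2 _; rewrite -ltnS; apply: leq_trans hN; rewrite ltnS -addSn leq_add.
  - by move=> /(_ dt') h1 _ h2; rewrite -ltnS; apply: leq_trans hN; rewrite ltnS -addnS leq_add.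
move=> sigma; move: (E sigma); rewrite /sub; case: eqP => // -> /eqP.
by rewrite (inj_eq (addIr _)) => /eqP.
Qed.

End StarDecomposition.

(** * Stars of cones: existence of barycentric coordinates *)

Section StarExistence.
Context {R : realType} {n : nat} {Sigma : {fset set 'cV[R]_n}}.
Hypothesis hS : is_fan Sigma.
Implicit Types sigma tau rho : Sigma.
Local Notation toR := (map_mx (intr : int -> R)).

Definition below (y : Sigma -> R) sigma := \sum_(tau | slt tau sigma) y tau.

Lemma seq_argmin (T : eqType) (f : T -> R) (s : seq T) : s != [::] ->
  exists2 x, x \in s & forall z, z \in s -> f x <= f z.
Proof.
elim: s => // x [|x' s] IH _; first by exists x => [|z]; rewrite inE// => /eqP->.
have [//|z zs zmin] := IH; have [xz|zx] := leP (f x) (f z).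
  exists x => [|t]; first exact: mem_head.
  by rewrite inE => /predU1P[->//|/zmin]; exact: le_trans.
exists z => [|t]; first by rewrite inE zs orbT.
by rewrite inE => /predU1P[->|/zmin//]; exact: ltW.
Qed.

(** Modulo the span of rho, move [v] along -bary(sigma) up to the boundary of sigma - rho; the
    remainder lies in a proper face containing rho, and induction applies. The weights are not
    normalized, since only ratios matter. *)
Lemma star_decomposition rho sigma v : sle rho sigma -> val sigma v ->
  exists y : Sigma -> R, [/\ forall tau, 0 <= y tau, 0 < y rho,
    chain [pred tau | y tau != 0],
    forall tau, y tau != 0 -> sle rho tau && sle tau sigma &
    forall m, orth_lattice (val rho) m ->
      \sum_tau (y tau / below y tau) * pr m (toR (bary tau)) = pr m v].
Proof.
have [N] := ubnP (rank sigma); elim: N => // N IH in sigma v * => hN rs sv.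
have [re|rne] := eqVneq rho sigma.
  exists (fun tau => (tau == rho)%:R); split.
  - by move=> tau; rewrite ler0n.
  - by rewrite eqxx.
  - by move=> a b /=; rewrite !pnatr_eq0 !eqb0 !negbK => /eqP-> /eqP->; rewrite sle_refl.
  - by move=> tau; rewrite pnatr_eq0 eqb0 negbK re => /eqP->; rewrite sle_refl.
  move=> m mo; rewrite (bigD1 rho)//= [pr _ _]mo; last exact: bary_in.
  rewrite mulr0 add0r [RHS]mo ?re// big1// => tau /negPf ->.
  by rewrite !mul0r.
have nsr : ~ val sigma `<=` val rho.
  move=> sr; move/negP: rne; apply; apply/eqP/sle_anti => //; exact/sleP.
have [ms msP] := @weyl R n (gens sigma ++ [seq - v | v <- gens rho]).
have inC a b : val sigma a -> val rho b -> forall m, m \in ms -> 0 <= pr m (a - b).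
  rewrite !gensP// => sa rb; apply/msP/cspan_cat; exists a, (- b); split=> //.
  by apply/cspanN; rewrite opprK.
have sigma0 : val sigma 0 by rewrite gensP//; exact: cspan0.
have rho0 : val rho 0 by rewrite gensP//; exact: cspan0.
have ms1 m a : m \in ms -> val sigma a -> 0 <= pr m a.
  by move=> mms sa; rewrite -[a]subr0; apply: inC.
have ms2 m : m \in ms -> orth_lattice (val rho) m.
  move=> mms b rb; apply/eqP; rewrite eq_le andbC [_ <= _]ms1//=; last by move/sleP: rs; exact.
  by rewrite -oppr_ge0 -pairingNr -[- b]add0r inC.
pose pos := [seq m <- ms | 0 < pr m (toR (bary sigma))].
(* Otherwise -bary(sigma) would lie in sigma - rho, and the form cutting out rho would vanish at
   bary(sigma). *)
have pos0 : pos != [::].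
  apply/eqP => pos0; move/sleP: (rs) => /(face_form hS)[m0 [m0D m0P]].
  have m0r := face_form_orth (elimT (sleP _ _) rs) m0P.
  have : cspan (gens sigma ++ [seq - v | v <- gens rho]) (- toR (bary sigma)).
    apply/msP => m mms; rewrite /pr pairingNr oppr_ge0 leNgt; apply/negP => mp.
    have : m \in pos by rewrite mem_filter mms andbT.
    by rewrite pos0.
  move=> /cspan_cat[a [b [sa /cspanN rb e]]]; rewrite -!gensP// in sa rb.
  apply/nsr/(bary_sub hS)/m0P; first exact: bary_in.
  apply/eqP; rewrite eq_le [0 <= _]m0D ?andbT; last exact: bary_in.
  rewrite -oppr_ge0 /pr -pairingNr e pairingDr [X in _ + X](_ : _ = 0) ?addr0 ?m0D//.
  by rewrite -[b]opprK pairingNr m0r// oppr0.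
(* [m1] is the first inequality to become tight on the way. *)
have [m1] := seq_argmin (fun m => pr m v / pr m (toR (bary sigma))) pos0.
rewrite mem_filter => /andP[m1p m1ms] m1min.
set c := pr m1 v / _ in m1min.
have c0 : 0 <= c by apply: divr_ge0; [exact: ms1|exact: ltW].
have : cspan (gens sigma ++ [seq - v | v <- gens rho]) (v - c *: toR (bary sigma)).
  apply/msP => m mms; rewrite /pr pairingBr pairingZr subr_ge0 -!/(pr _ _).
  have := ms1 _ _ mms (bary_in hS sigma); rewrite le_eqVlt => /predU1P[<-|mp].
    by rewrite mulr0 ms1.
  by rewrite -ler_pdivlMr// m1min// mem_filter mp.
move=> /cspan_cat[a [b [sa /cspanN rb e]]]; rewrite -!gensP// in sa rb.
have m1a : pr m1 a = 0.
  rewrite -[a](addrK b) -e /pr !pairingBr pairingZr -!/(pr _ _) divfK ?gt_eqF// subrr.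
  by rewrite -[b]opprK [pr _ (- _)]pairingNr [pairing _ _]ms2// !oppr0 addr0.
pose A := [set w | val sigma w /\ pr m1 w = 0].
have fA : face A (val sigma) by exists (map_mx intr m1) => // w; exact: ms1.
have SA : A \in Sigma by have [_ _ h _] := hS; exact: h (valP sigma) fA.
pose tau : Sigma := FSetSub SA.
have ts : sle tau sigma by apply/sleP => w [].
have nst : slt tau sigma.
  rewrite /slt ts andbT; apply/eqP => e'.
  have : val tau (toR (bary sigma)) by rewrite e'; exact: bary_in.
  by case=> _ h; rewrite h ltxx in m1p.
have rt : sle rho tau.
  apply/sleP => w rw; split; first by move/sleP: rs; exact.
  by have := ms2 _ m1ms w rw.
have [||y [y0 yr yc ybd yE]] := IH tau a _ rt.
- by rewrite -ltnS; apply: leq_trans hN; rewrite ltnS; exact: slt_rank.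
- by split.
have ys : y sigma = 0.
  by apply/eqP; apply: contraT => /ybd /andP[_]; rewrite (slt_nge nst).
pose mass := \sum_t y t.
have mass0 : 0 < mass.
  by rewrite /mass (bigD1 rho)//= ltr_pwDl// sumr_ge0.
(* All of [mass] sits on cones strictly below sigma, so this weight makes the ratio at sigma equal
   to [c]. *)
pose y' t := if t == sigma then c * mass else y t.
have y'0 t : y' t != 0 -> t = sigma \/ y t != 0.
  by rewrite /y'; case: (t =P sigma) => [-> _|_ h]; [left|right].
have bs : below y' sigma = mass.
  rewrite /below /mass [RHS](bigID (fun t => slt t sigma))/= [X in _ = _ + X]big1.
    rewrite addr0; apply: eq_bigr => t; rewrite /y'.
    by case: eqP => // ->; rewrite sltxx.
  move=> t /negP nt; apply/eqP; apply: contraT => /ybd /andP[_ tt].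
  by case: nt; exact: sle_lt_trans nst.
exists y'; split.
- by move=> t; rewrite /y'; case: eqP => // _; rewrite mulr_ge0// ltW.
- by rewrite /y' (negPf rne).
- move=> t t' /= /y'0[->|ht] /y'0[->|ht'].
  + by rewrite sle_refl.
  + by move/ybd: ht' => /andP[_ h]; rewrite [X in _ || X](sle_trans h) ?orbT.
  + by move/ybd: ht => /andP[_ h]; rewrite (sle_trans h).
  + exact: yc.
- move=> t /y'0[->|/ybd/andP[-> h]]; first by rewrite rs sle_refl.
  by rewrite (sle_trans h).
move=> m mo.
have -> : pr m v = c * pr m (toR (bary sigma)) + pr m a.
  rewrite -[v](subrK (c *: toR (bary sigma))) e /pr !pairingDr pairingZr.
  by rewrite -[b]opprK [pairing _ (- _)]pairingNr [X in - X]mo// oppr0 addr0 addrC.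
rewrite (bigD1 sigma)//= -yE// [in RHS](bigD1 sigma)//= ys !mul0r add0r.
rewrite bs /y' eqxx mulfK ?gt_eqF//; congr (_ + _); apply: eq_bigr => t ts'.
rewrite (negPf ts'); have [->|/ybd/andP[_ tt]] := eqVneq (y t) 0; first by rewrite !mul0r.
congr (_ / _ * _); apply: eq_bigr => t' tt'; case: eqP => // e'.
have := slt_le_trans tt' (sle_trans tt ts); rewrite e' => h.
by rewrite sltxx in h.
Qed.

Lemma orth_lattice_gens sigma m :
  (forall v, v \in gens sigma -> m *m v = 0) -> orth_lattice (val sigma) m.
Proof.
move=> h v; rewrite gensP//; apply: cspan_eq0 => w ws.
by rewrite -[LHS]/(pr m (toR w)) prI h// mxE.
Qed.

(* sigma^\perp is saturated in M, hence a direct summand: Smith normal form.   *)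
Lemma orth_lattice_projection sigma : exists P : 'M[int]_n,
  (forall m : 'rV[int]_n, orth_lattice (val sigma) (m *m P)) /\
  (forall m : 'rV[int]_n, orth_lattice (val sigma) m -> m *m P = m).
Proof.
pose V : 'M[int]_(n, size (gens sigma)) :=
  \matrix_(i, j) (nth 0 (gens sigma) j : 'cV[int]_n) i 0.
have colV j : col j V = nth 0 (gens sigma) j.
  by apply/matrixP => a b; rewrite !mxE ord1.
have VP (m : 'rV[int]_n) : orth_lattice (val sigma) m <-> m *m V = 0.
  split=> [mo|mV].
    apply/rowP => j; rewrite [RHS]mxE.
    have : pr m (toR (nth 0 (gens sigma) j)) = 0 :> R.
      by rewrite [LHS]mo//; apply: gens_in => //; rewrite mem_nth.
    rewrite prI => /eqP; rewrite intr_eq0 => /eqP; apply: etrans.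
    by rewrite !mxE; apply: eq_bigr => i _; rewrite !mxE.
  apply: orth_lattice_gens => v /(nthP 0)[j jl <-].
  by rewrite -(colV (Ordinal jl)) colE mulmxA mV mul0mx.
have [L Lu [Q Qu [d _ VE]]] := int_Smith_normal_form V.
set D := (\matrix_(i, j) _) in VE.
(* [E] keeps the coordinates that [D] annihilates: those with zero diagonal entry and those beyond
   the width of [D]. *)
pose E : 'M[int]_n := diag_mx (\row_i ((d`_i == 0) || (size (gens sigma) <= i)%N)%:R).
have ED : E *m D = 0.
  apply/matrixP => i j; rewrite mul_diag_mx !mxE; case: (val i =P val j) => ij;
    last by rewrite mulr0n mulr0.
  rewrite ij [(_ <= j)%N]leqNgt ltn_ord orbF; case: eqP => [->|_].
    by rewrite mul0rn mulr0.
  by rewrite mul0r.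
have DE (x : 'rV[int]_n) : x *m D = 0 -> x *m E = x.
  move=> xD; apply/rowP => i; rewrite mul_mx_diag !mxE.
  have [|/norP[di]] := boolP (_ || _); first by rewrite mulr1.
  rewrite -ltnNge => il; rewrite mulr0.
  have /rowP/(_ (Ordinal il)) := xD; rewrite !mxE (bigD1 i)//= !mxE eqxx mulr1n.
  rewrite big1 ?addr0 => [/eqP|j ji]; last first.
    rewrite !mxE; case: (val j =P val i) => [/val_inj e|_]; last by rewrite mulr0n mulr0.
    by rewrite e eqxx in ji.
  by rewrite mulf_eq0 (negPf di) orbF => /eqP.
exists (L *m E *m invmx L); split=> m.
  by apply/VP; rewrite VE !mulmxA mulmxKV// -[_ *m E *m D]mulmxA ED mulmx0 mul0mx.
move=> /VP; rewrite VE !mulmxA => /(congr1 (mulmx^~ (invmx Q))).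
by rewrite mulmxK// mul0mx => /DE ->; rewrite mulmxK.
Qed.

End StarExistence.

(** * Points of the toric variety and their convergence *)

Section MonoidHoms.
Context {R : realType} {n : nat} (S : set 'rV[int]_n) (K : set R[i]).
Implicit Types (chi : 'rV[int]_n -> R[i]).

Lemma monoid_hom1 chi : monoid_hom S K chi -> chi 0 = 1.
Proof. by case. Qed.

Lemma monoid_homMn chi m c : (forall a b, S a -> S b -> S (a + b)) -> S 0 ->
  monoid_hom S K chi -> S m -> chi (m *+ c) = chi m ^+ c.
Proof.
move=> SD S0 [c1 cM _ _] Sm.
suff /(_ c)[] : forall c, S (m *+ c) /\ chi (m *+ c) = chi m ^+ c by [].
elim=> [|{}c [IH1 IH2]]; first by rewrite mulr0n c1.
by rewrite mulrS exprS -IH2 -cM//; split=> //; exact: SD.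
Qed.

Lemma monoid_hom_sum chi (s : seq 'rV[int]_n) (c : 'I_(size s) -> nat) :
  (forall a b, S a -> S b -> S (a + b)) -> S 0 ->
  monoid_hom S K chi -> (forall m, m \in s -> S m) ->
  chi (\sum_(i < size s) s`_i *+ c i) = \prod_(i < size s) chi s`_i ^+ c i.
Proof.
move=> SD S0 hc sS; have [c1 cM _ _] := hc.
have SMn m j : S m -> S (m *+ j).
  by move=> Sm; elim: j => // j IH; rewrite mulrS; exact: SD.
suff [] : S (\sum_(i < size s) s`_i *+ c i) /\
  chi (\sum_(i < size s) s`_i *+ c i) = \prod_(i < size s) chi s`_i ^+ c i by [].
elim/big_rec2 : _ => [|i x y _ [IH1 IH2]]; first by [].
have Ss : S s`_i by apply: sS; rewrite mem_nth.
rewrite cM//; last exact: SMn.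
by rewrite IH2 monoid_homMn//; split=> //; apply: SD => //; exact: SMn.
Qed.

Lemma monoid_hom_neq0 chi m : S m -> S (- m) -> monoid_hom S K chi -> chi m != 0.
Proof.
move=> Sm SNm [c1 cM _ _]; apply/eqP => c0.
by move: (cM m (- m) Sm SNm); rewrite subrr c1 c0 mul0r => /eqP; rewrite oner_eq0.
Qed.

Lemma monoid_homN chi m : S m -> S (- m) -> monoid_hom S K chi ->
  chi (- m) = (chi m)^-1.
Proof.
move=> Sm SNm hc; have := monoid_hom_neq0 Sm SNm hc; have [c1 cM _ _] := hc.
by move=> c0; apply: (mulfI c0); rewrite -cM// subrr c1 mulfV.
Qed.

End MonoidHoms.

(** * Points of a chart as characters on orbits *)

Section Orbits.
Context {R : realType} {n : nat} {Sigma : {fset set 'cV[R]_n}} {k : scalars}.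
Hypothesis hS : is_fan Sigma.
Implicit Types (sigma tau rho : Sigma) (chi : 'rV[int]_n -> R[i]).
Local Notation K := (@scalar_set R k).
Local Notation charts := (charts k Sigma).
Local Notation toric := (toric k Sigma).

Definition orbit_hom tau : set ('rV[int]_n -> R[i]) :=
  monoid_hom (orth_lattice (val tau)) K.

Lemma orbit_hom_neq0 tau chi m : orbit_hom tau chi ->
  chi m != 0 <-> orth_lattice (val tau) m.
Proof.
move=> hc; split=> [|mo].
  by apply: contra_neqP; have [_ _ _] := hc; exact.
by apply: monoid_hom_neq0 hc => //; exact: orth_latticeN.
Qed.

(** A sum in the dual monoid is orthogonal to tau only if both terms are, so the extension by 0
    remains multiplicative there. *)
Lemma orbit_homM tau chi m m' : orbit_hom tau chi ->
  dual_monoid (val tau) m -> dual_monoid (val tau) m' ->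
  chi (m + m') = chi m * chi m'.
Proof.
move=> hc dm dm'; have [_ cM _ c0] := hc.
have sub a b : dual_monoid (val tau) a -> dual_monoid (val tau) b ->
    orth_lattice (val tau) (a + b) -> orth_lattice (val tau) a.
  move=> da db ab v tv; have := ab v tv; rewrite -[pairing _ _]/(pr _ _) prDl.
  move=> /eqP; rewrite paddr_eq0; [|exact: da|exact: db].
  by case/andP => /eqP.
have [mo|nmo] := pselect (orth_lattice (val tau) m); last first.
  by rewrite (c0 m)// mul0r c0// => /(sub _ _ dm dm').
have [mo'|nmo'] := pselect (orth_lattice (val tau) m'); last first.
  by rewrite (c0 m')// mulr0 c0// addrC => /(sub _ _ dm' dm).
exact: cM.
Qed.

Lemma orbit_homMn tau chi m c : orbit_hom tau chi ->
  dual_monoid (val tau) m -> chi (m *+ c) = chi m ^+ c.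
Proof.
move=> hc dm; elim: c => [|c IH]; first by rewrite mulr0n (monoid_hom1 hc).
by rewrite mulrS exprS (orbit_homM hc)// ?IH//; exact: dual_monoidMn.
Qed.

Lemma orbit_hom_scalar tau chi m : orbit_hom tau chi -> K (chi m).
Proof.
move=> [_ _ cK c0]; have [|/c0->] := pselect (orth_lattice (val tau) m); first exact: cK.
by case: k => /=.
Qed.

Definition chart_restriction sigma chi : 'rV[int]_n -> R[i] :=
  fun m => if `[< dual_monoid (val sigma) m >] then chi m else 0.

Lemma chart_restriction_subproof sigma tau chi :
  val tau `<=` val sigma -> orbit_hom tau chi ->
  chart_set k (val sigma) (chart_restriction sigma chi).
Proof.
move=> ts hc; rewrite /chart_restriction; split.
- by rewrite asboolT ?(monoid_hom1 hc)//; exact: dual_monoid0.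
- move=> m m' dm dm'; rewrite !asboolT//; last exact: dual_monoidD.
  by apply: orbit_homM hc _ _; exact: dual_monoidS ts _.
- by move=> m dm; rewrite asboolT//; exact: orbit_hom_scalar hc.
- by move=> m dm; rewrite asboolF.
Qed.

Definition chart_of sigma tau chi (ts : val tau `<=` val sigma)
    (hc : orbit_hom tau chi) : chart k (val sigma) :=
  SigSub (mem_set (chart_restriction_subproof ts hc)) : chart_set k (val sigma).

Lemma cval_chart_of sigma tau chi (ts : val tau `<=` val sigma)
    (hc : orbit_hom tau chi) m :
  dual_monoid (val sigma) m -> cval (chart_of ts hc) m = chi m.
Proof. by move=> dm; rewrite /cval set_valE /= /chart_restriction asboolT. Qed.

(* The point p lies in the orbit of tau, and chi is its value on tau^\perp,   *)
(* extended by 0.                                                             *)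
Definition orbit_datum (p : charts) tau chi :=
  [/\ val tau `<=` val (projT1 p), orbit_hom tau chi &
      forall m, dual_monoid (val (projT1 p)) m -> cval (projT2 p) m = chi m].

(** The cone is read off from the forms with non-zero value; on tau^perp, [face_form_lift] writes
    chi as a quotient of values on the dual monoid of the chart. *)
Lemma orbit_datum_uniq p tau chi tau' chi' :
  orbit_datum p tau chi -> orbit_datum p tau' chi' -> tau = tau' /\ chi = chi'.
Proof.
have half t c t' c' : orbit_datum p t c -> orbit_datum p t' c' ->
    val t' `<=` val t.
  move=> [ts hc e] [ts' hc' e']; have [m [mD mP]] := face_form hS ts.
  have mo := face_form_orth ts mP.
  have /(orbit_hom_neq0 _ hc) := mo; rewrite -e// e'// => /(orbit_hom_neq0 _ hc').
  by move=> mo' v tv; apply/mP; [exact: ts'|exact: mo'].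
move=> h h'; have tt : tau = tau' by apply: sub_val_inj; [exact: half h' h|exact: half h h'].
split=> //; rewrite -{}tt in h'.
move: h h' => [ts hc e] [_ hc' e']; apply/funext => m.
have [mo|nmo] := pselect (orth_lattice (val tau) m); last first.
  by have [[_ _ _ ->//] [_ _ _ ->//]] := (hc, hc').
have [m0 [m0D m0P]] := face_form hS ts.
have m0o := face_form_orth ts m0P.
have [N /(_ N (leqnn N)) mN] := face_form_lift hS ts m0D m0P (orth_dual mo).
have : chi (m + m0 *+ N) = chi' (m + m0 *+ N) by rewrite -e// -e'.
have d0 := orth_dual m0o.
rewrite (orbit_homM hc) ?(orbit_homM hc') ?(orbit_homMn _ hc) ?(orbit_homMn _ hc')//;
  try exact: dual_monoidMn; try exact: orth_dual.
rewrite -(e' m0)// -(e m0)//; apply: mulIf.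
by rewrite expf_neq0// e//; exact/(orbit_hom_neq0 _ hc).
Qed.

(** The generators with non-zero value add up to a form [m0]. Its zero set in the cone is tau, and
    localizing at [m0] extends the values to tau^perp. *)
Lemma orbit_datum_ex p : exists tau chi, orbit_datum p tau chi.
Proof.
case: p => sigma x; rewrite /orbit_datum /=.
have := cvalP x; set f := cval x => hf; have [f1 fM fK f0] := hf.
have [_ /(_ _ (valP sigma))[rc _] fS _] := hS.
have [gD gE] := generatorsP rc.
set s := generators (val sigma) in gD gE.
pose m0 := \sum_(m <- s | f m != 0) m.
have m0D : dual_monoid (val sigma) m0.
  rewrite /m0 big_seq_cond; elim/big_ind: _ => [|a b|m /andP[ms _]].
  - exact: dual_monoid0.
  - exact: dual_monoidD.
  - exact: gD.
have fm0 : f m0 != 0.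
  suff [] : dual_monoid (val sigma) m0 /\ f m0 != 0 by [].
  rewrite /m0 big_seq_cond; elim/big_ind: _ => [|a b [da fa] [db fb]|m /andP[ms fm]].
  - by rewrite f1 oner_eq0; split=> //; exact: dual_monoid0.
  - by rewrite fM// mulf_neq0//; split=> //; exact: dual_monoidD.
  - by split=> //; exact: gD.
pose A := [set v | val sigma v /\ pr m0 v = 0].
have fA : face A (val sigma) by exists (map_mx intr m0).
pose tau : Sigma := FSetSub (fS _ _ (valP sigma) fA).
have ts : val tau `<=` val sigma by move=> v [].
have m0P v : val sigma v -> pr m0 v = 0 <-> val tau v.
  by move=> sv; split=> [e|[]//]; split.
have m0o := face_form_orth ts m0P.
have lift m := @face_form_lift _ _ _ hS sigma tau m m0 ts m0D m0P.
have fMn m c : dual_monoid (val sigma) m -> f (m *+ c) = f m ^+ c.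
  by move=> dm; apply: monoid_homMn hf dm; [exact: dual_monoidD|exact: dual_monoid0].
have fneq0 m : dual_monoid (val sigma) m -> f m != 0 <-> orth_lattice (val tau) m.
  move=> dm; split=> [|mo].
    have [c ->] := gE m dm.
    rewrite (monoid_hom_sum _ _ _ hf)//; [|exact: dual_monoidD|exact: dual_monoid0].
    rewrite prodf_seq_neq0 => /allP h v tv.
    rewrite -[LHS]/(pr _ v) pr_suml big1// => i _; rewrite prMnl.
    have [->|ci] := eqVneq (c i) 0%N; first by rewrite mulr0n.
    have /(_ (mem_index_enum i)) := h i; rewrite implyTb expf_eq0 lt0n ci/= => fi.
    have [sv m0v] : val sigma v /\ pr m0 v = 0 by exact: tv.
    move: m0v => /eqP; rewrite pr_suml big_seq_cond psumr_eq0; last first.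
      by move=> m' /andP[ms _]; exact: gD.
    move=> /allP/(_ s`_i); rewrite mem_nth// fi /= => /(_ isT)/eqP ->.
    by rewrite mul0rn.
  have moN : dual_monoid (val tau) (- m) by exact/orth_dual/orth_latticeN.
  have [N /(_ N (leqnn N)) mN] := lift _ moN.
  have : f (m0 *+ N) != 0 by rewrite fMn// expf_neq0.
  have -> : m0 *+ N = m + (- m + m0 *+ N) by rewrite addrA subrr add0r.
  by rewrite fM// mulf_eq0 => /norP[].
pose good m N := dual_monoid (val sigma) (m + m0 *+ N).
have goodx m : exists N, orth_lattice (val tau) m -> good m N.
  have [mo|nmo] := pselect (orth_lattice (val tau) m); last by exists 0%N.
  by have [N /(_ N (leqnn N)) h] := lift _ (orth_dual mo); exists N.
pose N m := projT1 (cid (goodx m)).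
have NP m : orth_lattice (val tau) m -> good m (N m) by exact: projT2 (cid (goodx m)).
(* By [chiE] the quotient is the same for every admissible number of copies of [m0]. *)
pose chi m := if `[< orth_lattice (val tau) m >] then f (m + m0 *+ N m) / f m0 ^+ N m else 0.
have chiE m j : orth_lattice (val tau) m -> good m j -> chi m = f (m + m0 *+ j) / f m0 ^+ j.
  move=> mo gj; rewrite /chi asboolT//; apply/eqP.
  rewrite eqr_div ?expf_neq0//; apply/eqP; rewrite -!fMn// -!fM//.
  - by rewrite addrAC.
  - exact: dual_monoidMn.
  - exact: NP.
  - exact: dual_monoidMn.
exists tau, chi; split=> //=; last first.
  move=> m dm; have [mo|nmo] := pselect (orth_lattice (val tau) m).
    by rewrite (chiE m 0%N)// /good ?mulr0n ?addr0// expr0 divr1.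
  rewrite /chi asboolF//; apply: contra_notP nmo => /eqP fm.
  exact/fneq0.
split.
- have o0 := @orth_lattice0 R n (val tau).
  rewrite (chiE 0 0%N)//; last by rewrite /good mulr0n addr0; exact: dual_monoid0.
  by rewrite mulr0n addr0 f1 expr0 divr1.
- move=> m m' mo mo'; have mo2 := orth_latticeD mo mo'.
  have e : m + m' + m0 *+ (N m + N m') = (m + m0 *+ N m) + (m' + m0 *+ N m').
    by rewrite mulrnDr addrACA.
  rewrite (chiE (m + m') (N m + N m')%N)//; last first.
    by rewrite /good e; apply: dual_monoidD; exact: NP.
  rewrite e fM; [|exact: NP|exact: NP].
  by rewrite (chiE m (N m)) ?(chiE m' (N m'))//; [|exact: NP|exact: NP]; rewrite exprD mulf_div.
- move=> m mo; rewrite (chiE m (N m))//; last exact: NP.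
  apply: scalar_setM; first by apply: fK; exact: NP.
  by apply: scalar_setV; rewrite -fMn//; apply: fK; exact: dual_monoidMn.
- by move=> m mo; rewrite /chi asboolF.
Qed.

End Orbits.

(** * Limits along filters *)

Section Convergence.
Context {T : Type} {F : set_system T} {FF : Filter F}.

Lemma cvg_prodr (K : numFieldType) (I : Type) (r : seq I) (f : I -> T -> K) (a : I -> K) :
  (forall i, f i t @[t --> F] --> a i) ->
  (\prod_(i <- r) f i t) @[t --> F] --> \prod_(i <- r) a i.
Proof.
move=> fa; elim: r => [|i r IH].
  by rewrite big_nil; under eq_fun do rewrite big_nil; exact: cvg_cst.
by rewrite big_cons; under eq_fun do rewrite big_cons; exact: cvgM.
Qed.

Lemma cvg_sumr (K : numFieldType) (I : Type) (r : seq I) (P : pred I)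
    (f : I -> T -> K) (a : I -> K) :
  (forall i, P i -> f i t @[t --> F] --> a i) ->
  (\sum_(i <- r | P i) f i t) @[t --> F] --> \sum_(i <- r | P i) a i.
Proof.
move=> fa; elim: r => [|i r IH].
  by rewrite big_nil; under eq_fun do rewrite big_nil; exact: cvg_cst.
rewrite big_cons; under eq_fun do rewrite big_cons.
by case: ifP => // Pi; apply: cvgD => //; exact: fa.
Qed.

Lemma cvg_expr (K : numFieldType) (f : T -> K) (a : K) c :
  f t @[t --> F] --> a -> (f t ^+ c) @[t --> F] --> a ^+ c.
Proof.
move=> fa; elim: c => [|c IH].
  by rewrite expr0; under eq_fun do rewrite expr0; exact: cvg_cst.
by rewrite exprS; under eq_fun do rewrite exprS; exact: cvgM.
Qed.

Lemma cvg_matrix (U : topologicalType) p q (f : T -> 'M[U]_(p, q)) (M : 'M[U]_(p, q)) :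
  (forall i j, f t i j @[t --> F] --> M i j) -> f t @[t --> F] --> M.
Proof.
move=> fM A [P MP sPA]; have FA : F [set t | forall i j, P i j (f t i j)].
  apply: (@filter_forall _ _ (fun i => [set t | forall j, P i j (f t i j)])) => i.
  apply: (@filter_forall _ _ (fun j => [set t | P i j (f t i j)])) => j.
  exact/fM/MP.
by apply: (filterS sPA); exact: FA.
Qed.

Lemma cvg_initial (S : choiceType) (U : topologicalType) (w : S -> U)
    (f : T -> initial_topology w) (s : initial_topology w) :
  w (f t) @[t --> F] --> w s -> f t @[t --> F] --> s.
Proof.
move=> fs A [_ [[B oB <-] Bs BA]].
have FB : F [set t | B (w (f t))] by apply: fs; exact: open_nbhs_nbhs.
by apply: (filterS BA); exact: FB.
Qed.

End Convergence.

(** * Points of the glued variety *)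

Section ToricPoints.
Context {R : realType} {n : nat} {Sigma : {fset set 'cV[R]_n}} {k : scalars}.
Hypothesis hS : is_fan Sigma.
Implicit Types (sigma tau rho : Sigma) (chi : 'rV[int]_n -> R[i]).
Local Notation charts := (charts k Sigma).
Local Notation toric := (toric k Sigma).
Implicit Types (p q : charts) (z : toric).
Local Notation orbit_hom := (@orbit_hom R n Sigma k).
Local Notation ochart := (existT (fun sigma : Sigma => chart k (val sigma))).

Lemma orbit_datum_step p q tau chi :
  glue_step p q -> orbit_datum p tau chi -> orbit_datum q tau chi.
Proof.
move=> [/face_sub pq e] [tp hc pe]; split=> // [v /tp/pq//|m dm].
by rewrite e// pe//; exact: dual_monoidS pq dm.
Qed.

(** A gluing step carries the datum forward only; existence and uniqueness give the way back. *)
Lemma orbit_datum_glue p q tau chi : clos_refl_sym_trans charts (@glue_step R n k Sigma) p q ->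
  orbit_datum p tau chi <-> orbit_datum q tau chi.
Proof.
elim=> [a b ab|a|a b _ IH|a b c _ IH1 _ IH2].
- split; first exact: orbit_datum_step.
  move=> hb; have [t [c ha]] := orbit_datum_ex hS a.
  by have [<- <-] := orbit_datum_uniq hS (orbit_datum_step ab ha) hb.
- by [].
- by split=> /IH.
- by split=> [/IH1/IH2|/IH2/IH1].
Qed.

Definition datum z := cid (orbit_datum_ex hS (repr z)).
(* Every point z is determined by the pair (ot z, ch z).                      *)
Definition ot z : Sigma := projT1 (datum z).
Definition ch z : 'rV[int]_n -> R[i] := projT1 (cid (projT2 (datum z))).

Lemma datumP z : orbit_datum (repr z) (ot z) (ch z).
Proof. exact: projT2 (cid (projT2 (datum z))). Qed.

Lemma orbit_datum_pi p : orbit_datum p (ot (\pi_toric p)) (ch (\pi_toric p)).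
Proof.
have /eqmodP/asboolP h : repr (\pi_toric p) = p %[mod {eq_quot glue_equiv k Sigma}].
  exact: reprK.
exact/(orbit_datum_glue _ _ h)/datumP.
Qed.

Lemma orbit_datum_piE p tau chi : orbit_datum p tau chi ->
  ot (\pi_toric p) = tau /\ ch (\pi_toric p) = chi.
Proof. by move=> h; apply: (orbit_datum_uniq hS) h; exact: orbit_datum_pi. Qed.

Lemma ch_hom z : orbit_hom (ot z) (ch z).
Proof. by have [] := datumP z. Qed.

(** The two points are glued through the chart of tau, which lies in both of their charts. *)
Lemma pi_chart_of sigma tau chi (ts : val tau `<=` val sigma) (hc : orbit_hom tau chi) p :
  orbit_datum p tau chi -> \pi_toric (ochart sigma (chart_of ts hc)) = \pi_toric p.
Proof.
move=> [tp _ pe]; apply/eqmodP/asboolP.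
pose c := ochart tau (chart_of (@subset_refl _ (val tau)) hc).
apply: (@rst_trans _ _ _ c).
  apply: rst_sym; apply: rst_step; split; first exact: fan_face.
  move=> m /= dm; have dm' := dual_monoidS ts dm.
  by rewrite !cval_chart_of.
apply: rst_step; split; first exact: fan_face.
move=> m /= dm; have dm' := dual_monoidS tp dm.
by rewrite !cval_chart_of// pe.
Qed.

Lemma toric_eq z z' : ot z = ot z' -> ch z = ch z' -> z = z'.
Proof.
move=> eo ec; rewrite -[z]reprK -[z']reprK.
have h := datumP z; have h' := datumP z'; rewrite -eo -ec in h'.
have s := @subset_refl _ (val (ot z)).
by rewrite -(pi_chart_of s (ch_hom z) h) -(pi_chart_of s (ch_hom z) h').
Qed.

Definition pt tau chi (hc : orbit_hom tau chi) : toric :=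
  \pi_toric (ochart tau (chart_of (@subset_refl _ (val tau)) hc)).

Lemma pt_datum tau chi (hc : orbit_hom tau chi) : ot (pt hc) = tau /\ ch (pt hc) = chi.
Proof. by apply: orbit_datum_piE; split=> // m dm; rewrite cval_chart_of. Qed.

Lemma ot_pt tau chi (hc : orbit_hom tau chi) : ot (pt hc) = tau.
Proof. by have [] := pt_datum hc. Qed.

Lemma ch_pt tau chi (hc : orbit_hom tau chi) : ch (pt hc) = chi.
Proof. by have [] := pt_datum hc. Qed.

Lemma toric_act_datum (g : torus R n k) z :
  ot (toric_act g z) = ot z /\ ch (toric_act g z) = fun m => tval g m * ch z m.
Proof.
apply: orbit_datum_piE; have [ts hc e] := datumP z; split=> //=; last first.
  by move=> m dm; rewrite cval_act e.
have [g1 gM gK _] := tvalP g; have [c1 cM cK c0] := hc.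
split=> [|m m' mo mo'|m mo|m mo]; first by rewrite g1 c1 mulr1.
- by rewrite gM// cM// mulrACA.
- by apply: scalar_setM; [have [] := gK m I|exact: cK].
- by rewrite c0// mulr0.
Qed.

Lemma ot_act (g : torus R n k) z : ot (toric_act g z) = ot z.
Proof. by have [] := toric_act_datum g z. Qed.

Lemma ch_act (g : torus R n k) z m : ch (toric_act g z) m = tval g m * ch z m.
Proof. by have [_ ->] := toric_act_datum g z. Qed.

Lemma generators_fan sigma : generates (generators (val sigma)) (dual_monoid (val sigma)).
Proof.
by have [_ /(_ _ (valP sigma))[rc _] _ _] := hS; exact: generatorsP.
Qed.

Lemma dual_cval sigma (x : chart k (val sigma)) m
    (c : 'I_(size (generators (val sigma))) -> nat) :
  m = \sum_(i < size (generators (val sigma))) (generators (val sigma))`_i *+ c i ->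
  cval x m = \prod_(i < size (generators (val sigma))) cval x (generators (val sigma))`_i ^+ c i.
Proof.
move=> ->; have [gD _] := generators_fan sigma.
by rewrite (monoid_hom_sum _ _ _ (cvalP x))//; [exact: dual_monoidD|exact: dual_monoid0].
Qed.

Lemma cval_continuous sigma m : dual_monoid (val sigma) m ->
  continuous (fun x : chart k (val sigma) => cval x m : R[i]^o).
Proof.
have [gD gE] := generators_fan sigma; move=> /gE[c mE].
have -> : (fun x : chart k (val sigma) => cval x m : R[i]^o) = fun x =>
    \prod_(i < size (generators (val sigma))) cval x (generators (val sigma))`_i ^+ c i.
  by apply/funext => x; exact: dual_cval.
move=> x; apply: (@cvg_prodr _ _ (nbhs_filter x) R[i]) => i.
apply: (@cvg_expr _ _ (nbhs_filter x) R[i]).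
have h := @initial_continuous _ _ (@chart_coord R n k (val sigma)) x.
have E : (fun y : chart k (val sigma) => cval y (generators (val sigma))`_i : R[i]^o) =
    (fun M : 'rV[R[i]^o]_(size (generators (val sigma))) => M 0 i) \o
    (@chart_coord R n k (val sigma)).
  by apply/funext => y /=; rewrite mxE.
have -> : cval x (generators (val sigma))`_i = chart_coord x 0 i by rewrite mxE.
rewrite E; apply: continuous_comp; first exact: h.
exact: (@coord_continuous R[i] 1 _ 0 i (chart_coord x)).
Qed.

End ToricPoints.

(** * Convergence in the toric variety *)

Section ToricTopology.
Context {R : realType} {n : nat} {Sigma : {fset set 'cV[R]_n}} {k : scalars}.
Hypothesis hS : is_fan Sigma.
Implicit Types (sigma tau rho : Sigma) (chi : 'rV[int]_n -> R[i]).
Local Notation charts := (charts k Sigma).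
Local Notation toric := (toric k Sigma).
Implicit Types (z : toric).
Local Notation orbit_hom := (@orbit_hom R n Sigma k).
Local Notation ochart := (existT (fun sigma : Sigma => chart k (val sigma))).
Local Notation ot := (@ot R n Sigma k hS).
Local Notation ch := (@ch R n Sigma k hS).

(** As long as the value at [m0] is non-zero, the orbit cone is contained in that of [x0], and the
    value at [m] is a quotient of two continuous chart functions. *)
Lemma chart_near sigma (x0 : chart k (val sigma)) :
  let z x := \pi_toric (ochart sigma x) in
  (\forall x \near x0, sle (ot (z x)) (ot (z x0))) /\
  forall m, dual_monoid (val (ot (z x0))) m ->
    (ch (z x) m : R[i]^o) @[x --> x0] --> (ch (z x0) m : R[i]^o).
Proof.
move=> z; have D x : orbit_datum (ochart sigma x) (ot (z x)) (ch (z x)).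
  exact: orbit_datum_pi.
have [/= ts0 hc0 e0] := D x0.
have [m0 [m0D m0P]] := face_form hS ts0.
have m0o := face_form_orth ts0 m0P.
have c0 : cval x0 m0 != 0 by rewrite e0//; exact/(orbit_hom_neq0 _ hc0).
have /(_ x0) cm0 := @cval_continuous R n Sigma k hS sigma m0 m0D.
have near0 : \forall x \near x0, cval x m0 != 0 :=
  @cvgr_neq0 R[i] R[i]^o _ _ (nbhs_filter x0) _ _ cm0 c0.
have sub : \forall x \near x0, sle (ot (z x)) (ot (z x0)) /\ cval x m0 != 0.
  apply: filterS near0 => x cx; split=> //; have [/= ts hc e] := D x.
  apply/sleP => v tv; apply/m0P; first exact: ts.
  by move: cx; rewrite e// => /(orbit_hom_neq0 _ hc); exact.
split; first by apply: filterS sub => x [].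
move=> m dm; have [N /(_ N (leqnn N)) mN] := face_form_lift hS ts0 m0D m0P dm.
have E x : sle (ot (z x)) (ot (z x0)) -> cval x m0 != 0 ->
    cval x (m + m0 *+ N) / cval x m0 ^+ N = ch (z x) m.
  move=> /sleP le cx; have [/= ts hc e] := D x.
  have d0 : dual_monoid (val (ot (z x))) m0 by exact: dual_monoidS ts m0D.
  rewrite !e// in cx *; rewrite (orbit_homM hc) ?(orbit_homMn _ hc)//.
  - by rewrite mulfK// expf_neq0.
  - exact: dual_monoidS le dm.
  - exact: dual_monoidMn.
have near_E : {near x0, (fun x => cval x (m + m0 *+ N) / cval x m0 ^+ N : R[i]^o)
    =1 (fun x => ch (z x) m : R[i]^o)}.
  by apply: filterS sub => x [le cx]; exact: E.
apply: cvg_trans (near_eq_cvg near_E) _.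
rewrite -(E x0)//; last exact: sle_refl.
apply: (@cvgM R[i] _ _ (nbhs_filter x0)); first exact: cval_continuous.
apply: (@cvgV R[i] _ _ (nbhs_filter x0)); first by rewrite expf_neq0.
exact: (@cvg_expr _ _ (nbhs_filter x0) R[i]).
Qed.

Lemma open_toric sigma m (W : set R[i]^o) : open W ->
  dual_monoid (val sigma) m ->
  open [set z | sle (ot z) sigma /\ W (ch z m)].
Proof.
move=> oW dm.
suff : open (\pi_toric @^-1` [set z | sle (ot z) sigma /\ W (ch z m)]) by [].
apply/sigT_openP => tau; rewrite openE => x0 /= [le0 W0].
have [nl /(_ m) nc] := chart_near x0.
have {}nc := nc (dual_monoidS (elimT (sleP _ _) le0) dm).
have nW : \forall x \near x0, W (ch (\pi_toric (ochart tau x)) m).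
  by apply: nc; exact: open_nbhs_nbhs.
apply: (filterS2 _ _ nl nW) => x le Wx; split=> //.
exact: sle_trans le le0.
Qed.

Lemma near_sle z0 : \forall z \near z0, sle (ot z) (ot z0).
Proof.
have := open_toric (@openT R[i]^o) (@dual_monoid0 R n (val (ot z0))).
move=> o; have : nbhs z0 [set z | sle (ot z) (ot z0) /\ setT (ch z 0 : R[i]^o)].
  by apply: open_nbhs_nbhs; split=> //; split=> //; exact: sle_refl.
by apply: filterS => z [].
Qed.

Lemma ch_cvg z0 m : dual_monoid (val (ot z0)) m ->
  (ch z m : R[i]^o) @[z --> z0] --> (ch z0 m : R[i]^o).
Proof.
move=> dm A nA.
have [W [oW Wz] WA] : exists2 B, open_nbhs (ch z0 m : R[i]^o) B & B `<=` A.
  by move: nA; rewrite nbhsE.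
have o := open_toric oW dm.
have N : nbhs z0 [set z | sle (ot z) (ot z0) /\ W (ch z m)].
  by apply: open_nbhs_nbhs; split=> //; split=> //; exact: sle_refl.
by apply: filterS N => z [_ /WA].
Qed.

(** Eventually all points lift to the chart of [ot z0], where convergence is tested on
    generators. *)
Lemma toric_cvg (T : Type) (F : set_system T) (FF : Filter F) (h : T -> toric) z0 :
  (\forall t \near F, sle (ot (h t)) (ot z0)) ->
  (forall m, dual_monoid (val (ot z0)) m ->
    (ch (h t) m : R[i]^o) @[t --> F] --> (ch z0 m : R[i]^o)) ->
  h t @[t --> F] --> z0.
Proof.
set sigma := ot z0 => nle nch.
pose x0 := chart_of (@subset_refl _ (val sigma)) (ch_hom hS z0).
have z0E : \pi_toric (ochart sigma x0) = z0.
  by rewrite (pi_chart_of hS _ _ (datumP hS z0)) reprK.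
(* [x0] fills in for those [t] whose point is not in the chart; eventually there are none. *)
pose j t : chart k (val sigma) := match pselect (val (ot (h t)) `<=` val sigma) with
  | left le => chart_of le (ch_hom hS (h t)) | right _ => x0 end.
have jE t : sle (ot (h t)) sigma ->
    \pi_toric (ochart sigma (j t)) = h t /\
    forall m, dual_monoid (val sigma) m -> cval (j t) m = ch (h t) m.
  move=> /sleP le; rewrite /j; case: pselect => // le'; split.
    by rewrite (pi_chart_of hS _ _ (datumP hS (h t))) reprK.
  by move=> m dm; rewrite cval_chart_of.
have [gD _] := generators_fan hS sigma.
have jx : j t @[t --> F] --> x0.
  apply: cvg_initial; apply: cvg_matrix => a i; rewrite !mxE.
  have gm : dual_monoid (val sigma) (generators (val sigma))`_i.
    by apply: gD; rewrite mem_nth.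
  have E : {near F, (fun t => ch (h t) (generators (val sigma))`_i : R[i]^o) =1
      (fun t => @chart_coord R n k (val sigma) (j t) a i : R[i]^o)}.
    apply: filterS nle => t /jE[_ e]; rewrite mxE -[LHS]e//.
  apply: cvg_trans (near_eq_cvg E) _.
  rewrite (_ : set_val _ _ = ch z0 (generators (val sigma))`_i); first exact: nch.
  by rewrite -[LHS]/(cval x0 _) cval_chart_of.
rewrite -z0E.
have E : {near F, (fun t => \pi_toric (ochart sigma (j t)) : toric) =1 h}.
  by apply: filterS nle => t /jE[].
apply: cvg_trans; first exact: (near_eq_cvg E).
apply: (@cvg_comp _ _ _ j (fun y => \pi_toric (ochart sigma y) : toric) F (nbhs x0) _ jx).
move=> A nA; by have := @pi_continuous _ {eq_quot glue_equiv k Sigma} (ochart sigma x0) A nA.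
Qed.

End ToricTopology.

(** * The order complex in the toric variety *)

Section ComplexModulus.
Context {R : realType}.
Implicit Types (z : R[i]) (x : R).

Definition absc z : R := complex.Re `|z|.

Lemma abscC z : (absc z)%:C = `|z|.
Proof. by rewrite RRe_real// normr_real. Qed.

Lemma absc_ge0 z : 0 <= absc z.
Proof. by rewrite -lecR abscC normr_ge0. Qed.

Lemma abscM z z' : absc (z * z') = absc z * absc z'.
Proof. by apply: complexI; rewrite rmorphM !abscC normrM. Qed.

Lemma absc_eq0 z : (absc z == 0) = (z == 0).
Proof. by rewrite -(inj_eq (@complexI R)) abscC normr_eq0. Qed.

Lemma absc0 : absc 0 = 0.
Proof. by apply/eqP; rewrite absc_eq0. Qed.

Lemma absc1 : absc 1 = 1.
Proof. by apply: complexI; rewrite abscC normr1. Qed.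

Lemma absc_gt0 z : (0 < absc z) = (z != 0).
Proof. by rewrite lt_neqAle absc_ge0 andbT eq_sym absc_eq0. Qed.

Lemma abscR x : 0 <= x -> absc x%:C = x.
Proof. by move=> x0; apply: complexI; rewrite abscC ger0_norm// lecR. Qed.

Lemma norm_realC x : `|x%:C| = `|x|%:C.
Proof. by rewrite normc_def /= expr0n/= addr0 sqrtr_sqr. Qed.

Lemma absc_cvg (T : Type) (F : set_system T) (FF : Filter F) (f : T -> R[i]) z :
  (f t : R[i]^o) @[t --> F] --> (z : R[i]^o) -> absc (f t) @[t --> F] --> absc z.
Proof.
move=> /(@cvgrPdist_lt R[i] R[i]^o) h; apply/(@cvgrPdist_lt R R) => e e0.
have e0' : 0 < e%:C by rewrite ltcR.
apply: filterS (h _ e0') => t; rewrite -ltcR; apply: le_lt_trans.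
by rewrite -norm_realC rmorphB /= !abscC; exact: ler_dist_dist.
Qed.

Lemma absc0_cvg (T : Type) (F : set_system T) (FF : Filter F) (f : T -> R[i]) :
  absc (f t) @[t --> F] --> (0 : R) -> (f t : R[i]^o) @[t --> F] --> (0 : R[i]^o).
Proof.
move=> /(@cvgrPdist_lt R R) h; apply/(@cvgrPdist_lt R[i] R[i]^o) => e e0.
have e0' : 0 < complex.Re e by move: e0; rewrite ltcE => /andP[].
have eE : e = (complex.Re e)%:C by rewrite RRe_real// gtr0_real.
apply: filterS (h _ e0') => t; rewrite !sub0r !normrN eE -abscC ltcR.
by rewrite ger0_norm// absc_ge0.
Qed.

Lemma realC_cvg (T : Type) (F : set_system T) (FF : Filter F) (f : T -> R) x :
  f t @[t --> F] --> x -> ((f t)%:C : R[i]^o) @[t --> F] --> (x%:C : R[i]^o).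
Proof.
move=> /(@cvgrPdist_lt R R) h; apply/(@cvgrPdist_lt R[i] R[i]^o) => e e0.
have e0' : 0 < complex.Re e by move: e0; rewrite ltcE => /andP[].
have eE : e = (complex.Re e)%:C by rewrite RRe_real// gtr0_real.
apply: filterS (h _ e0') => t; rewrite eE -rmorphB norm_realC ltcR//.
Qed.

End ComplexModulus.

(** * Points of the order complex and their least cones *)

Section Realization.
Context {R : realType} {n : nat} {Sigma : {fset set 'cV[R]_n}}.
Hypothesis hS : is_fan Sigma.
Implicit Types (sigma tau rho : Sigma).
Local Notation realization := (realization Sigma).
Local Notation rset := (@realization_set R n Sigma).
Implicit Types y : realization.

Definition co y : Sigma -> R := set_val (y : rset).

Lemma strict_face_slt : (fun tau sigma : Sigma =>
  `[< strict_face (val tau) (val sigma) >]) = slt.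
Proof.
apply/funext => tau; apply/funext => sigma; apply/asboolP/idP => [[/face_sub ts /eqP nts]|].
  by rewrite /slt; apply/andP; split; [apply: contra nts => /eqP ->|exact/sleP].
case/andP => nts /sleP ts; split; first exact: fan_face.
by move=> /val_inj e; rewrite e eqxx in nts.
Qed.

Lemma slt_trans : transitive (@slt R n Sigma).
Proof. by move=> b a c ab /slt_le; exact: slt_le_trans ab. Qed.

Lemma supporting_chain (x : Sigma -> R) s : supporting_simplex x s ->
  chain [pred sigma | x sigma != 0].
Proof.
case; rewrite strict_face_slt => ss xs sigma tau /=; rewrite !xs => hs ht.
move: ss; rewrite (sorted_pairwise slt_trans) => /(pairwiseP sigma) ps.
have is_ := hs; rewrite -index_mem in is_; have it_ := ht; rewrite -index_mem in it_.
rewrite -(nth_index sigma hs) -(nth_index sigma ht).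
have [h|h|->] := ltngtP (index sigma s) (index tau s).
- by rewrite (slt_le (ps _ _ is_ it_ h)).
- by rewrite (slt_le (ps _ _ it_ is_ h)) orbT.
- by rewrite sle_refl.
Qed.

Lemma supporting_simplex_min (x : Sigma -> R) sigma0 s :
  supporting_simplex x (sigma0 :: s) ->
  x sigma0 != 0 /\ forall sigma, x sigma != 0 -> sle sigma0 sigma.
Proof.
case; rewrite strict_face_slt /= => ss xs; split; first by rewrite xs mem_head.
move=> sigma; rewrite xs inE => /predU1P[->|hs]; first exact: sle_refl.
by move: ss; rewrite (path_sortedE slt_trans) => /andP[/allP/(_ _ hs)/slt_le].
Qed.

Lemma chain_supporting (x : Sigma -> R) : chain [pred sigma | x sigma != 0] ->
  exists s, supporting_simplex x s.
Proof.
move=> cx; pose s := sort (@sle R n Sigma) (enum [pred sigma | x sigma != 0]).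
have ms sigma : (sigma \in s) = (x sigma != 0) by rewrite mem_sort mem_enum.
exists s; split=> [|sigma]; last by rewrite ms.
rewrite strict_face_slt (sorted_pairwise slt_trans).
have us : uniq s by rewrite sort_uniq enum_uniq.
rewrite uniq_pairwise in us.
have : sorted (@sle R n Sigma) s.
  apply: (@sort_sorted_in _ [pred sigma | x sigma != 0]).
    by move=> a b; exact: cx.
  by apply/allP => a; rewrite mem_enum.
rewrite (sorted_pairwise (@sle_trans R n Sigma)) => ls.
have -> : @slt R n Sigma = [rel a b | (a != b) && sle a b] by [].
by rewrite pairwise_relI us ls.
Qed.

Lemma co_ge0 y sigma : 0 <= co y sigma.
Proof. by have [] : rset (co y) := set_valP (y : rset). Qed.

Lemma co_sum y : \sum_sigma co y sigma = 1.
Proof. by have [] : rset (co y) := set_valP (y : rset). Qed.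

Lemma co_chain y : chain [pred sigma | co y sigma != 0].
Proof.
have [_ _ [s hs]] : rset (co y) := set_valP (y : rset).
exact: supporting_chain hs.
Qed.

Lemma realization_of_subproof (x : Sigma -> R) : (forall sigma, 0 <= x sigma) ->
  \sum_sigma x sigma = 1 -> chain [pred sigma | x sigma != 0] -> rset x.
Proof. by move=> x0 x1 cx; split=> //; exact: chain_supporting. Qed.

Definition realization_of (x : Sigma -> R) (x0 : forall sigma, 0 <= x sigma)
    (x1 : \sum_sigma x sigma = 1) (cx : chain [pred sigma | x sigma != 0]) : realization :=
  SigSub (mem_set (realization_of_subproof x0 x1 cx)) : rset.

Lemma co_realization_of x x0 x1 cx : co (@realization_of x x0 x1 cx) = x.
Proof. by rewrite /co set_valE. Qed.

Lemma co_inj : injective co.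
Proof. by move=> y y' e; apply: val_inj; move: e; rewrite /co !set_valE. Qed.

Lemma co_min_ex y : exists tau, co y tau != 0 /\
  forall sigma, co y sigma != 0 -> sle tau sigma.
Proof.
have [[sigma ys]|y0] := pselect (exists sigma, co y sigma != 0).
  by have [tau] := chain_min (@co_chain y) ys; exists tau.
have := co_sum y; rewrite big1 => [/eqP|sigma _]; first by rewrite eq_sym oner_eq0.
by apply/eqP; apply: contraT => ys; case: y0; exists sigma.
Qed.

Definition mn y : Sigma := projT1 (cid (co_min_ex y)).

Lemma mn_neq0 y : co y (mn y) != 0.
Proof. by have [] := projT2 (cid (co_min_ex y)). Qed.

Lemma mn_le y sigma : co y sigma != 0 -> sle (mn y) sigma.
Proof. by have [_] := projT2 (cid (co_min_ex y)); exact. Qed.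

Lemma mn_gt0 y : 0 < co y (mn y).
Proof. by rewrite lt_neqAle co_ge0 eq_sym mn_neq0. Qed.

Lemma mn_uniq y tau : co y tau != 0 -> (forall sigma, co y sigma != 0 -> sle tau sigma) ->
  mn y = tau.
Proof. by move=> yt /(_ _ (mn_neq0 y)); apply: sle_anti; exact: mn_le. Qed.

Lemma co_continuous sigma : continuous (fun y => co y sigma).
Proof.
move=> y; have h := @initial_continuous _ _ (@set_val _ (rset)) y.
have p := @proj_continuous Sigma (fun=> R) sigma (co y).
exact: (cvg_comp _ _ h p).
Qed.

Lemma realization_cvg (T : Type) (F : set_system T) (FF : Filter F)
    (f : T -> realization) y :
  (forall sigma, co (f t) sigma @[t --> F] --> co y sigma) -> f t @[t --> F] --> y.
Proof.
move=> fy; apply: cvg_initial; apply/cvg_sup => sigma.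
by apply: cvg_initial; exact: fy.
Qed.

(** Supports can only grow nearby, so the least cone can only shrink. *)
Lemma near_mn y0 : \forall y \near y0, (forall sigma, co y0 sigma != 0 -> co y sigma != 0) /\
  sle (mn y) (mn y0).
Proof.
have N sigma : \forall y \near y0, co y0 sigma != 0 -> co y sigma != 0.
  have [_|c0] := eqVneq (co y0 sigma) 0; first by apply: (@nearW _ (nbhs y0)).
  have /(_ y0) h := @co_continuous sigma.
  by apply: filterS (@cvgr_neq0 R R _ _ _ _ _ h c0) => y yn _.
have {}N := @filter_forall _ _ (fun sigma y => co y0 sigma != 0 -> co y sigma != 0)
  _ (nbhs_filter y0) N.
by apply: filterS N => y h; split=> //; apply/mn_le/h/mn_neq0.
Qed.

End Realization.

(** * Continuity and injectivity of the embedding *)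

Section Embedding.
Context {R : realType} {n : nat} {Sigma : {fset set 'cV[R]_n}}.
Hypothesis hS : is_fan Sigma.
Implicit Types (sigma tau rho : Sigma) (m : 'rV[int]_n).
Local Notation realization := (realization Sigma).
Local Notation toR := (map_mx (intr : int -> R)).
Local Notation mn := (@mn R n Sigma hS).
Implicit Types y : realization.

(* At the least cone of the support, division by 0 makes the ratio 0.         *)
Definition ratio y sigma : R := co y sigma / below (co y) sigma.

Definition wt y m : R := \sum_sigma ratio y sigma * pr m (toR (bary sigma)).

Definition ev y m : R :=
  if `[< orth_lattice (val (mn y)) m >] then expR (- wt y m) else 0.

Lemma below_ge0 y sigma : 0 <= below (co y) sigma.
Proof. by apply: sumr_ge0 => tau _; exact: co_ge0. Qed.

Lemma ratio_ge0 y sigma : 0 <= ratio y sigma.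
Proof. by rewrite divr_ge0 ?co_ge0// below_ge0. Qed.

Lemma below_gt0 y tau sigma : co y tau != 0 -> slt tau sigma -> 0 < below (co y) sigma.
Proof.
move=> yt ts; rewrite /below (bigD1 tau)//= ltr_pwDl//.
  by rewrite lt_neqAle co_ge0 eq_sym yt.
by apply: sumr_ge0 => rho _; exact: co_ge0.
Qed.

Lemma wtD y m m' : wt y (m + m') = wt y m + wt y m'.
Proof.
by rewrite /wt -big_split; apply: eq_bigr => sigma _; rewrite prDl mulrDr.
Qed.

Lemma wt0 y : wt y 0 = 0.
Proof. by rewrite /wt big1// => sigma _; rewrite pr0l mulr0. Qed.

Lemma evE y m : orth_lattice (val (mn y)) m -> ev y m = expR (- wt y m).
Proof. by move=> mo; rewrite /ev asboolT. Qed.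

Lemma ev_eq0 y m : ~ orth_lattice (val (mn y)) m -> ev y m = 0.
Proof. by move=> mo; rewrite /ev asboolF. Qed.

Lemma ev_ge0 y m : 0 <= ev y m.
Proof. by rewrite /ev; case: ifP => // _; exact: expR_ge0. Qed.

Lemma scalar_setR (k : scalars) (x : R) : 0 <= x -> @scalar_set R k x%:C.
Proof.
move=> x0; have x0' : 0 <= x%:C by rewrite lecR.
by case: k => //=; exact: ger0_real.
Qed.

Lemma ev_hom (k : scalars) y : @orbit_hom R n Sigma k (mn y) (fun m => (ev y m)%:C).
Proof.
split=> [|m m' mo mo'|m mo|m mo].
- by rewrite evE ?wt0 ?oppr0 ?expR0//; exact: orth_lattice0.
- rewrite !evE//; last exact: orth_latticeD.
  by rewrite wtD opprD expRD rmorphM.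
- exact/scalar_setR/ev_ge0.
- by rewrite ev_eq0.
Qed.

Lemma below_continuous sigma : continuous (fun y => below (co y) sigma).
Proof.
move=> y; apply: (@cvg_sumr _ _ (nbhs_filter y)) => tau _.
exact: co_continuous.
Qed.

(** Above [mn y0] the denominator has a positive limit. A cone incomparable with [mn y0] has weight
    0 near [y0], since supports are chains. *)
Lemma ratio_cvg y0 sigma : ~~ sle sigma (mn y0) ->
  ratio y sigma @[y --> y0] --> ratio y0 sigma.
Proof.
move=> nle; have [le|nle'] := boolP (sle (mn y0) sigma).
  apply: (@cvgM R _ _ (nbhs_filter y0)); first exact: co_continuous.
  apply: (@cvgV R _ _ (nbhs_filter y0)); last exact: below_continuous.
  rewrite gt_eqF// (below_gt0 (mn_neq0 hS y0))// /slt le andbT.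
  by apply: contraNneq nle => ->; exact: sle_refl.
have r0 y : co y (mn y0) != 0 -> ratio y sigma = 0.
  move=> y0n; rewrite /ratio; have [->|ys] := eqVneq (co y sigma) 0; first by rewrite mul0r.
  by have := co_chain hS ys y0n; rewrite (negPf nle) (negPf nle').
rewrite r0; last exact: mn_neq0.
have N : {near y0, (fun=> 0) =1 ratio^~ sigma}.
  by apply: filterS (near_mn hS y0) => y [h _]; rewrite r0//; apply/h/mn_neq0.
by apply: cvg_trans (near_eq_cvg N) _; exact: cvg_cst.
Qed.

Definition upper_wt y0 y m : R :=
  \sum_(sigma | ~~ sle sigma (mn y0)) ratio y sigma * pr m (toR (bary sigma)).

Lemma upper_wt_cvg y0 m : upper_wt y0 y m @[y --> y0] --> upper_wt y0 y0 m.
Proof.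
apply: (@cvg_sumr _ _ (nbhs_filter y0)) => sigma ns.
by apply: (@cvgM R _ _ (nbhs_filter y0)); [exact: ratio_cvg|exact: cvg_cst].
Qed.

(** If [m] is orthogonal to [mn y0], the cones inside [mn y0] contribute nothing. If not, then near
    [y0] the value is either 0 already or is forced to 0 by the ratio at [mn y0], whose denominator
    tends to 0. *)
Lemma ev_cvg y0 m : dual_monoid (val (mn y0)) m -> ev y m @[y --> y0] --> ev y0 m.
Proof.
move=> dm; set s0 := mn y0.
have wtE y : wt y m = upper_wt y0 y m +
    \sum_(sigma | sle sigma s0) ratio y sigma * pr m (toR (bary sigma)).
  by rewrite /wt (bigID (fun sigma => sle sigma s0))/= addrC.
have in0 sigma : sle sigma s0 -> val s0 (toR (bary sigma)).
  by move=> /sleP; apply; exact: bary_in.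
have [mo|nmo] := pselect (orth_lattice (val s0) m).
  have wtE' y : wt y m = upper_wt y0 y m.
    rewrite wtE big1 ?addr0// => sigma /in0 s; rewrite [pr _ _]mo//.
    by rewrite mulr0.
  have N : {near y0, (fun y => expR (- upper_wt y0 y m)) =1 ev^~ m}.
    apply: filterS (near_mn hS y0) => y [_ /sleP le].
    by rewrite evE ?wtE'//; exact: orth_latticeS le mo.
  apply: cvg_trans (near_eq_cvg N) _; rewrite evE// wtE'.
  apply: (@continuous_cvg _ _ _ _ (nbhs_filter y0)); first exact: continuous_expR.
  by apply: (@cvgN R R _ _ (nbhs_filter y0)); exact: upper_wt_cvg.
rewrite ev_eq0//.
have low0 : below (co y0) s0 = 0.
  apply: big1 => tau ts; apply/eqP; apply: contraT => /(mn_le hS).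
  by rewrite slt_nge.
(* This is exp x >= 1 + x for the part x of the exponent coming from cones inside [s0]; x is at
   least the ratio at [s0], because [m] takes a positive integer value at bary(s0). *)
have bound : \forall y \near y0, 0 <= ev y m <=
    expR (- upper_wt y0 y m) * (below (co y) s0 / co y s0).
  apply: filterS (near_mn hS y0) => y [h le]; rewrite ev_ge0/=.
  have cs0 : co y s0 != 0 by apply/h/mn_neq0.
  have [mo|nmo'] := pselect (orth_lattice (val (mn y)) m); last first.
    by rewrite ev_eq0// mulr_ge0 ?expR_ge0// divr_ge0 ?below_ge0 ?co_ge0.
  rewrite evE// wtE opprD expRD ler_pM2l ?expR_gt0//.
  have b0 : 0 < below (co y) s0.
    apply: (below_gt0 (mn_neq0 hS y)); rewrite /slt le andbT.
    by apply/eqP => e; apply: nmo; rewrite -e.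
  have r0 : 0 < ratio y s0 by rewrite divr_gt0// lt_neqAle co_ge0 eq_sym cs0.
  rewrite -[leRHS]invf_div -[_ / _]/(ratio y s0) expRN lef_pV2 ?posrE ?expR_gt0//.
  apply: le_trans (expR_ge1Dx _); apply: ler_wpDl => //.
  rewrite (bigD1 s0)/=; last exact: sle_refl.
  apply: ler_wpDr.
    by apply: sumr_ge0 => sigma /andP[/in0 s _]; rewrite mulr_ge0 ?ratio_ge0//; exact: dm.
  apply: ler_peMr; first exact: ltW.
  have := dm _ (bary_in hS s0); rewrite -[pairing _ _]/(pr _ _) le_eqVlt => /predU1P[e|].
    by case: nmo; apply: bary_orth_lattice => //.
  by rewrite prI ltr0z ler1z gtz0_ge1.
apply: (squeeze_cvgr bound); first exact: cvg_cst.
rewrite -[X in _ --> X](mulr0 (expR (- upper_wt y0 y0 m))).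
apply: (@cvgM R _ _ (nbhs_filter y0)).
  apply: (@continuous_cvg _ _ _ _ (nbhs_filter y0)); first exact: continuous_expR.
  by apply: (@cvgN R R _ _ (nbhs_filter y0)); exact: upper_wt_cvg.
rewrite -[X in _ --> X](mul0r (co y0 s0)^-1) -low0; apply: (@cvgM R _ _ (nbhs_filter y0)).
  exact: below_continuous.
by apply: (@cvgV R _ _ (nbhs_filter y0)); [exact: mn_neq0|exact: co_continuous].
Qed.

(** [flag_weights_inj] recovers the ratios. By induction on the rank they determine the weights up
    to a common factor, which the total weight 1 fixes. *)
Lemma ev_inj y y' : mn y = mn y' ->
  (forall m, orth_lattice (val (mn y)) m -> ev y m = ev y' m) -> y = y'.
Proof.
move=> emn eev; set s0 := mn y in emn eev.
pose d (x : realization) sigma := if sigma == s0 then 0 else ratio x sigma.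
have dP x : mn x = s0 -> flag_weights s0 (d x).
  move=> xs; have dn sigma : d x sigma != 0 -> sigma != s0 /\ co x sigma != 0.
    rewrite /d; have [//|ns] := eqVneq sigma s0; first by rewrite eqxx.
    by rewrite /ratio mulf_eq0 => /norP[].
  split=> [sigma|sigma tau /= /dn[_ hs] /dn[_ ht]|sigma /dn[ns cs]].
  - by rewrite /d; case: ifP => // _; exact: ratio_ge0.
  - exact: (co_chain hS hs ht).
  - by apply/andP; split; [rewrite eq_sym|rewrite -xs; exact: mn_le].
have dE x m : orth_lattice (val s0) m ->
    \sum_sigma d x sigma * pr m (toR (bary sigma)) = wt x m.
  move=> mo; apply: eq_bigr => sigma _; rewrite /d; case: eqP => // ->.
  by rewrite [pr _ _]mo ?mulr0//; exact: bary_in.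
have dd : d y =1 d y'.
  apply: (flag_weights_inj hS (dP y erefl) (dP y' (esym emn))) => m mo.
  rewrite !dE//; apply: oppr_inj; apply: expR_inj.
  by rewrite -!evE -?emn// eev.
pose c := co y' s0 / co y s0.
have s0n : co y s0 != 0 by exact: mn_neq0.
have prop sigma : co y' sigma = c * co y sigma.
  have [N] := ubnP (rank sigma); elim: N => // N IH in sigma *; rewrite ltnS => hN.
  have [->|ns] := eqVneq sigma s0; first by rewrite /c divfK.
  have bE : below (co y') sigma = c * below (co y) sigma.
    rewrite /below mulr_sumr; apply: eq_bigr => tau ts; apply: IH.
    exact: leq_trans (slt_rank ts) hN.
  have := dd sigma; rewrite /d (negPf ns) /ratio.
  have z0 x : mn x = s0 -> below (co x) sigma = 0 -> co x sigma = 0.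
    move=> xs b0; apply/eqP; apply: contraT => xn.
    have h : slt (mn x) sigma by apply/andP; split; [rewrite xs eq_sym|exact: mn_le].
    by have := below_gt0 (mn_neq0 hS x) h; rewrite b0 ltxx.
  have [b0|b0] := eqVneq (below (co y) sigma) 0.
    by move=> _; rewrite (z0 y)// (z0 y') ?mulr0// bE b0 mulr0.
  rewrite bE => e; have c0 : c != 0.
    by rewrite mulf_neq0 ?invr_neq0// emn mn_neq0.
  have : co y' sigma = co y sigma / below (co y) sigma * (c * below (co y) sigma).
    by rewrite e divfK// mulf_neq0.
  by move=> ->; rewrite mulrCA divfK.
have c1 : c = 1.
  have := co_sum y'; under eq_bigr do rewrite prop.
  by rewrite -mulr_sumr co_sum mulr1.
by apply: co_inj; apply/funext => sigma; rewrite prop c1 mul1r.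
Qed.

End Embedding.

Section Additive.
Context {R : realType} {n : nat}.

Lemma additive_pairing (f : 'rV[int]_n -> R) : (forall a b, f (a + b) = f a + f b) ->
  exists w : 'cV[R]_n, forall m, f m = pr m w.
Proof.
move=> fD; have f0 : f 0 = 0 by apply: (addrI (f 0)); rewrite -fD !addr0.
have fN a : f (- a) = - f a by apply: (addrI (f a)); rewrite -fD !subrr.
have fMn a c : f (a *+ c) = f a *+ c.
  by elim: c => [|c IH]; rewrite ?mulr0n// !mulrS fD IH.
have fZ (c : int) a : f (c *: a) = c%:~R * f a.
  case: c => c.
    by rewrite -[Posz c]natz scaler_nat fMn natz -mulr_natl.
  by rewrite NegzE -natz scaleNr scaler_nat fN fMn rmorphN /= natz mulNr -mulr_natl.
exists (\col_i f (delta_mx 0 i)) => m.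
rewrite [in LHS](row_sum_delta m) (big_morph f fD f0) /pr /pairing mxE.
by apply: eq_bigr => i _; rewrite fZ !mxE.
Qed.

End Additive.

(** * Surjectivity of the embedding for complete fans *)

Section Surjectivity.
Context {R : realType} {n : nat} {Sigma : {fset set 'cV[R]_n}}.
Hypothesis hS : is_fan Sigma.
Implicit Types (sigma tau rho : Sigma) (m : 'rV[int]_n).
Local Notation realization := (realization Sigma).
Local Notation toR := (map_mx (intr : int -> R)).
Local Notation mn := (@mn R n Sigma hS).

(* Some cone contains w + N bary rho for infinitely many N, hence bary rho.   *)
Lemma complete_star rho (w : 'cV[R]_n) : complete Sigma ->
  exists sigma (N : nat), sle rho sigma /\ val sigma (w + N%:R *: toR (bary rho)).
Proof.
move=> cS; pose b := toR (bary rho).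
have [sigma inf] : exists sigma : Sigma, forall B, exists2 N, (B <= N)%N &
    val sigma (w + N%:R *: b).
  apply: contrapT => no.
  have /choice[B BP] : forall sigma : Sigma, exists B, forall N, (B <= N)%N ->
      ~ val sigma (w + N%:R *: b).
    move=> sigma; apply: contrapT => noB; apply: no; exists sigma => B.
    apply: contrapT => noN; apply: noB; exists B => N BN sN.
    by apply: noN; exists N.
  have [A AS Aw] := cS (w + (\max_sigma B sigma)%:R *: b).
  apply: (BP (FSetSub AS) _ _ Aw); exact: (leq_bigmax (FSetSub AS)).
exists sigma; have [N _ sN] := inf 0%N; exists N; split=> //.
apply/sleP/(bary_sub hS).
(* An inequality of sigma violated by bary(rho) would be violated by w + N bary(rho) for all large
   N. *)
have [ms msP] := @weyl R n (gens sigma).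
rewrite gensP//; apply/msP => m mms; rewrite leNgt; apply/negP => mb.
have [M] : exists M : nat, pr m w / - pr m b < M%:R.
  exists (Num.truncn `|pr m w / - pr m b|).+1.
  apply: le_lt_trans (ler_norm _) _; exact: truncnS_gt.
rewrite ltr_pdivrMr ?oppr_gt0// => MP.
have [N' MN] := inf M; rewrite gensP// => /msP/(_ m mms).
rewrite /pr pairingDr pairingZr -!/(pr _ _) leNgt => /negP; apply.
rewrite -ltrBrDr sub0r -mulrN; apply: lt_le_trans MP _.
by rewrite ler_wpM2r ?ler_nat// oppr_ge0 ltW.
Qed.

(** Minus the logarithm of the modulus is additive on rho^perp; extended by a projection, it is the
    pairing with a vector [w]. Adding multiples of bary(rho) is invisible on rho^perp and moves [w]
    into a cone containing rho. *)
Lemma ev_surj (k : scalars) (z : toric k Sigma) : complete Sigma ->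
  exists y : realization, mn y = ot hS z /\ forall m, ev hS y m = absc (ch hS z m).
Proof.
move=> cS; set rho := ot hS z; set chi := ch hS z.
have hc : @orbit_hom R n Sigma k rho chi by exact: ch_hom.
have [P [Po Pid]] := orth_lattice_projection hS rho.
pose f m : R := - ln (absc (chi (m *m P))).
have [_ cM _ c0] := hc.
have pos m : orth_lattice (val rho) m -> 0 < absc (chi m).
  by move=> mo; rewrite absc_gt0; exact/(orbit_hom_neq0 _ hc).
have [|w fw] := @additive_pairing R n f.
  move=> a b; rewrite /f mulmxDl cM// abscM lnM ?posrE ?pos//.
  by rewrite opprD.
have [sigma [N [rs sv]]] := complete_star rho w cS.
have [x [x0 xr xc xb xE]] := star_decomposition hS rs sv.
pose mass := \sum_tau x tau.
have mass0 : 0 < mass by rewrite /mass (bigD1 rho)//= ltr_pwDl// sumr_ge0.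
(* Normalizing the weights leaves the ratios unchanged. *)
pose x' tau := x tau / mass.
have x'n tau : (x' tau != 0) = (x tau != 0).
  by rewrite mulf_eq0 invr_eq0 (gt_eqF mass0) orbF.
have x'0 tau : 0 <= x' tau by rewrite divr_ge0// ltW.
have x'1 : \sum_tau x' tau = 1 by rewrite -mulr_suml divff// gt_eqF.
have x'c : chain [pred tau | x' tau != 0].
  by move=> a b /=; rewrite !x'n; exact: xc.
pose y := realization_of hS x'0 x'1 x'c.
have yE : co y = x' by exact: co_realization_of.
have ymn : mn y = rho.
  apply: mn_uniq => [|tau]; rewrite yE x'n; first by rewrite gt_eqF.
  by move=> /xb/andP[].
exists y; split=> // m; have [mo|nmo] := pselect (orth_lattice (val rho) m); last first.
  by rewrite ev_eq0 ?ymn// (c0 m)// absc0.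
rewrite evE ?ymn//; have -> : wt y m = pr m (w + N%:R *: toR (bary rho)).
  rewrite -xE//; apply: eq_bigr => tau _; congr (_ * _).
  rewrite /ratio yE /below -mulr_suml /x' invf_div mulrA.
  by rewrite divfK// gt_eqF.
rewrite /pr pairingDr pairingZr [X in _ + _ * X]mo; last exact: bary_in.
by rewrite mulr0 addr0 -/(pr m w) -fw /f opprK Pid// lnK// posrE pos.
Qed.

Section Phi.
Context {k : scalars}.

Definition phi (y : realization) : toric k Sigma := pt (ev_hom hS k y).

Lemma ot_phi y : ot hS (phi y) = mn y.
Proof. exact: ot_pt. Qed.

Lemma ch_phi y m : ch hS (phi y) m = (ev hS y m)%:C.
Proof. by rewrite ch_pt. Qed.

Lemma phi_continuous : continuous phi.
Proof.
move=> y0; apply: (toric_cvg (nbhs_filter y0)).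
  by apply: filterS (near_mn hS y0) => y [_]; rewrite !ot_phi.
move=> m; rewrite ot_phi => dm; rewrite ch_phi.
under eq_fun do rewrite ch_phi.
by apply: (realC_cvg (nbhs_filter y0)); exact: ev_cvg.
Qed.

End Phi.

End Surjectivity.

(** * The retraction onto the order complex *)

Lemma compact_set_type (X : topologicalType) (A : set X) :
  compact A -> compact [set: A].
Proof.
move=> cA F FF _.
have [|x [Ax xF]] := cA (fmap (@set_val _ A) F) (fmap_proper_filter _ FF).
  by rewrite /fmap /=; apply: filterE => a; exact: set_valP.
exists (SigSub (mem_set Ax)); split=> // B C FB nC.
have [_ [[W oW <-] Wx WC]] := nC.
have FB' : fmap (@set_val _ A) F (set_val @` B).
  exact: (@filterS _ F _ B _ (@preimage_image _ _ set_val B) FB).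
have nW : nbhs x W.
  by apply: open_nbhs_nbhs; split=> //; move: Wx; rewrite /= set_valE.
have [_ [[a Ba <-] Wa]] := xF _ _ FB' nW.
by exists a; split=> //; exact: WC.
Qed.

(** * Extension of functions from compact sets *)

Section DistanceToSet.
Context {R : realType} {V : pseudoMetricNormedZmodType R} (B : set V).
Hypothesis B0 : B !=set0.

Definition dist_set (v : V) : R := inf [set `|v - b| | b in B].

Let lb0 v : lbound [set `|v - b| | b in B] 0.
Proof. by move=> _ [b _ <-]. Qed.

Let ne v : [set `|v - b| | b in B] !=set0.
Proof. by have [b Bb] := B0; exists `|v - b|, b. Qed.

Lemma dist_set_ge0 v : 0 <= dist_set v.
Proof. by apply: lb_le_inf; [exact: ne|exact: lb0]. Qed.

Lemma dist_set_le v b : B b -> dist_set v <= `|v - b|.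
Proof. by move=> Bb; apply: ge_inf; [exists 0; exact: lb0|exists b]. Qed.

Lemma dist_set_eq0 v : B v -> dist_set v = 0.
Proof.
move=> Bv; apply/eqP; rewrite eq_le dist_set_ge0 andbT.
by rewrite (le_trans (dist_set_le v Bv))// subrr normr0.
Qed.

Lemma dist_set_lipschitz v w : `|dist_set v - dist_set w| <= `|v - w|.
Proof.
have half x y : dist_set x - dist_set y <= `|x - y|.
  rewrite lerBlDr -lerBlDl; apply: lb_le_inf; first exact: ne.
  move=> _ [b Bb <-].
  rewrite lerBlDl (le_trans (dist_set_le x Bb))//.
  by rewrite (_ : x - b = (x - y) + (y - b)) ?ler_normD// addrA subrK.
by rewrite ler_norml half andbT lerNl opprB distrC half.
Qed.

Lemma dist_set_continuous : continuous dist_set.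
Proof.
move=> v; apply/(@cvgrPdist_lt R R) => e e0.
have h : id w @[w --> v] --> v by exact: cvg_id.
move/(@cvgrPdist_lt R V) : h => /(_ e e0).
by apply: filterS => w; apply: le_lt_trans; exact: dist_set_lipschitz.
Qed.

Lemma dist_set_gt0 v : closed B -> ~ B v -> 0 < dist_set v.
Proof.
move=> cB nBv; have oB : open (~` B) by exact: closed_openC.
have /nbhs_ballP[e /= e0 be] : nbhs v (~` B) by exact: open_nbhs_nbhs.
apply: (lt_le_trans e0); apply: lb_le_inf; first exact: ne.
move=> _ [b Bb <-].
rewrite leNgt; apply/negP => h; apply: (be b) => //.
by rewrite -ball_normE /ball_ /=.
Qed.

End DistanceToSet.

Section CompactFactor.
Context {R : realType} {d : nat} {K : topologicalType}.
Hypothesis cK : compact [set: K].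

(* A Tietze extension, made positive off the image of h by adding the         *)
(* distance to that image.                                                    *)
Lemma compact_factor (h : K -> 'rV[R]_d) (f : K -> R) :
  continuous h -> continuous f -> (forall y, 0 <= f y <= 1) ->
  (forall y y', h y = h y' -> f y = f y') -> (forall y, h y = 0 -> f y = 0) ->
  exists G : 'rV[R]_d -> R, [/\ continuous G, forall y, G (h y) = f y, G 0 = 0,
    forall v, 0 <= G v & forall v, v != 0 -> (forall y, v <> h y) -> 0 < G v].
Proof.
move=> ch cf f01 hf h0.
pose B := range h `|` [set 0].
have rc C : closed C -> compact (h @` (f @^-1` C)).
  move=> cC; apply: continuous_compact; first exact: continuous_subspaceT.
  apply: subclosed_compact cK _ => //; exact: (proj1 (continuous_closedP f) cf C cC).
have haus : hausdorff_space 'rV[R]_d by exact: norm_hausdorff.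
have cB : closed B.
  apply: closedU; last by apply: compact_closed => //; exact: compact_set1.
  by apply: (compact_closed haus); have := rc setT (@closedT _); rewrite preimage_setT.
have B0 : B !=set0 by exists 0; right.
pose g v : R := match pselect (exists y, v = h y) with
  | left e => f (projT1 (cid e)) | right _ => 0 end.
have gh y : g (h y) = f y.
  rewrite /g; case: pselect => [e|[]]; last by exists y.
  by apply: hf; rewrite -(projT2 (cid e)).
have g0 : g 0 = 0.
  rewrite /g; case: pselect => // e; apply: h0.
  by rewrite -(projT2 (cid e)).
have cg : {within B, continuous g}.
  apply/continuous_closedP => C cC; apply/closed_subspaceP.
  (* Preimages of closed sets under [g] are images of compact sets, up to the point 0. *)
  exists (h @` (f @^-1` C) `|` [set v | v = 0 /\ C 0]).
    apply: closedU; first exact: (compact_closed haus (rc C cC)).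
    have [C0|nC0] := pselect (C 0).
      rewrite (_ : [set v | _] = [set 0]); last by apply/seteqP; split=> v //= [].
      by apply: compact_closed => //; exact: compact_set1.
    by rewrite (_ : [set v | _] = set0); [exact: closed0|apply/seteqP; split=> v //= []].
  rewrite /from_subspace; apply/seteqP; split=> v [] /=.
    by move=> [[y Cy <-]|[-> C0]] Bv; split=> //=; rewrite ?gh ?g0.
  move=> Cv [[y _ yv]|v0].
    by split; [left; exists y => //; rewrite /= -gh yv|left; exists y].
  by split; [right; rewrite v0 g0 in Cv|right].
have [|F [FB cF F1]] := continuous_bounded_extension (@pseudometric_normal R 'rV[R]_d)
  cB (@ltr01 R) cg.
  move=> v [[y _ <-]|->]; last by rewrite g0 normr0.
  by rewrite gh; have /andP[a b] := f01 y; rewrite ger0_norm.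
have FBE v : B v -> F v = g v by move=> Bv; rewrite FB// inE.
exists (fun v => `|F v| + dist_set B v); split.
- move=> v.
  have h1 : `|F w| @[w --> v] --> `|F v| by apply: (@cvg_norm R R _ _ (nbhs_filter v)); exact: cF.
  have h2 : dist_set B w @[w --> v] --> dist_set B v by exact: dist_set_continuous.
  exact: (@cvgD R R _ _ (nbhs_filter v) _ _ _ _ h1 h2).
- move=> y; have By : B (h y) by left; exists y.
  rewrite dist_set_eq0// addr0 FBE// gh ger0_norm//.
  by have /andP[] := f01 y.
- have By : B 0 by right.
  by rewrite dist_set_eq0// addr0 FBE// g0 normr0.
- by move=> v; rewrite addr_ge0// dist_set_ge0.
- move=> v v0 vh; rewrite ltr_wpDl// dist_set_gt0//.
  by move=> [[y _ e]|/eqP]; [exact: (vh y)|rewrite (negPf v0)].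
Qed.

End CompactFactor.

Section RealizationCompact.
Context {R : realType} {n : nat} {Sigma : {fset set 'cV[R]_n}}.
Hypothesis hS : is_fan Sigma.
Local Notation rset := (@realization_set R n Sigma).

(** Being supported on a chain is a closed condition, namely that products of coordinates at
    incomparable cones vanish; so the realization is closed in a cube. *)
Lemma realization_compact : compact [set: realization Sigma].
Proof.
apply: compact_set_type.
have pc (sigma : Sigma) : continuous (fun x : {ptws Sigma -> R} => x sigma).
  exact: (@proj_continuous Sigma (fun=> R) sigma).
have sc (r : seq Sigma) : continuous (fun x : {ptws Sigma -> R} => \sum_(s <- r) x s).
  by move=> x; apply: (@cvg_sumr _ _ (nbhs_filter x)) => s _; exact: pc.
have -> : rset = [set x : {ptws Sigma -> R} | forall sigma, `[0, 1]%classic (x sigma)] `&`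
   ([set x | \sum_sigma x sigma = 1] `&`
    \bigcap_(p in [set p : Sigma * Sigma | ~~ (sle p.1 p.2 || sle p.2 p.1)])
      [set x | x p.1 * x p.2 = 0]).
  apply/seteqP; split=> x.
    move=> [x0 x1 [s hs]]; split; last split=> //.
      move=> sigma /=; rewrite in_itv/= x0/= -x1 (bigD1 sigma)//= lerDl.
      by apply: sumr_ge0 => tau _; exact: x0.
    move=> [a b] /= nab; apply/eqP; rewrite mulf_eq0; apply: contraNT nab.
    by case/norP; exact: (supporting_chain hS hs).
  move=> [x01 [x1 xc]]; apply: (realization_of_subproof hS) => //.
    by move=> sigma; have := x01 sigma; rewrite /= in_itv/= => /andP[].
  move=> a b /= xa xb; apply: contraT => nab.
  by have := xc (a, b) nab => /eqP; rewrite /= mulf_eq0 (negPf xa) (negPf xb).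
apply: compact_closedI.
  exact: (@tychonoff Sigma (fun=> R) (fun=> `[0, 1]%classic) (fun=> @segment_compact R 0 1)).
apply: closedI.
  apply: (@preimage_closed _ _ _ [set x : R | x = 1]); last exact: closed_eq.
  by move=> x _; exact: sc.
apply: closed_bigI => -[a b] _ /=.
apply: (@preimage_closed _ _ _ [set x : R | x = 0]); last exact: closed_eq.
by move=> x _; apply: (@cvgM R _ _ (nbhs_filter x)); exact: pc.
Qed.

End RealizationCompact.

(** * Bump functions and the orbit-preserving retraction *)

Section Retraction.
Context {R : realType} {n : nat} {Sigma : {fset set 'cV[R]_n}} {k : scalars}.
Hypothesis hS : is_fan Sigma.
Implicit Types (sigma tau rho : Sigma) (m : 'rV[int]_n).
Local Notation realization := (realization Sigma).
Local Notation toric := (toric k Sigma).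
Local Notation mn := (@mn R n Sigma hS).
Local Notation ot := (@ot R n Sigma k hS).
Local Notation ch := (@ch R n Sigma k hS).
Local Notation phi := (@phi R n Sigma hS k).
Implicit Types (z : toric) (y : realization).

Lemma absc_hom tau (chi : 'rV[int]_n -> R[i]) : @orbit_hom R n Sigma k tau chi ->
  @orbit_hom R n Sigma k tau (fun m => (absc (chi m))%:C).
Proof.
move=> [c1 cM cK c0]; split=> [|m m' mo mo'|m mo|m mo].
- by rewrite c1 absc1.
- by rewrite cM// abscM rmorphM.
- exact/scalar_setR/absc_ge0.
- by rewrite c0// absc0.
Qed.

Definition absz z : toric := pt (absc_hom (ch_hom hS z)).

Lemma ot_absz z : ot (absz z) = ot z.
Proof. exact: ot_pt. Qed.

Lemma ch_absz z m : ch (absz z) m = (absc (ch z m))%:C.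
Proof. by rewrite ch_pt. Qed.

Lemma toric_eq_on_chart sigma z z' : sle (ot z) sigma -> sle (ot z') sigma ->
  (forall m, dual_monoid (val sigma) m -> ch z m = ch z' m) -> z = z'.
Proof.
move=> /sleP le /sleP le' e.
pose p : charts k Sigma := existT (fun sigma : Sigma => chart k (val sigma)) sigma
  (chart_of le (ch_hom hS z)).
have h : orbit_datum p (ot z) (ch z).
  by split=> //= [|m dm]; [exact: ch_hom|rewrite cval_chart_of].
have h' : orbit_datum p (ot z') (ch z').
  by split=> //= [|m dm]; [exact: ch_hom|rewrite cval_chart_of// e].
have [eo ec] := orbit_datum_uniq hS h h'; exact: (toric_eq eo ec).
Qed.

Definition av z m : R := absc (ch z m).

Lemma av_ge0 z m : 0 <= av z m. Proof. exact: absc_ge0. Qed.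

Definition sepf sigma tau : 'rV[int]_n := projT1 (cid (separating_form hS sigma tau)).

(** The entry 0 keeps [theta] non-zero on the chart, the generators make it injective up to phases,
    and the separating forms make [total] blow up on leaving the chart. *)
Definition forms sigma : seq 'rV[int]_n :=
  0 :: generators (val sigma) ++ codom (sepf sigma).

Lemma forms_dual sigma m : m \in forms sigma -> dual_monoid (val sigma) m.
Proof.
rewrite inE mem_cat => /predU1P[->|/orP[|/codomP[tau ->]]].
- exact: dual_monoid0.
- by have [gD _] := generators_fan hS sigma; exact: gD.
- by have [] := projT2 (cid (separating_form hS sigma tau)).
Qed.

Definition total sigma z : R := \sum_(m <- forms sigma) av z m.

Lemma total_ge sigma z m : m \in forms sigma -> av z m <= total sigma z.
Proof.
move=> mf; rewrite /total (big_rem m)//= lerDl.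
by apply: sumr_ge0 => m' _; exact: av_ge0.
Qed.

Lemma av0 z : av z 0 = 1.
Proof. by rewrite /av (monoid_hom1 (ch_hom hS z)) absc1. Qed.

Lemma total_ge1 sigma z : 1 <= total sigma z.
Proof. by rewrite -(av0 z) total_ge// mem_head. Qed.

Lemma total_gt0 sigma z : 0 < total sigma z.
Proof. exact: lt_le_trans ltr01 (total_ge1 sigma z). Qed.

(* The chart of sigma is embedded by the values on forms sigma, rescaled so   *)
(* as to tend to 0 at infinity; this extends by 0 to the whole variety.       *)
Definition theta sigma z : 'rV[R]_(size (forms sigma)) :=
  if sle (ot z) sigma then \row_i (av z (forms sigma)`_i / total sigma z ^+ 2) else 0.

Lemma theta_ge0 sigma z i : 0 <= theta sigma z 0 i.
Proof.
rewrite /theta; case: ifP => _; rewrite mxE// divr_ge0 ?av_ge0// exprn_ge0//.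
exact/ltW/total_gt0.
Qed.

Lemma theta_le sigma z i : sle (ot z) sigma -> theta sigma z 0 i <= (total sigma z)^-1.
Proof.
move=> le; rewrite /theta le mxE ler_pdivrMr ?exprn_gt0 ?total_gt0//.
by rewrite expr2 mulKf ?gt_eqF ?total_gt0// total_ge// mem_nth.
Qed.

Lemma av_cvg z0 m : dual_monoid (val (ot z0)) m -> av z m @[z --> z0] --> av z0 m.
Proof. by move=> dm; apply: (absc_cvg (nbhs_filter z0)); exact: ch_cvg. Qed.

(** The point is continuity at [z0] off the chart. Chart points near [z0] have cones inside both
    sigma and [ot z0], so the separating form [m] has a non-zero value on them. The modulus at [- m]
    tends to 0, and it bounds the inverse of [total]. *)
Lemma theta_continuous sigma : continuous (theta sigma).
Proof.
move=> z0; apply: (@cvg_matrix _ _ (nbhs_filter z0) R) => a i; rewrite ord1 {a}.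
have [le|nle] := boolP (sle (ot z0) sigma).
  have N : {near z0, (fun z => av z (forms sigma)`_i / total sigma z ^+ 2)
      =1 (fun z => theta sigma z 0 i)}.
    apply: filterS (near_sle hS z0) => z lz.
    by rewrite /theta (sle_trans lz le) mxE.
  apply: cvg_trans (near_eq_cvg N) _; rewrite /theta le mxE.
  have dm m : m \in forms sigma -> dual_monoid (val (ot z0)) m.
    by move=> /forms_dual; apply: dual_monoidS; exact/sleP.
  apply: (@cvgM R _ _ (nbhs_filter z0)).
    by apply: av_cvg; apply: dm; rewrite mem_nth.
  apply: (@cvgV R _ _ (nbhs_filter z0)); first by rewrite gt_eqF// exprn_gt0// total_gt0.
  apply: (@cvg_expr _ _ (nbhs_filter z0) R).
  rewrite /total big_seq; under eq_fun do rewrite big_seq.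
  by apply: (@cvg_sumr _ _ (nbhs_filter z0) R) => m /dm; exact: av_cvg.
have [] := projT2 (cid (separating_form hS sigma (ot z0))).
rewrite -/(sepf sigma (ot z0)); set m := sepf _ _ => m1 m2 m3.
have {}m3 : ~ orth_lattice (val (ot z0)) m by apply: m3 => /sleP; rewrite (negPf nle).
have mf : m \in forms sigma.
  by rewrite inE mem_cat; apply/or3P/Or33/codom_f.
have t0 : theta sigma z0 0 i = 0 by rewrite /theta (negPf nle) mxE.
have av0' : av z0 (- m) = 0.
  have [_ _ _ c0] := ch_hom hS z0; rewrite /av c0 ?absc0// => mo.
  by apply: m3; rewrite -[m]opprK; exact: orth_latticeN.
have bound : \forall z \near z0, 0 <= theta sigma z 0 i <= av z (- m).
  apply: filterS (near_sle hS z0) => z lz; rewrite theta_ge0/=.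
  have [le|nle'] := boolP (sle (ot z) sigma); last by rewrite /theta (negPf nle') mxE av_ge0.
  apply: le_trans (theta_le i le) _.
  have mo : orth_lattice (val (ot z)) m.
    move=> v zv; apply/eqP; rewrite eq_le andbC m1/=; last by move/sleP: le; exact.
    by rewrite -oppr_ge0 -[pairing _ _]/(pr m v) -prNl; apply: m2; move/sleP: lz; exact.
  have mno := orth_latticeN mo.
  have -> : av z (- m) = (av z m)^-1.
    rewrite /av (monoid_homN mo mno (ch_hom hS z)).
    have avm : absc (ch z m) != 0 by rewrite absc_eq0; exact/(orbit_hom_neq0 _ (ch_hom hS z)).
    apply: (mulfI avm); rewrite mulfV// -abscM mulfV ?absc1//.
    by rewrite -absc_eq0.
  rewrite lef_pV2 ?posrE ?total_gt0 ?total_ge//.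
  by rewrite /av absc_gt0; exact/(orbit_hom_neq0 _ (ch_hom hS z)).
rewrite t0; apply: (squeeze_cvgr bound); first exact: cvg_cst.
by rewrite -av0'; exact: av_cvg.
Qed.

Lemma theta0 sigma z : sle (ot z) sigma -> 0 < theta sigma z 0 0.
Proof. by move=> le; rewrite /theta le mxE /= av0 divr_gt0// exprn_gt0// total_gt0. Qed.

Lemma theta_eq0 sigma z : theta sigma z = 0 <-> ~~ sle (ot z) sigma.
Proof.
split=> [t0|nle]; last by rewrite /theta (negPf nle).
by apply/negP => /theta0; rewrite t0 mxE ltxx.
Qed.

(** Coordinate 0 is the inverse square of [total], which permits the other coordinates to be
    unscaled. *)
Lemma theta_inj sigma z z' : sle (ot z) sigma -> theta sigma z = theta sigma z' ->
  absz z = absz z'.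
Proof.
move=> le e; have le' : sle (ot z') sigma.
  by apply: contraT => /theta_eq0 t0; move: (theta0 le); rewrite e t0 mxE ltxx.
have [gD gE] := generators_fan hS sigma.
have E j : (j < size (forms sigma))%N -> av z (forms sigma)`_j / total sigma z ^+ 2 =
    av z' (forms sigma)`_j / total sigma z' ^+ 2.
  move=> jl; have := congr1 (fun M : 'rV_(size (forms sigma)) => M 0 (Ordinal jl)) e.
  by rewrite /theta le le' !mxE.
have eav j : (j < size (forms sigma))%N -> av z (forms sigma)`_j = av z' (forms sigma)`_j.
  move=> jl; have := E 0%N isT; rewrite /= !av0 !mul1r => e0.
  move: (E j jl); rewrite e0; apply: mulIf.
  by rewrite invr_eq0 gt_eqF// exprn_gt0// total_gt0.
apply: (@toric_eq_on_chart sigma); rewrite ?ot_absz// => m dm; rewrite !ch_absz.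
congr (_%:C); have [c mE] := gE m dm.
have P x : sle (ot x) sigma -> absc (ch x m) =
    \prod_(i < size (generators (val sigma))) av x (generators (val sigma))`_i ^+ c i.
  move=> /sleP lx; rewrite -(cval_chart_of lx (ch_hom hS x) dm) (dual_cval hS _ mE).
  rewrite (big_morph (@absc R) (@abscM R) (@absc1 R)); apply: eq_bigr => i _.
  rewrite cval_chart_of; last by apply: gD; rewrite mem_nth.
  rewrite /av; elim: (c i) => [|j IH]; first by rewrite !expr0 absc1.
  by rewrite !exprS abscM IH.
rewrite !P//; apply: eq_bigr => i _; congr (_ ^+ _).
have := eav i.+1; rewrite /= !nth_cat ltn_ord ltnS size_cat; apply.
by rewrite ltn_addr.
Qed.

Lemma av_absz z m : av (absz z) m = av z m.
Proof. by rewrite /av ch_absz abscR// absc_ge0. Qed.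

Lemma theta_absz sigma z : theta sigma (absz z) = theta sigma z.
Proof.
rewrite /theta ot_absz; case: ifP => // _; apply/rowP => i; rewrite !mxE av_absz.
by congr (_ / _ ^+ _); apply: eq_bigr => m _; exact: av_absz.
Qed.

Lemma absz_phi y : absz (phi y) = phi y.
Proof.
apply: (toric_eq (hS := hS)); rewrite ?ot_absz//; apply/funext => m.
by rewrite ch_absz ch_phi abscR// ev_ge0.
Qed.

Lemma phi_inj : injective phi.
Proof.
move=> y y' e; apply: (ev_inj (hS := hS)) => [|m _].
  by rewrite -(ot_phi hS (k := k)) e ot_phi.
by apply: complexI; rewrite -!(ch_phi hS (k := k)) e.
Qed.

Lemma co_le1 y sigma : co y sigma <= 1.
Proof.
rewrite -(co_sum y) (bigD1 sigma)//= lerDl.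
by apply: sumr_ge0 => tau _; exact: co_ge0.
Qed.

(** [compact_factor] is applied to [theta] on the order complex. Positivity on the orbit of sigma
    holds on the image of [phi] because the least cone has positive weight, and elsewhere by the
    added distance. *)
Lemma bump_ex sigma : exists a : toric -> R, [/\ continuous a,
  forall y, a (phi y) = co y sigma, forall z, 0 <= a z,
  forall z, (a z != 0 -> sle (ot z) sigma) /\ (ot z = sigma -> 0 < a z) &
  forall z, a (absz z) = a z].
Proof.
pose h y := theta sigma (phi y).
have ch' : continuous h.
  by move=> y; apply: continuous_comp; [exact: phi_continuous|exact: theta_continuous].
have co0 y : ~~ sle (mn y) sigma -> co y sigma = 0.
  by move=> nle; apply/eqP; apply: contraNT nle; exact: mn_le.
have [|y y'|y|G [cG Gh G0 Gge0 Ggt0]] := compact_factor (realization_compact hS)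
    ch' (@co_continuous R n Sigma sigma).
- by move=> y; rewrite co_ge0 co_le1.
- move=> e; have [le|nle] := boolP (sle (mn y) sigma).
    have le' : sle (ot (phi y)) sigma by rewrite ot_phi.
    by have := theta_inj le' e; rewrite !absz_phi => /phi_inj ->.
  have t0 : h y = 0 by apply/theta_eq0; rewrite ot_phi.
  by move: e; rewrite t0 (co0 y)// => /esym/theta_eq0; rewrite ot_phi => /co0 ->.
- by move=> /theta_eq0; rewrite ot_phi; exact: co0.
exists (fun z => G (theta sigma z)); split.
- by move=> z; apply: continuous_comp; [exact: theta_continuous|exact: cG].
- exact: Gh.
- by move=> z.
- move=> z; split.
    by apply: contraR => /theta_eq0 ->; rewrite G0.
  move=> oz; have le : sle (ot z) sigma by rewrite oz sle_refl.
  have [[y zy]|nzy] := pselect (exists y, theta sigma z = h y).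
    rewrite zy Gh; have := theta_inj le zy; rewrite absz_phi => e.
    have -> : sigma = mn y by rewrite -oz -ot_absz e ot_phi.
    exact: mn_gt0.
  apply: Ggt0 => [|y zy]; last by apply: nzy; exists y.
  by apply/eqP => /theta_eq0; rewrite le.
- by move=> z; rewrite theta_absz.
Qed.

Definition bump sigma : toric -> R := projT1 (cid (bump_ex sigma)).

Lemma bump_continuous sigma : continuous (bump sigma).
Proof. by have [] := projT2 (cid (bump_ex sigma)). Qed.

Lemma bump_phi sigma y : bump sigma (phi y) = co y sigma.
Proof. by have [_ h _ _ _] := projT2 (cid (bump_ex sigma)); exact: h. Qed.

Lemma bump_ge0 sigma z : 0 <= bump sigma z.
Proof. by have [_ _ h _ _] := projT2 (cid (bump_ex sigma)); exact: h. Qed.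

Lemma bump_neq0 sigma z : bump sigma z != 0 -> sle (ot z) sigma.
Proof. by have [_ _ _ /(_ z)[h _] _] := projT2 (cid (bump_ex sigma)). Qed.

Lemma bump_gt0 z : 0 < bump (ot z) z.
Proof. by have [_ _ _ /(_ z)[_ h] _] := projT2 (cid (bump_ex (ot z))); exact: h. Qed.

Lemma bump_absz sigma z : bump sigma (absz z) = bump sigma z.
Proof. by have [_ _ _ _ h] := projT2 (cid (bump_ex sigma)); exact: h. Qed.

Definition incomparable sigma tau := ~~ (sle sigma tau || sle tau sigma).

(* The order complex is a flag complex: subtracting the weights of all        *)
(* incomparable cones retracts arbitrary weights to weights supported on a    *)
(* chain.                                                                     *)
Definition flag_bump sigma z : R :=
  Num.max 0 (bump sigma z - \sum_(tau | incomparable sigma tau) bump tau z).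

Lemma flag_bump_ge0 sigma z : 0 <= flag_bump sigma z.
Proof. by rewrite le_max lexx. Qed.

Lemma flag_bump_neq0 sigma z : flag_bump sigma z != 0 ->
  \sum_(tau | incomparable sigma tau) bump tau z < bump sigma z.
Proof.
rewrite /flag_bump maxEle; case: ifP => [|_]; last by rewrite eqxx.
by rewrite le_eqVlt => /predU1P[<-|]; rewrite ?eqxx// subr_gt0.
Qed.

(** Of two incomparable cones, each would need a strictly larger bump than the other. *)
Lemma flag_bump_chain z : chain [pred sigma | flag_bump sigma z != 0].
Proof.
move=> sigma tau /= /flag_bump_neq0 hs /flag_bump_neq0 ht; apply: contraT => nst.
have le a b : incomparable a b ->
    bump b z <= \sum_(t | incomparable a t) bump t z.
  move=> ab; rewrite (bigD1 b)//= lerDl.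
  by apply: sumr_ge0 => t _; exact: bump_ge0.
have := lt_trans (le_lt_trans (le _ _ nst) hs).
have nts : incomparable tau sigma by rewrite /incomparable orbC.
by move=> /(_ _ (le_lt_trans (le _ _ nts) ht)); rewrite ltxx.
Qed.

Lemma flag_bump_sle sigma z : flag_bump sigma z != 0 -> sle (ot z) sigma.
Proof.
move=> /flag_bump_neq0 h; apply: bump_neq0; rewrite gt_eqF//; apply: le_lt_trans h.
by apply: sumr_ge0 => t _; exact: bump_ge0.
Qed.

Lemma flag_bump_gt0 z : 0 < flag_bump (ot z) z.
Proof.
rewrite lt_max; apply/orP; right; rewrite big1 ?subr0 ?bump_gt0// => tau ntau.
by apply/eqP; apply: contraNT ntau => /bump_neq0 ->.
Qed.

Definition flag_total z : R := \sum_sigma flag_bump sigma z.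

Lemma flag_total_gt0 z : 0 < flag_total z.
Proof.
rewrite /flag_total (bigD1 (ot z))//= ltr_pwDl ?flag_bump_gt0//.
by apply: sumr_ge0 => tau _; exact: flag_bump_ge0.
Qed.

Lemma retract_neq0 z sigma :
  (flag_bump sigma z / flag_total z != 0) = (flag_bump sigma z != 0).
Proof. by rewrite mulf_eq0 invr_eq0 (gt_eqF (flag_total_gt0 z)) orbF. Qed.

Lemma retract_ge0 z sigma : 0 <= flag_bump sigma z / flag_total z.
Proof. by rewrite divr_ge0 ?flag_bump_ge0// ltW// flag_total_gt0. Qed.

Lemma retract_sum z : \sum_sigma flag_bump sigma z / flag_total z = 1.
Proof. by rewrite -mulr_suml divff// gt_eqF// flag_total_gt0. Qed.

Lemma retract_chain z : chain [pred sigma | flag_bump sigma z / flag_total z != 0].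
Proof. by move=> a b /=; rewrite !retract_neq0; exact: flag_bump_chain. Qed.

Definition retract z : realization :=
  realization_of hS (retract_ge0 z) (retract_sum z) (@retract_chain z).

Lemma co_retract z sigma : co (retract z) sigma = flag_bump sigma z / flag_total z.
Proof. by rewrite co_realization_of. Qed.

(** Non-zero bumps occur only at cones containing [ot z], all comparable with it, so the truncation
    leaves the bump of [ot z] intact. *)
Lemma mn_retract z : mn (retract z) = ot z.
Proof.
apply: mn_uniq => [|sigma]; rewrite co_retract retract_neq0.
  by rewrite gt_eqF// flag_bump_gt0.
exact: flag_bump_sle.
Qed.

Lemma flag_bump_continuous sigma : continuous (flag_bump sigma).
Proof.
pose g z := bump sigma z - \sum_(tau | incomparable sigma tau) bump tau z.
have cg : continuous g.
  move=> z; apply: (@cvgB R R _ _ (nbhs_filter z)); first exact: bump_continuous.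
  by apply: (@cvg_sumr _ _ (nbhs_filter z) R) => tau _; exact: bump_continuous.
have c0 : continuous (cst 0 : toric -> R^o) by exact: cst_continuous.
by move=> z; exact: (@continuous_max R toric (cst 0) g z (@c0 z) (@cg z)).
Qed.

Lemma retract_continuous : continuous retract.
Proof.
move=> z; apply: (realization_cvg (nbhs_filter z)) => sigma.
rewrite co_retract; under eq_fun do rewrite co_retract.
apply: (@cvgM R _ _ (nbhs_filter z)); first exact: flag_bump_continuous.
apply: (@cvgV R _ _ (nbhs_filter z)); first by rewrite gt_eqF// flag_total_gt0.
by apply: (@cvg_sumr _ _ (nbhs_filter z) R) => tau _; exact: flag_bump_continuous.
Qed.

Lemma flag_bump_phi sigma y : flag_bump sigma (phi y) = co y sigma.
Proof.
rewrite /flag_bump bump_phi; have [->|ys] := eqVneq (co y sigma) 0.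
  rewrite sub0r max_l// oppr_le0; apply: sumr_ge0 => tau _; exact: bump_ge0.
rewrite big1 ?subr0 ?max_r ?co_ge0// => tau nst.
rewrite bump_phi; apply/eqP; apply: contraNT nst => yt.
exact: (co_chain hS ys yt).
Qed.

Lemma retract_phi y : retract (phi y) = y.
Proof.
apply: co_inj; apply/funext => sigma; rewrite co_retract flag_bump_phi /flag_total.
by under eq_bigr do rewrite flag_bump_phi; rewrite co_sum divr1.
Qed.

Lemma retract_absz z : retract (absz z) = retract z.
Proof.
have E sigma : flag_bump sigma (absz z) = flag_bump sigma z.
  by rewrite /flag_bump bump_absz; under eq_bigr do rewrite bump_absz.
apply: co_inj; apply/funext => sigma; rewrite !co_retract E /flag_total.
by under eq_bigr do rewrite E.
Qed.

End Retraction.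

(** * Quotients by the compact torus and the deformation *)

Section TorusTopology.
Context {R : realType} {n : nat} {k : scalars}.
Local Notation torus := (torus R n k).
Implicit Types (g h : torus) (m : 'rV[int]_n).

Lemma lattice_ind (P : 'rV[int]_n -> Prop) : P 0 ->
  (forall a b, P a -> P b -> P (a + b)) -> (forall a, P a -> P (- a)) ->
  (forall i, P (delta_mx 0 i)) -> forall m, P m.
Proof.
move=> P0 PD PN Pd m; rewrite (row_sum_delta m); elim/big_ind : _ => // i _.
have PMn a c : P a -> P (a *+ c).
  by move=> Pa; elim: c => // c IH; rewrite mulrS; exact: PD.
case: (m 0 i) => c; first by rewrite -[Posz c]natz scaler_nat; exact: PMn.
by rewrite NegzE -natz scaleNr scaler_nat; exact/PN/PMn.
Qed.

Lemma tval0 g : tval g 0 = 1.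
Proof. by have [] := tvalP g. Qed.

Lemma tvalD g m m' : tval g (m + m') = tval g m * tval g m'.
Proof. by have [_ gM _ _] := tvalP g; exact: gM. Qed.

Lemma tval_norm g m : `|tval g m| = 1.
Proof. by have [_ _ /(_ m I)[]] := tvalP g. Qed.

Lemma tval_neq0 g m : tval g m != 0.
Proof. by rewrite -normr_eq0 tval_norm oner_eq0. Qed.

Lemma tvalN g m : tval g (- m) = (tval g m)^-1.
Proof.
by apply: (mulfI (tval_neq0 g m)); rewrite -tvalD subrr tval0 mulfV// tval_neq0.
Qed.

Lemma absc_tval g m : absc (tval g m) = 1.
Proof. by apply: complexI; rewrite abscC tval_norm. Qed.

Lemma tval_eq g h : (forall i, tval g (delta_mx 0 i) = tval h (delta_mx 0 i)) -> g = h.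
Proof.
move=> e; have E : tval g = tval h.
  apply/funext; apply: lattice_ind => //; first by rewrite !tval0.
  - by move=> a b ea eb; rewrite !tvalD ea eb.
  - by move=> a ea; rewrite !tvalN ea.
by apply: val_inj; move: E; rewrite /tval !set_valE.
Qed.

Lemma tval_cvg g m : (tval h m : R[i]^o) @[h --> g] --> (tval g m : R[i]^o).
Proof.
move: m; apply: lattice_ind.
- rewrite tval0; under eq_fun do rewrite tval0.
  exact: (@cvg_cst R[i]^o 1 _ _ (nbhs_filter g)).
- move=> a b ga gb; rewrite tvalD; under eq_fun do rewrite tvalD.
  exact: (@cvgM R[i] _ _ (nbhs_filter g) (fun h => tval h a) (fun h => tval h b) _ _ ga gb).
- move=> a ga; rewrite tvalN; under eq_fun do rewrite tvalN.
  exact: (@cvgV R[i] _ _ (nbhs_filter g) (fun h => tval h a) _ (tval_neq0 g a) ga).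
move=> i; have E : (fun h : torus => tval h (delta_mx 0 i) : R[i]^o) =
    (fun M : 'rV[R[i]^o]_n => M 0 i) \o (@torus_coord R n k).
  by apply/funext => h /=; rewrite mxE.
have -> : tval g (delta_mx 0 i) = torus_coord g 0 i by rewrite mxE.
have h1 := @initial_continuous _ _ (@torus_coord R n k) g.
have h2 := @coord_continuous R[i] 1 n 0 i (torus_coord g).
rewrite E; exact: (cvg_comp _ _ h1 h2).
Qed.

Definition unit_scalars : set R[i]^o := [set z | scalar_set k z /\ `|z| = 1].

Lemma unit_scalars_compact : compact unit_scalars.
Proof.
pose u (p : R * R) : R[i]^o := p.1%:C + 'i * p.2%:C.
have cu : continuous u.
  move=> p; apply: (@cvgD R[i] R[i]^o _ _ (nbhs_filter p)).
    by apply: (realC_cvg (nbhs_filter p)); exact: cvg_fst.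
  apply: (@cvgM R[i] _ _ (nbhs_filter p)); first exact: cvg_cst.
  by apply: (realC_cvg (nbhs_filter p)); exact: cvg_snd.
have uE p : u p = (p.1 +i* p.2)%C.
  by rewrite /u [RHS]complexE.
pose S := [set p : R * R | p.1 ^+ 2 + p.2 ^+ 2 = 1] `&`
  (match k with Complexes => setT | Reals => [set p : R * R | p.2 = 0]
   | NonnegReals => [set p : R * R | p.2 = 0] `&` [set p : R * R | 0 <= p.1] end).
have cS : closed S.
  have c1 : continuous (fun p : R * R => p.1) by move=> p; exact: cvg_fst.
  have c2 : continuous (fun p : R * R => p.2) by move=> p; exact: cvg_snd.
  apply: closedI.
    apply: (@preimage_closed _ _ (fun p : R * R => p.1 ^+ 2 + p.2 ^+ 2) [set x : R | x = 1]);
      last exact: closed_eq.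
    move=> p _; apply: (@cvgD R R _ _ (nbhs_filter p)).
      by apply: (@cvg_expr _ _ (nbhs_filter p) R); exact: c1.
    by apply: (@cvg_expr _ _ (nbhs_filter p) R); exact: c2.
  have b0 : closed [set p : R * R | p.2 = 0].
    apply: (@preimage_closed _ _ (fun p : R * R => p.2) [set x : R | x = 0]);
      last exact: closed_eq.
    by move=> p _; exact: c2.
  case: k => //.
  apply: closedI => //.
  apply: (@preimage_closed _ _ (fun p : R * R => p.1) [set x : R | 0 <= x]);
    last exact: closed_ge.
  by move=> p _; exact: c1.
have Sc : compact S.
  have cI : compact ((`[-1, 1] : set R) `*` (`[-1, 1] : set R)).
    by apply: compact_setX; exact: segment_compact.
  apply: (subclosed_compact cS cI).
  have sq (a b : R) : a ^+ 2 + b ^+ 2 = 1 -> a \in `[-1, 1].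
    move=> e; rewrite in_itv /= -ler_norml -(@ler_pXn2r _ 2)// ?nnegrE//.
    by rewrite real_normK ?num_real// expr1n -e lerDl sqr_ge0.
  move=> [a b] [/= e _]; split=> /=; first exact: (sq a b).
  by apply: (sq b a); rewrite addrC.
have -> : unit_scalars = u @` S.
  have N1 (a b : R) : `|(a +i* b)%C| = 1 <-> a ^+ 2 + b ^+ 2 = 1.
    split=> [|e]; last by rewrite normc_def /= e sqrtr1.
    move=> e; have := add_Re2_Im2 (a +i* b)%C; rewrite e expr1n /=.
    by move=> /complexI.
  apply/seteqP; split=> z.
    case: z => a b [Kz /N1 e]; exists (a, b); last by rewrite uE.
    split=> //; move: Kz; case: k => //=.
      by rewrite realE !lecE /= => /orP[] /andP[/eqP]//.
    by rewrite lecE /= => /andP[/eqP -> ?].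
  move=> [[a b] [/= e h]] <-; rewrite uE /=; split; last exact/N1.
  move: h; case: k => //=; first by move=> ->; rewrite realE !lecE /= eqxx le_total.
  by move=> [-> a0]; rewrite lecE /= eqxx.
by apply: continuous_compact Sc; exact: continuous_subspaceT.
Qed.

End TorusTopology.

Section TorusCompact.
Context {R : realType} {n : nat} {k : scalars}.
Local Notation torus := (torus R n k).
Local Notation U := (@unit_scalars R k).

Definition unit_row : set 'rV[R[i]^o]_n := [set v | forall i, U (v ord0 i)].

Lemma unit_scalarsM (z w : R[i]) : U z -> U w -> U (z * w).
Proof. by move=> [zk z1] [wk w1]; split; [exact: scalar_setM|rewrite normrM z1 w1 mulr1]. Qed.

Lemma unit_scalarsV (z : R[i]) : U z -> U z^-1.
Proof. by move=> [zk z1]; split; [exact: scalar_setV|rewrite normfV z1 invr1]. Qed.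

Lemma unit_scalars1 : U 1.
Proof. by split; [exact: (@scalar_setR R k 1)|exact: normr1]. Qed.

Lemma unit_scalars_neq0 (z : R[i]) : U z -> z != 0.
Proof. by move=> [_ z1]; rewrite -normr_eq0 z1 oner_eq0. Qed.

Lemma unit_scalarsX (z : R[i]) (c : int) : U z -> U (z ^ c).
Proof.
move=> Uz; have UX j : U (z ^+ j).
  by elim: j => [|j IH]; [exact: unit_scalars1|rewrite exprS; exact: unit_scalarsM].
by case: c => j; [exact: UX|exact/unit_scalarsV/UX].
Qed.

Lemma torus_of_row_subproof (v : unit_row) :
  @torus_set R n k (fun m => \prod_i (set_val v ord0 i : R[i]) ^ (m ord0 i)).
Proof.
have Uv i : U (set_val v ord0 i) := set_valP v i.
split=> [|m m' _ _|m _|m []//].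
- by rewrite big1// => i _; rewrite mxE expr0z.
- rewrite -big_split; apply: eq_bigr => i _; rewrite mxE expfzDr//.
  exact: unit_scalars_neq0.
suff [] : U (\prod_i (set_val v ord0 i : R[i]) ^ (m ord0 i)) by [].
elim/big_ind : _ => [||i _]; [exact: unit_scalars1|exact: unit_scalarsM|].
exact: unit_scalarsX.
Qed.

Definition torus_of_row (v : unit_row) : torus :=
  SigSub (mem_set (torus_of_row_subproof v)) : @torus_set R n k.

Lemma tval_torus_of_row (v : unit_row) i :
  tval (torus_of_row v) (delta_mx 0 i) = set_val v ord0 i.
Proof.
rewrite /tval set_valE /= (bigD1 i)//= mxE !eqxx expr1z big1 ?mulr1// => j ji.
by rewrite mxE (negPf ji) expr0z.
Qed.

Lemma torus_compact : compact [set: torus].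
Proof.
have cr : compact [set: unit_row].
  apply: compact_set_type.
  exact: (@rV_compact R[i]^o n (fun=> U) (fun=> unit_scalars_compact)).
have E v : torus_coord (torus_of_row v) = set_val v.
  apply/rowP => i; rewrite mxE -[LHS]/(tval (torus_of_row v) _).
  exact: tval_torus_of_row.
have cf : continuous torus_of_row.
  move=> v; apply: (@cvg_initial _ _ (nbhs_filter v)); rewrite E.
  rewrite (_ : (fun w => _) = set_val); last by apply/funext => w; exact: E.
  exact: (@initial_continuous _ _ (@set_val _ unit_row) v).
rewrite (_ : [set: torus] = torus_of_row @` setT).
  by apply: continuous_compact cr; exact: continuous_subspaceT.
apply/seteqP; split=> // g _.
have gP : unit_row (torus_coord g).
  by move=> i; rewrite mxE; have [_ _ /(_ (delta_mx 0 i) I) []] := tvalP g.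
exists (SigSub (mem_set gP)) => //; apply: tval_eq => i.
by rewrite tval_torus_of_row set_valE /= mxE.
Qed.

End TorusCompact.

(** * The maps between Y and the toric variety *)

Section MapsToYspace.
Context {R : realType} {n : nat} {Sigma : {fset set 'cV[R]_n}} {k : scalars}.
Hypothesis hS : is_fan Sigma.
Implicit Types (sigma tau rho : Sigma) (m : 'rV[int]_n).
Local Notation realization := (realization Sigma).
Local Notation toric := (toric k Sigma).
Local Notation torus := (torus R n k).
Local Notation Yspace := (@Yspace R n Sigma k).
Local Notation Yprod := (@Yprod R n Sigma k).
Local Notation mn := (@mn R n Sigma hS).
Local Notation ot := (@ot R n Sigma k hS).
Local Notation ch := (@ch R n Sigma k hS).
Local Notation phi := (@phi R n Sigma hS k).
Local Notation retract := (@retract R n Sigma k hS).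
Implicit Types (z : toric) (y : realization) (g h : torus).

Lemma supporting_mn y : exists s, supporting_simplex (co y) (mn y :: s).
Proof.
have [_ _ [s hs]] : @realization_set R n Sigma (co y) := set_valP (y : @realization_set R n Sigma).
case: s hs => [[_ e]|sigma s hs]; first by have := mn_neq0 hS y; rewrite e.
by exists s; have [h1 h2] := supporting_simplex_min hS hs; rewrite (mn_uniq hS h1 h2).
Qed.

Lemma YrelP (p q : Yprod) : Yrel p q <->
  p.2 = q.2 /\ forall m, orth_lattice (val (mn p.2)) m -> tval p.1 m = tval q.1 m.
Proof.
split=> [/asboolP[e h]|[e h]].
  split=> // m mo; have [s hs] := supporting_mn p.2.
  have := h _ _ hs m mo; rewrite tval_mul tval_inv => e1.
  by rewrite -[RHS]mul1r -e1 divfK// tval_neq0.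
apply/asboolP; split=> // sigma s hs m mo.
have [h1 h2] := supporting_simplex_min hS hs.
by rewrite tval_mul tval_inv h ?mulfV ?tval_neq0// (mn_uniq hS h1 h2).
Qed.

Definition Phi0 (p : Yprod) : toric := toric_act p.1 (phi p.2).

Lemma ot_Phi0 p : ot (Phi0 p) = mn p.2.
Proof. by rewrite ot_act ot_phi. Qed.

Lemma ch_Phi0 p m : ch (Phi0 p) m = tval p.1 m * (ev hS p.2 m)%:C.
Proof. by rewrite ch_act ch_phi. Qed.

Lemma Phi0_rel p q : Yrel p q -> Phi0 p = Phi0 q.
Proof.
move=> /YrelP[e h]; apply: (toric_eq (hS := hS)); first by rewrite !ot_Phi0 e.
apply/funext => m; rewrite !ch_Phi0 -e.
have [mo|nmo] := pselect (orth_lattice (val (mn p.2)) m); first by rewrite h.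
by rewrite ev_eq0// !mulr0.
Qed.

Definition Phi (y : Yspace) : toric := Phi0 (repr y).

Lemma Phi_pi p : Phi (\pi_Yspace p) = Phi0 p.
Proof. by apply: Phi0_rel; apply/eqmodP; exact: reprK. Qed.

Lemma Phi_continuous : continuous Phi.
Proof.
apply/quotient_continuous.
have -> : Phi \o \pi_Yspace = Phi0 by apply/funext => p; exact: Phi_pi.
move=> [g0 y0]; apply: (toric_cvg (hS := hS) (nbhs_filter (g0, y0))).
  have N : \forall p \near (g0, y0), sle (mn p.2) (mn y0).
    have Ny : nbhs y0 [set y | sle (mn y) (mn y0)].
      by apply: filterS (near_mn hS y0) => y [].
    exact: (@cvg_snd _ _ (nbhs g0) (nbhs y0) _ _ Ny).
  by apply: filterS N => p; rewrite !ot_Phi0.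
move=> m; rewrite ot_Phi0 /= => dm; rewrite ch_Phi0.
rewrite (_ : (fun p => _) = fun p : Yprod => (tval p.1 m * (ev hS p.2 m)%:C : R[i]));
  last by apply/funext => p; exact: ch_Phi0.
apply: (@cvgM R[i] _ _ (nbhs_filter (g0, y0)) (fun p : Yprod => tval p.1 m)
  (fun p : Yprod => (ev hS p.2 m)%:C)).
  exact: (@cvg_comp Yprod torus R[i]^o (fun p => p.1) (fun g => tval g m) (nbhs (g0, y0))
    (nbhs g0) (nbhs (tval g0 m : R[i]^o)) cvg_fst (tval_cvg (g:=g0) (m:=m))).
apply: (realC_cvg (nbhs_filter (g0, y0))).
exact: (@cvg_comp Yprod realization R (fun p => p.2) (fun y => ev hS y m) (nbhs (g0, y0))
  (nbhs y0) (nbhs (ev hS y0 m)) cvg_snd (ev_cvg dm)).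
Qed.

Lemma Phi_equivariant : equivariant (@Yact R n Sigma k) (@toric_act R n k Sigma) Phi.
Proof.
move=> g y; rewrite -[y]reprK Yact_pi !Phi_pi; apply: (toric_eq (hS := hS)).
  by rewrite ot_act !ot_Phi0.
by apply/funext => m; rewrite ch_act !ch_Phi0 tval_mul mulrA.
Qed.

(** The phase is given on ([ot z])^perp only; composing with a projection of M onto it yields a
    torus element. *)
Lemma phase_ex z : exists g : torus, forall m, ch z m = tval g m * (absc (ch z m))%:C.
Proof.
have [P [Po Pid]] := orth_lattice_projection hS (ot z).
have hc := ch_hom hS z; have [c1 cM cK c0] := hc.
have cn m : ch z (m *m P) != 0 by exact/(orbit_hom_neq0 _ hc).
pose f m : R[i] := ch z (m *m P) / (absc (ch z (m *m P)))%:C.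
have fT : @torus_set R n k f.
  have an m : (absc (ch z (m *m P)))%:C != 0 by rewrite abscC normr_eq0.
  split=> [|m m' _ _|m _|m []//].
  - by rewrite /f mul0mx c1 absc1 divr1.
  - by rewrite /f mulmxDl cM// abscM rmorphM mulf_div.
  split; last by rewrite /= /f normf_div abscC normr_id divff// normr_eq0.
  apply: scalar_setM; first exact: cK.
  by apply: scalar_setV; exact/scalar_setR/absc_ge0.
exists (SigSub (mem_set fT) : @torus_set R n k) => m.
rewrite /tval set_valE /= /f.
have [mo|nmo] := pselect (orth_lattice (val (ot z)) m).
  by rewrite Pid// divfK// abscC normr_eq0; exact/(orbit_hom_neq0 _ hc).
by rewrite (c0 m)// absc0 mulr0.
Qed.

Definition phase z : torus := projT1 (cid (phase_ex z)).

Lemma phaseP z m : ch z m = tval (phase z) m * (absc (ch z m))%:C.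
Proof. exact: (projT2 (cid (phase_ex z)) m). Qed.

Definition Psi z : Yspace := \pi_Yspace (phase z, retract z).

(** Two phases agree on ([ot z])^perp, and [ot z] is the least cone of [retract z]. *)
Lemma Psi_phase z g : (forall m, ch z m = tval g m * (absc (ch z m))%:C) ->
  Psi z = \pi_Yspace (g, retract z).
Proof.
move=> gP; apply/eqmodP/YrelP; split=> //= m; rewrite mn_retract => mo.
have hc := ch_hom hS z; have cn : ch z m != 0 by exact/(orbit_hom_neq0 _ hc).
have an : (absc (ch z m))%:C != 0 by rewrite abscC normr_eq0.
by apply: (mulIf an); rewrite -phaseP -gP.
Qed.

Lemma absz_Phi0 p : absz hS (Phi0 p) = phi p.2.
Proof.
apply: (toric_eq (hS := hS)); first by rewrite ot_absz ot_Phi0 ot_phi.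
apply/funext => m; rewrite ch_absz ch_Phi0 ch_phi abscM absc_tval mul1r.
by rewrite abscR// ev_ge0.
Qed.

Lemma retract_Phi0 p : retract (Phi0 p) = p.2.
Proof. by rewrite -retract_absz absz_Phi0 retract_phi. Qed.

Lemma PhiK : cancel Phi Psi.
Proof.
move=> y; rewrite -[y]reprK Phi_pi; move: (repr y) => p.
rewrite (@Psi_phase _ p.1) ?retract_Phi0; first by case: p.
by move=> m; rewrite ch_Phi0 abscM absc_tval mul1r abscR// ev_ge0.
Qed.

(* phase is not continuous, but the torus is compact and [Psi z] does not     *)
(* depend on the choice of a phase.                                           *)
Lemma Psi_continuous : continuous Psi.
Proof.
move=> z0 A nA; have [B [oB Bz] BA] : exists2 B, open_nbhs (Psi z0) B & B `<=` A.
  by move: nA; rewrite nbhsE.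
pose P z g := (forall m, ch z m = tval g m * (absc (ch z m))%:C) ->
  B (\pi_Yspace (g, retract z)).
have cov : near_covering [set: torus] by apply/compact_near_coveringP; exact: torus_compact.
have N : \forall z \near z0, [set: torus] `<=` P z.
  apply: (cov toric (nbhs z0) P (nbhs_filter z0)) => g0 _.
  have cg m : (tval p.1 m : R[i]^o) @[p --> (g0, z0)] --> (tval g0 m : R[i]^o).
    exact: (@cvg_comp (torus * toric)%type torus R[i]^o (fun p => p.1) (fun g => tval g m)
      (nbhs (g0, z0)) (nbhs g0) (nbhs (tval g0 m : R[i]^o)) cvg_fst (tval_cvg (g:=g0) (m:=m))).
  have [e0|ne0] := pselect (forall m, ch z0 m = tval g0 m * (absc (ch z0 m))%:C).
    have c1 : ((p.1, retract p.2) : Yprod) @[p --> (g0, z0)] --> ((g0, retract z0) : Yprod).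
      have c0 : retract p.2 @[p --> (g0, z0)] --> retract z0.
        exact: (@cvg_comp (torus * toric)%type toric realization (fun p => p.2) retract
          (nbhs (g0, z0)) (nbhs z0) (nbhs (retract z0)) cvg_snd
          (@retract_continuous R n Sigma k hS z0)).
      have c2 : (p : torus * toric).1 @[p --> (g0, z0)] --> g0 by exact: cvg_fst.
      exact: (@cvg_pair _ _ _ (nbhs (g0, z0)) (nbhs g0) (nbhs (retract z0)) _ _ _ _ _ c2 c0).
    have c2 : nbhs ((g0, retract z0) : Yprod) [set q | B (\pi_Yspace q)].
      have := @pi_continuous Yprod {eq_quot @Yequiv R n Sigma k} (g0, retract z0) B.
      by rewrite -[\pi _](Psi_phase e0); apply; exact: open_nbhs_nbhs.
    apply: (@filterS _ (filter_prod (nbhs g0) (nbhs z0)) _ _ _ _ (c1 _ c2)) => p Bp _.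
    exact: Bp.
  (* If [g0] is not a phase of [z0], the failure at [m] persists nearby, and there [P] holds
     vacuously. *)
  move/existsNP : ne0 => [m /eqP ne].
  have dm : dual_monoid (val (ot z0)) m.
    apply: orth_dual; apply: contrapT => nmo; move: ne.
    by have [_ _ _ c0] := ch_hom hS z0; rewrite c0// absc0 mulr0 eqxx.
  have cz : (ch p.2 m : R[i]^o) @[p --> (g0, z0)] --> (ch z0 m : R[i]^o).
    exact: (@cvg_comp (torus * toric)%type toric R[i]^o (fun p => p.2) (fun z => ch z m)
      (nbhs (g0, z0)) (nbhs z0) (nbhs (ch z0 m : R[i]^o)) cvg_snd (ch_cvg dm)).
  have ca : ((absc (ch p.2 m))%:C : R[i]^o) @[p --> (g0, z0)] --> ((absc (ch z0 m))%:C : R[i]^o).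
    by apply: (realC_cvg (nbhs_filter (g0, z0))); apply: (absc_cvg (nbhs_filter (g0, z0))).
  have cw := @cvgB R[i] R[i]^o _ _ (nbhs_filter (g0, z0)) _ _ _ _ cz
    (@cvgM R[i] _ _ (nbhs_filter (g0, z0)) _ _ _ _ (cg m) ca).
  rewrite -subr_eq0 in ne.
  have nw := @cvgr_neq0 R[i] R[i]^o _ _ (nbhs_filter (g0, z0)) _ _ cw ne.
  apply: (@filterS _ (filter_prod (nbhs g0) (nbhs z0)) _ _ _ _ nw) => p /= wp h.
  case/negP: wp; apply/eqP.
  exact: (etrans (congr1 (fun x : R[i] => x - _) (h m)) (subrr _)).
by apply: filterS N => z /(_ (phase z) I) h; apply/BA/h => m; exact: phaseP.
Qed.

End MapsToYspace.

(** * The deformation and the two conclusions *)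

Section Homotopy.
Context {R : realType} {n : nat} {Sigma : {fset set 'cV[R]_n}} {k : scalars}.
Hypothesis hS : is_fan Sigma.
Implicit Types (sigma tau rho : Sigma) (m : 'rV[int]_n).
Local Notation toric := (toric k Sigma).
Local Notation torus := (torus R n k).
Local Notation ot := (@ot R n Sigma k hS).
Local Notation ch := (@ch R n Sigma k hS).
Local Notation mn := (@mn R n Sigma hS).
Local Notation retract := (@retract R n Sigma k hS).
Local Notation Phi := (@Phi R n Sigma k hS).
Local Notation Psi := (@Psi R n Sigma k hS).
Implicit Types (z : toric) (t : R) (g : torus).

Definition log_gap z m : R := ln (ev hS (retract z) m) - ln (absc (ch z m)).

(** The modulus is |chi|^(1-t) ev^t on ([ot z])^perp, with unchanged phase; elsewhere the factor
    [ch z m] is 0, whatever the value of [log_gap]. *)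
Definition slide t z m : R[i] := ch z m * (expR (t * log_gap z m))%:C.

Lemma ev_retract_gt0 z m : orth_lattice (val (ot z)) m -> 0 < ev hS (retract z) m.
Proof. by move=> mo; rewrite evE ?mn_retract// expR_gt0. Qed.

Lemma absc_ch_gt0 z m : orth_lattice (val (ot z)) m -> 0 < absc (ch z m).
Proof. by move=> mo; rewrite absc_gt0; exact/(orbit_hom_neq0 _ (ch_hom hS z)). Qed.

Lemma slide_hom t z : @orbit_hom R n Sigma k (ot z) (slide t z).
Proof.
have [c1 cM cK c0] := ch_hom hS z.
have [e1 eM _ _] := ev_hom hS k (retract z); rewrite mn_retract in eM.
rewrite /slide; split=> [|m m' mo mo'|m mo|m mo].
- rewrite c1 mul1r /log_gap c1 absc1; move/complexI : e1 => ->.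
  by rewrite ln1 subrr mulr0 expR0.
- have eM' : ev hS (retract z) (m + m') = ev hS (retract z) m * ev hS (retract z) m'.
    by apply: complexI; rewrite rmorphM -eM.
  rewrite cM// mulrACA -rmorphM -expRD -mulrDr; congr (_ * (expR (_ * _))%:C).
  rewrite /log_gap eM' cM// abscM !lnM ?posrE ?ev_retract_gt0 ?absc_ch_gt0//.
  by rewrite opprD addrACA.
- by apply: scalar_setM; [exact: cK|exact/scalar_setR/expR_ge0].
- by rewrite c0// mul0r.
Qed.

Definition homotopy (p : R * toric) : toric := pt (slide_hom p.1 p.2).

Lemma ot_homotopy p : ot (homotopy p) = ot p.2.
Proof. exact: ot_pt. Qed.

Lemma ch_homotopy p m : ch (homotopy p) m = slide p.1 p.2 m.
Proof. by rewrite ch_pt. Qed.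

Lemma homotopy0 z : homotopy (0, z) = z.
Proof.
apply: (toric_eq (hS := hS)); first exact: ot_homotopy.
by apply/funext => m; rewrite ch_homotopy /slide mul0r expR0 mulr1.
Qed.

Lemma homotopy1 z : homotopy (1, z) = Phi (Psi z).
Proof.
rewrite Phi_pi; apply: (toric_eq (hS := hS)).
  by rewrite ot_homotopy ot_Phi0 mn_retract.
apply/funext => m; rewrite ch_homotopy ch_Phi0 /slide /= mul1r.
have [mo|nmo] := pselect (orth_lattice (val (ot z)) m); last first.
  have [_ _ _ c0] := ch_hom hS z.
  by rewrite c0// mul0r ev_eq0 ?mn_retract// mulr0.
have ap := absc_ch_gt0 mo; have ep := ev_retract_gt0 mo.
rewrite /log_gap expRB !lnK ?posrE// [X in X * _](phaseP hS z m) -mulrA -rmorphM.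
by congr (_ * _%:C); rewrite mulrC divfK ?gt_eqF.
Qed.

Lemma homotopy_Phi t y : homotopy (t, Phi y) = Phi y.
Proof.
rewrite -[y]reprK Phi_pi; move: (repr y) => p.
apply: (toric_eq (hS := hS)); first exact: ot_homotopy.
apply/funext => m; rewrite ch_homotopy /slide /log_gap /= retract_Phi0 ch_Phi0.
by rewrite abscM absc_tval mul1r abscR ?ev_ge0// subrr mulr0 expR0 mulr1.
Qed.

Lemma absz_act g z : absz hS (toric_act g z) = absz hS z.
Proof.
apply: (toric_eq (hS := hS)); first by rewrite !ot_absz ot_act.
by apply/funext => m; rewrite !ch_absz ch_act abscM absc_tval mul1r.
Qed.

Lemma homotopy_equivariant t :
  equivariant (@toric_act R n k Sigma) (@toric_act R n k Sigma) (fun z => homotopy (t, z)).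
Proof.
move=> g z; apply: (toric_eq (hS := hS)); first by rewrite ot_act !ot_homotopy ot_act.
apply/funext => m; rewrite ch_act !ch_homotopy /slide /log_gap /= ch_act.
by rewrite -retract_absz absz_act retract_absz abscM absc_tval mul1r mulrA.
Qed.

(** A geometric mean is at most the larger of its ends. The bound is uniform in [t]. *)
Lemma slide_le t z m : 0 <= t <= 1 ->
  absc (slide t z m) <= absc (ch z m) + ev hS (retract z) m.
Proof.
case/andP => t0 t1; rewrite /slide abscM abscR ?expR_ge0//.
have [mo|nmo] := pselect (orth_lattice (val (ot z)) m); last first.
  have [_ _ _ c0] := ch_hom hS z.
  by rewrite c0// absc0 mul0r add0r ev_ge0.
rewrite -[X in X * _](lnK (absc_ch_gt0 mo)) -[X in X + _](lnK (absc_ch_gt0 mo)).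
rewrite -[X in _ + X](lnK (ev_retract_gt0 mo)) -expRD /log_gap.
move: (ln (absc _)) (ln (ev _ _ _)) => a b.
have [ab|ba] := leP a b.
  by apply: ler_wpDl; [exact: expR_ge0|rewrite ler_expR; nra].
by apply: ler_wpDr; [exact: expR_ge0|rewrite ler_expR; nra].
Qed.

(** On ([ot z0])^perp the logarithms have finite limits. Elsewhere both ends tend to 0 and
    [slide_le] squeezes the path between them. *)
Lemma homotopy_continuous : {within `[0, 1] `*` setT, continuous homotopy}.
Proof.
apply/subspace_continuousP => -[t0 z0] D0.
set D := `[0, 1] `*` setT in D0 *.
have FF : Filter (within D (nbhs (t0, z0))) by exact: within_filter.
have c1 : (p : R * toric).1 @[p --> within D (nbhs (t0, z0))] --> t0.
  by apply: cvg_trans (cvg_app _ (@cvg_within _ (nbhs (t0, z0)) _ D)) _; exact: cvg_fst.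
have c2 : (p : R * toric).2 @[p --> within D (nbhs (t0, z0))] --> z0.
  by apply: cvg_trans (cvg_app _ (@cvg_within _ (nbhs (t0, z0)) _ D)) _; exact: cvg_snd.
apply: toric_cvg.
  have N : \forall p \near within D (nbhs (t0, z0)), sle (ot p.2) (ot z0).
    exact: (c2 _ (near_sle hS z0)).
  by apply: filterS N => p; rewrite !ot_homotopy.
move=> m; rewrite ot_homotopy /= => dm; rewrite ch_homotopy.
rewrite (_ : (fun p => _) = fun p : R * toric => (slide p.1 p.2 m : R[i]^o));
  last by apply/funext => p; exact: ch_homotopy.
have cc : (ch p.2 m : R[i]^o) @[p --> within D (nbhs (t0, z0))] --> (ch z0 m : R[i]^o).
  exact: (cvg_comp _ _ c2 (@ch_cvg R n Sigma k hS z0 m dm)).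
have ca := absc_cvg FF cc.
have ce : ev hS (retract p.2) m @[p --> within D (nbhs (t0, z0))] --> ev hS (retract z0) m.
  have dm' : dual_monoid (val (mn (retract z0))) m by rewrite mn_retract.
  have c3 := cvg_comp _ _ c2 (@retract_continuous R n Sigma k hS z0).
  exact: (cvg_comp _ _ c3 (ev_cvg dm')).
have [mo|nmo] := pselect (orth_lattice (val (ot z0)) m).
  apply: (@cvgM R[i] _ _ FF _ _ _ _ cc); apply: (realC_cvg FF).
  apply: (@cvg_comp _ _ _ (fun p : R * toric => p.1 * log_gap p.2 m) expR
    _ (nbhs (t0 * log_gap z0 m))); last exact: continuous_expR.
  apply: (@cvgM R _ _ FF _ _ _ _ c1); apply: (@cvgB R R _ _ FF).
    exact: (cvg_comp _ _ ce (continuous_ln (ev_retract_gt0 mo))).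
  exact: (cvg_comp _ _ ca (continuous_ln (absc_ch_gt0 mo))).
have s0 : slide t0 z0 m = 0.
  by have [_ _ _ c0] := ch_hom hS z0; rewrite /slide c0// mul0r.
have a0 : absc (ch z0 m) = 0.
  by have [_ _ _ c0] := ch_hom hS z0; rewrite c0// absc0.
have e0 : ev hS (retract z0) m = 0 by rewrite ev_eq0// mn_retract.
rewrite s0; apply: (absc0_cvg FF).
have bound : \forall p \near within D (nbhs (t0, z0)),
    0 <= absc (slide p.1 p.2 m) <= absc (ch p.2 m) + ev hS (retract p.2) m.
  rewrite near_withinE; apply: (@nearW _ (nbhs (t0, z0))) => p [p1 _].
  rewrite absc_ge0/=; apply: slide_le.
  by move: p1; rewrite /= in_itv.
apply: (@squeeze_cvgr _ _ FF _ _ _ _ bound); first exact: cvg_cst.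
rewrite -[X in _ --> X](addr0 0) -{1}a0 -e0.
exact: (@cvgD R R _ _ FF _ _ _ _ ca ce).
Qed.

(** The subspace is the image of [Phi], and the inverse homeomorphism is the restriction of
    [Psi]. *)
Lemma deformation_retract : equivariant_strong_deformation_retract R
  (@Yact R n Sigma k) (@toric_act R n k Sigma).
Proof.
have sA : stable (@toric_act R n k Sigma) (range Phi).
  by move=> g _ [y _ <-]; exists (Yact g y); rewrite ?Phi_equivariant.
exists (range Phi), sA; split.
  have rP y : range Phi (Phi y) by exists y.
  exists (fun y => SigSub (mem_set (rP y)) : range Phi), (fun a : range Phi => Psi (set_val a)).
  split.
  - by move=> y; rewrite set_valE /= PhiK.
  - move=> a; apply: val_inj; rewrite /= set_valE.
    by have [y _ e] := set_valP a; rewrite -e PhiK.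
  - move=> y; apply: (@cvg_initial _ _ (nbhs_filter y)).
    have E w : set_val (SigSub (mem_set (rP w)) : range Phi) = Phi w by rewrite set_valE.
    rewrite E; apply: cvg_trans; last exact: (@Phi_continuous R n Sigma k hS y).
    by apply: (@near_eq_cvg _ _ _ (nbhs_filter y)); apply: (@nearW _ (nbhs y)) => w.
  - move=> a; apply: (@cvg_comp _ _ _ set_val Psi (nbhs a) (nbhs (set_val a))).
      exact: (@initial_continuous _ _ (@set_val _ (range Phi)) a).
    exact: Psi_continuous.
  - by move=> g y; apply: val_inj; rewrite /= Phi_equivariant set_valE.
exists homotopy; split.
- exact: homotopy_continuous.
- exact: homotopy0.
- by move=> z; rewrite homotopy1; exists (Psi z).
- by move=> t _ _ [y _ <-]; exact: homotopy_Phi.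
- by move=> t _; exact: homotopy_equivariant.
Qed.

(** By [ev_surj] the modulus of z is some [phi] y, which [retract] fixes; restoring the phase gives
    z. *)
Lemma complete_homeomorphic : complete Sigma ->
  equivariantly_homeomorphic (@Yact R n Sigma k) (@toric_act R n k Sigma).
Proof.
move=> cS; exists Phi, Psi; split.
- exact: PhiK.
- move=> z; rewrite Phi_pi; have [y [ey evy]] := ev_surj hS z cS.
  have az : absz hS z = phi hS y.
    apply: (toric_eq (hS := hS)); first by rewrite ot_absz ot_phi.
    by apply/funext => m; rewrite ch_absz ch_phi evy.
  have ry : retract z = y by rewrite -retract_absz az retract_phi.
  apply: (toric_eq (hS := hS)); first by rewrite ot_Phi0 /= ry.
  by apply/funext => m; rewrite ch_Phi0 /= ry evy -phaseP.
- exact: Phi_continuous.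
- exact: Psi_continuous.
- exact: Phi_equivariant.
Qed.

End Homotopy.

Theorem theorem2p1 (R : realType) (n : nat) (k : scalars)
    (Sigma : {fset set 'cV[R]_n}) (hSigma : is_fan Sigma) :
  (complete Sigma ->
     equivariantly_homeomorphic (@Yact R n Sigma k) (@toric_act R n k Sigma)) /\
  equivariant_strong_deformation_retract R
    (@Yact R n Sigma k) (@toric_act R n k Sigma).
Proof.
by split; [exact: complete_homeomorphic|exact: deformation_retract].
Qed.
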